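(* Let $X$ be a complex Banach space and let $-A$ be the generator of a bounded $C_0$-semigroup $(T(t))_{t\ge 0}$ on $X$ such that $\overline{\mathrm{ran}}(A)=X$. Let $g$ be a Stieltjes function with representation $(0,0,\mu)$ and $g(0+)=\infty$. Suppose $q$ is a complete Bernstein function such that $$\int_1^\infty\frac{q(\tau)}{\tau^2}\,d\tau<\infty,\qquad \lim_{s\to0+}q(s)=0.$$ If $x\in X$ satisfies $$\|C_t(A)x\|=O\left(\frac{1}{g(1/t)}\right),\qquad t\to\infty,$$ then $x\in\mathrm{dom}((q\circ g)(A))$. In particular, if $\|C_t(A)x\|=O(1/g(1/t))$ as $t\to\infty$, then $x\in\mathrm{dom}([g^\alpha](A))$ for every $\alpha\in(0,1)$.
   Context: Cesàro means: $C_t(A)x:=\frac1t\int_0^t T(s)x\,ds$ for $t>0$, $x\in X$. Stieltjes functions: a Stieltjes function is a function of the form $g(z)=a+\frac bz+\int_{(0,\infty)}\frac{\mu(ds)}{z+s}$, $z>0$, with $a,b\ge0$ and $\mu$ a positive Radon measure on $(0,\infty)$ with $\int_{(0,\infty)}\frac{\mu(ds)}{1+s}<\infty$; $(a,b,\mu)$ is its representation. The formula extends $g$ holomorphically to $\mathbb C_+=\{z:\mathrm{Re}\, z>0\}$. Here $g(0+)=\lim_{s\to0+}g(s)$. Complete Bernstein functions: functions of the form $q(z)=a+bz+\int_{(0,\infty)}\frac{z}{z+s}\,\mu(ds)$, $z>0$, with $a,b\ge0$ and $\mu$ a positive Radon measure on $(0,\infty)$ with $\int_{(0,\infty)}\frac{\mu(ds)}{1+s}<\infty$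 (equivalently, Bernstein functions whose Lévy measure has a completely monotone density). If $q$ is complete Bernstein and $g$ is Stieltjes then $q\circ g$ is a Stieltjes function. Extended Hille–Phillips calculus: let $\mathcal A$ be the set of Laplace transforms $e(z)=\int_{[0,\infty)}e^{-sz}\,\nu(ds)$ of bounded Radon measures $\nu$ on $[0,\infty)$, and for such $e$ put $e(A)=\int_{[0,\infty)}T(s)\,\nu(ds)$ (strongly convergent integral). A holomorphic $h:\mathbb C_+\to\mathbb C$ is regularizable if there is $e\in\mathcal A$ with $eh\in\mathcal A$ and $e(A)$ injective; then $h(A):=e(A)^{-1}(eh)(A)$ with domain $\mathrm{dom}(h(A))=\{x\in X:(eh)(A)x\in\mathrm{ran}(e(A))\}$, and this does not depend on the choice of $e$. When $\overline{\mathrm{ran}}(A)=X$ (so that $\ker A=\{0\}$), every Stieltjes function is regularizable by $e(z)=z/(z+1)$; the operators $(q\circ g)(A)$ and $[g^\alpha](A)$ are those assigned by this calculus to the Stieltjes functions $q\circ g$ and $g^\alpha$. *)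

(* Defs.v *)
From HB Require Import structures.
From mathcomp Require Import all_boot all_order all_algebra.
From mathcomp Require Import all_classical all_reals all_analysis.
From mathcomp.real_closed Require Import complex.

Set Implicit Arguments.
Unset Strict Implicit.
Unset Printing Implicit Defensive.

Import Order.TTheory GRing.Theory Num.Theory.
Import numFieldNormedType.Exports.

Local Open Scope classical_set_scope.
Local Open Scope ring_scope.
Local Open Scope complex_scope.

(* The norm of a normed module over R[i] takes its (real) values in R[i]. *)
Definition rnorm (R : realType) (X : normedModType R[i]) (x : X) : R :=
  complex.Re `|x|.

Section Bochner.
Context d (S : measurableType d) (R : realType) (X : normedModType R[i]).
Variables (mu : {measure set S -> \bar R}) (D : set S).

(* The sequence [:: (A_1, x_1); ...; (A_n, x_n)] encodes the simple function
   \1_(A_1) x_1 + ... + \1_(A_n) x_n; the A_k need not be disjoint. *)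
Definition simple_eval (s : seq (set S * X)) (w : S) : X :=
  \sum_(p <- s) (\1_(p.1) w : R[i]) *: p.2.

Definition simple_integrable (s : seq (set S * X)) : Prop :=
  forall p : set S * X, p \in s ->
    measurable p.1 /\ (mu (p.1 `&` D) < +oo)%E.

Definition simple_integral (s : seq (set S * X)) : X :=
  \sum_(p <- s) (fine (mu (p.1 `&` D)))%:C *: p.2.

Definition is_bochner_integral (f : S -> X) (y : X) : Prop :=
  exists s : nat -> seq (set S * X),
    [/\ forall n, simple_integrable (s n),
        forall n, measurable_fun D (fun w => rnorm (f w - simple_eval (s n) w)),
        (fun n => \int[mu]_(w in D) (rnorm (f w - simple_eval (s n) w))%:E)%E
          @ \oo --> 0%E &
        (fun n => simple_integral (s n)) @ \oo --> y].

(* The value is the junk value 0 when f is not Bochner integrable; below the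
   integrands are bounded continuous and the measures finite on D. *)
Definition bochner_integral (f : S -> X) : X :=
  xget 0 [set y | is_bochner_integral f y].

End Bochner.

Section Semigroup.
Context (R : realType) (X : normedModType R[i]).

(* Only the values T t with 0 <= t matter. *)
Definition C0_semigroup (T : R -> X -> X) : Prop :=
  [/\ forall t : R, 0 <= t -> linear (T t),
      forall t : R, 0 <= t -> continuous (T t),
      forall x, T 0 x = x,
      forall (s t : R) x, 0 <= s -> 0 <= t -> T (s + t) x = T s (T t x) &
      forall x, T t x @[t --> 0^'+] --> x].

Definition bounded_semigroup (T : R -> X -> X) : Prop :=
  exists M : R, forall (t : R) x, 0 <= t -> rnorm (T t x) <= M * rnorm x.

(* Unbounded operators are given by their graphs. *)
Definition op_dom (A : set (X * X)) : set X := [set x | exists y, A (x, y)].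

Definition op_ran (A : set (X * X)) : set X := [set y | exists x, A (x, y)].

Definition op_opp (A : set (X * X)) : set (X * X) := [set p | A (p.1, - p.2)].

Definition generator (T : R -> X -> X) : set (X * X) :=
  [set p | (h^-1)%:C *: (T h p.1 - p.1) @[h --> 0^'+] --> p.2].

Definition cesaro_mean (T : R -> X -> X) (t : R) (x : X) : X :=
  (t^-1)%:C *:
    bochner_integral (@lebesgue_measure R) `[0, t] (fun s => T s x).

End Semigroup.

(* Only the restrictions of g, q and mu to ]0, +oo[ matter; the integrability
   condition makes that restriction of mu finite on compact sets, i.e. Radon. *)

Definition levy_integrable (R : realType)
    (mu : {measure set (measurableTypeR R) -> \bar R}) : Prop :=
  (\int[mu]_(s in `]0%R, +oo[) ((1 + s)^-1)%:E < +oo)%E.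

Definition stieltjes_rep (R : realType) (g : R -> R) (a b : R)
    (mu : {measure set (measurableTypeR R) -> \bar R}) : Prop :=
  [/\ 0 <= a, 0 <= b, levy_integrable mu &
      forall z : R, 0 < z ->
        g z = a + b / z + (\int[mu]_(s in `]0%R, +oo[) (z + s)^-1)%R].

Definition complete_bernstein (R : realType) (q : R -> R) : Prop :=
  exists (a b : R) (mu : {measure set (measurableTypeR R) -> \bar R}),
  [/\ 0 <= a, 0 <= b, levy_integrable mu &
      forall z : R, 0 < z ->
        q z = a + b * z + (\int[mu]_(s in `]0%R, +oo[) (z / (z + s)))%R].

(* A bounded complex Radon measure on [0, +oo[, given as
   (re_pos - re_neg) + i (im_pos - im_neg) for finite positive Borel measures
   (e.g. by Jordan decomposition); only the restrictions to [0, +oo[ matter. *)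
Record cmeasure (R : realType) := CMeasure {
  re_pos : {finite_measure set (measurableTypeR R) -> \bar R};
  re_neg : {finite_measure set (measurableTypeR R) -> \bar R};
  im_pos : {finite_measure set (measurableTypeR R) -> \bar R};
  im_neg : {finite_measure set (measurableTypeR R) -> \bar R} }.

Definition cexp (R : realType) (z : R[i]) : R[i] :=
  (expR (complex.Re z))%:C *
  (cos (complex.Im z) +i* sin (complex.Im z)).

Definition laplace_pos (R : realType)
    (mu : {measure set (measurableTypeR R) -> \bar R}) (z : R[i]) : R[i] :=
  (\int[mu]_(s in `[0%R, +oo[) complex.Re (cexp (- s%:C * z)))%R +i*
  (\int[mu]_(s in `[0%R, +oo[) complex.Im (cexp (- s%:C * z)))%R.

Definition laplace (R : realType) (nu : cmeasure R) (z : R[i]) : R[i] :=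
  (laplace_pos (re_pos nu) z - laplace_pos (re_neg nu) z) +
  'i%C * (laplace_pos (im_pos nu) z - laplace_pos (im_neg nu) z).

Section Calculus.
Context (R : realType) (X : normedModType R[i]).
Variable T : R -> X -> X.

Definition hp_pos (mu : {measure set (measurableTypeR R) -> \bar R}) (x : X) :
    X :=
  bochner_integral mu `[0, +oo[ (fun s => T s x).

(* e(A) for e = laplace nu *)
Definition hp (nu : cmeasure R) (x : X) : X :=
  (hp_pos (re_pos nu) x - hp_pos (re_neg nu) x) +
  'i%C *: (hp_pos (im_pos nu) x - hp_pos (im_neg nu) x).

Definition regularizes (H : R[i] -> R[i]) (nu sigma : cmeasure R) : Prop :=
  injective (hp nu) /\
  forall z : R[i], 0 < complex.Re z -> laplace nu z * H z = laplace sigma z.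

(* The graph of H(A); it is empty when H is not regularizable. *)
Definition ext_hp (H : R[i] -> R[i]) : set (X * X) :=
  [set p | exists nu sigma, regularizes H nu sigma /\ hp nu p.2 = hp sigma p.1].

Definition holomorphic_extension (h : R -> R) (H : R[i] -> R[i]) : Prop :=
  (forall z : R[i], 0 < complex.Re z -> derivable (H : R[i]^o -> R[i]^o) z 1) /\
  (forall t : R, 0 < t -> H t%:C = (h t)%:C).

(* The graph of h(A) for a function h on ]0, +oo[ such as a Stieltjes function:
   the values on the half-plane of the holomorphic extension H are determined
   by h (identity theorem), and for a Stieltjes function H is given by the
   integral formula at complex z. *)
Definition ext_hp_real (h : R -> R) : set (X * X) :=
  [set p | exists2 H, holomorphic_extension h H & ext_hp H p].

End Calculus.

(* Main.v *)
Require Import Defs.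
From HB Require Import structures.
From mathcomp Require Import all_boot all_order all_algebra.
From mathcomp Require Import all_classical all_reals all_analysis.
From mathcomp Require Import measurable_realfun.
From mathcomp.real_closed Require Import complex.
From mathcomp Require Import lra ring.

Set Implicit Arguments.
Unset Strict Implicit.
Unset Printing Implicit Defensive.

Import Order.TTheory GRing.Theory Num.Theory.
Import numFieldNormedType.Exports.

Local Open Scope classical_set_scope.
Local Open Scope ring_scope.
Local Open Scope complex_scope.

(* Every operator used below is f(A) for a difference f of two Laplace transforms
   of finite positive measures on the half-line.  By uniqueness of the Laplace
   transform, f |-> f(A) is a well-defined algebra morphism on such functions of
   a real variable, bounded by the total mass, so that identities between
   operators reduce to identities between real functions.

   Write f_s = g/(g+s), psi_s = 1 - f_s = s/(g+s), and q = \int z/(z+s) nu(ds),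
   so that q o g = \int f_s nu(ds).  The point is the bound
   |f_s(A) x| = O((1 + ln s)/s) for s >= 1: since
   \int_1^oo q(t)/t^2 dt = \int ln(1+s)/s nu(ds), it makes
   \int f_s(A) x nu(ds) converge absolutely, to the value (q o g)(A) x.

   - The operators psi_s(A) are bounded uniformly in s.  With zeta = c/(z+c) and c
     such that g(c) is a small multiple of s, the part of mu below c/2 turns
     1 + g/s into a power series in zeta whose coefficients are moments, hence
     log-convex; by Kaluza's theorem its reciprocal is 1 - P(zeta) with P having
     nonnegative coefficients of sum at most 1.  The part of mu above c/2 is a
     small perturbation.
   - Abel summation turns the growth bound on the Cesaro means into
     |(A+p)^-1 x| = O(1/(p g(p))) for p <= 1.  Cutting mu into dyadic blocks,
     each of which is (z+P)^-1 times a bounded symbol, gives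
     |(z/(z+r) g)(A) x| = O(1 + ln g(r)), and then the bound on f_s(A) x by
     choosing r with g(r) comparable to s. *)

(** * Bochner integrals *)

(** As g blows up at 0, f_s is a Stieltjes function with f_s(0+) = 1, so abstractly it is the
    Laplace transform of a probability measure and psi_s has mass at most 2. That fact comes from
    the complex-analytic description of Stieltjes functions; Kaluza's theorem is a real-variable
    substitute, and yields the masses 4 and 5 instead.

    Uniform boundedness of f_s(A) alone does not suffice: nu may have infinite mass near infinity,
    so decay in s has to come from the vector x.

    Since q o g may be unbounded near 0, it may lie outside the calculus of finite measures.
    Multiplied by e(z) = z/(z+1) it lies inside: e g has finite mass, and e f_s = e g psi_s / s then
    has mass O(1/s), which is nu-integrable at infinity. The domain condition becomes the equation
    e(A) y = (e (q o g))(A) x, where y is the sum of the vectors produced by the decay of f_s(A) x.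

    No operator-valued integral over s is formed. The half-line is cut into geometric blocks, and on
    a block with right end S the integral of f_s is f_S times a symbol given by a power series in
    psi_S. *)

Section RealNorm.
Context (R : realType) (X : normedModType R[i]).
Implicit Types (x y : X) (a : R).

Lemma rnormE x : `|x| = (rnorm x)%:C.
Proof. by rewrite /rnorm RRe_real// normr_real. Qed.

Lemma rnorm_ge0 x : 0 <= rnorm x.
Proof. by rewrite -lecR -rnormE normr_ge0. Qed.

Lemma rnorm0 : rnorm (0 : X) = 0.
Proof. by rewrite /rnorm normr0. Qed.

Lemma rnorm_eq0 x : rnorm x = 0 -> x = 0.
Proof. by move=> x0; apply/normr0_eq0; rewrite rnormE x0. Qed.

Lemma rnormD x y : rnorm (x + y) <= rnorm x + rnorm y.
Proof. by rewrite -lecR rmorphD /= -!rnormE ler_normD. Qed.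

Lemma rnormN x : rnorm (- x) = rnorm x.
Proof. by rewrite /rnorm normrN. Qed.

Lemma rnormB x y : rnorm (x - y) <= rnorm x + rnorm y.
Proof. by rewrite -(rnormN y) rnormD. Qed.

Lemma rnorm_distC x y : rnorm (x - y) = rnorm (y - x).
Proof. by rewrite -rnormN opprB. Qed.

Lemma rnormZ a x : rnorm (a%:C *: x) = `|a| * rnorm x.
Proof.
apply: complexI; rewrite rmorphM /= -rnormE normrZ rnormE; congr (_ * _).
by rewrite normc_def /= expr0n addr0 sqrtr_sqr.
Qed.

Lemma rnorm_sum (I : Type) (s : seq I) (P : pred I) (F : I -> X) :
  rnorm (\sum_(i <- s | P i) F i) <= \sum_(i <- s | P i) rnorm (F i).
Proof.
elim/big_rec2: _ => [|i y1 y2 _ h]; first by rewrite rnorm0.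
by rewrite (le_trans (rnormD _ _))// lerD2l.
Qed.

Lemma rnorm_dist_triangle y x z : rnorm (x - z) <= rnorm (x - y) + rnorm (y - z).
Proof. by rewrite (le_trans _ (rnormD _ _))// addrA subrK. Qed.

Lemma cvg_rnormP (I : Type) (F : set_system I) {FF : Filter F} (f : I -> X) (l : X) :
  f @ F --> l <-> forall e : R, 0 < e -> \forall t \near F, rnorm (f t - l) < e.
Proof.
split=> [/cvgrPdist_lt fl e e0|fl].
  have := fl e%:C; rewrite ltcR => /(_ e0); apply: filterS => t.
  by rewrite rnormE ltcR rnorm_distC.
apply/cvgrPdist_lt => e e0.
have eE : e = (complex.Re e)%:C by rewrite RRe_real// gtr0_real.
have := fl (complex.Re e); rewrite -ltcR -eE => /(_ e0); apply: filterS => t.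
by rewrite rnormE eE ltcR rnorm_distC.
Qed.

Lemma cvg_rnorm0P (I : Type) (F : set_system I) {FF : Filter F} (f : I -> X) (l : X) :
  f @ F --> l <-> (fun t => rnorm (f t - l)) @ F --> (0 : R).
Proof.
rewrite cvg_rnormP; split=> [fl|/cvgrPdist_lt fl e e0].
  apply/cvgrPdist_lt => e e0; have := fl _ e0; apply: filterS => t.
  by rewrite sub0r normrN ger0_norm// rnorm_ge0.
have := fl _ e0; apply: filterS => t.
by rewrite sub0r normrN ger0_norm// rnorm_ge0.
Qed.

Lemma cvg_rnorm_squeeze (I : Type) (F : set_system I) {FF : Filter F}
    (f : I -> X) (l : X) (u : I -> R) :
  (\forall t \near F, rnorm (f t - l) <= u t) -> u @ F --> (0 : R) -> f @ F --> l.
Proof.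
move=> fu u0; apply/cvg_rnorm0P; apply: (squeeze_cvgr _ (cvg_cst 0) u0).
by apply: filterS fu => t ->; rewrite rnorm_ge0.
Qed.

Lemma cvg_rnorm (I : Type) (F : set_system I) {FF : Filter F}
    (f : I -> X) (l : X) : f @ F --> l -> (fun t => rnorm (f t)) @ F --> rnorm l.
Proof.
move=> /cvg_rnormP fl; apply/cvgrPdist_lt => e e0; have := fl _ e0.
apply: filterS => t; apply: le_lt_trans; rewrite ler_norml.
have := rnorm_dist_triangle (f t) l 0; have := rnorm_dist_triangle l (f t) 0.
rewrite !subr0 [rnorm (l - _)]rnorm_distC => h1 h2; apply/andP; split; lra.
Qed.

Lemma rnorm_cvg_le (f : nat -> X) (l : X) (c : R) :
  f @ \oo --> l -> (forall n, rnorm (f n) <= c) -> rnorm l <= c.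
Proof.
move=> /cvg_rnorm fl fc; rewrite -(cvg_lim (@Rhausdorff R) fl).
apply: limr_le; first by apply/cvg_ex; eexists; exact: fl.
exact: nearW.
Qed.

Lemma cvg_vec_unique (f : nat -> X) (l l' : X) :
  f @ \oo --> l -> f @ \oo --> l' -> l = l'.
Proof. exact: (@cvg_unique _ (@norm_hausdorff _ X) (f @ \oo)). Qed.

End RealNorm.

Section Completeness.
Context (R : realType) (X : completeNormedModType R[i]).

Lemma rnorm_cauchy_cvg (u : nat -> X) (r : nat -> R) :
  r @ \oo --> (0 : R) -> (forall m n, (m <= n)%N -> rnorm (u n - u m) <= r m) ->
  cvg (u @ \oo).
Proof.
move=> r0 ur; apply/cauchy_cvgP/cauchy_ballP => e e0.
have eE : e = (complex.Re e)%:C by rewrite RRe_real// gtr0_real.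
have e0' : 0 < complex.Re e by rewrite -ltcR -eE.
have [N _ hN] : \forall n \near \oo, `|r n| < complex.Re e / 2.
  have /cvgrPdist_lt /(_ (complex.Re e / 2)) := r0; rewrite divr_gt0// => /(_ isT).
  by apply: filterS => n; rewrite sub0r normrN.
have main n : (N <= n)%N -> rnorm (u n - u N) < complex.Re e / 2.
  by move=> Nn; rewrite (le_lt_trans (ur _ _ Nn))// (le_lt_trans (ler_norm _))// hN/=.
pose V := u @` [set n | (N <= n)%N].
have uV : (u @ \oo) V by exists N => // n Nn; exists n.
exists (V, V) => //= -[_ _] /= [[m Nm <-] [n Nn <-]]; rewrite -ball_normE /= rnormE eE ltcR.
rewrite (le_lt_trans (rnorm_dist_triangle (u N) _ _))// [X in _ + X]rnorm_distC.
by have := main _ Nm; have := main _ Nn; lra.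
Qed.

(** Absolute convergence, with the tail of the scalar series as Cauchy modulus. It will produce the
    vectors whose sum is (q o g)(A) x. *)
Lemma rnorm_series_cvg (x : nat -> X) (c : nat -> R) (C : R) :
  (forall n, rnorm (x n) <= c n) -> (forall N, \sum_(n < N) c n <= C) ->
  exists y : X, (fun N => \sum_(n < N) x n) @ \oo --> y.
Proof.
move=> xc cC.
have c0 n : 0 <= c n by rewrite (le_trans _ (xc n))// rnorm_ge0.
pose s N := \sum_(n < N) c n.
have ns : {homo s : n m / (n <= m)%N >-> n <= m}.
  by apply/nondecreasing_seqP => n; rewrite /s big_ord_recr/= lerDl.
have cs : s @ \oo --> sup (range s).
  by apply: nondecreasing_cvgn => //; exists C => _ [N _ <-]; exact: cC.
have bs N : s N <= sup (range s).
  apply: ub_le_sup; last by exists N.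
  by exists C => _ [M _ <-]; exact: cC.
apply/cvg_ex.
apply: (@rnorm_cauchy_cvg _ (fun N => sup (range s) - s N)).
  by rewrite -(subrr (sup (range s))); apply: cvgB => //; exact: cvg_cst.
move=> m n mn; apply: (@le_trans _ _ (s n - s m)); last by rewrite lerB.
rewrite -(subnKC mn) /s !big_split_ord /= ![_ + _ - _]addrC !addKr.
by rewrite (le_trans (rnorm_sum _ _ _))// ler_sum.
Qed.

End Completeness.

Lemma cvg_rnorm_esqueeze (R : realType) (X : normedModType R[i])
    (f : nat -> X) (l : X) (u : nat -> \bar R) :
  (forall n, ((rnorm (f n - l))%:E <= u n)%E) -> u @ \oo --> 0%E -> f @ \oo --> l.
Proof.
move=> fu /fine_cvgP[fu0 cu]; apply: cvg_rnorm_squeeze cu.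
by apply: filterS fu0 => n un; rewrite -lee_fin /= fineK.
Qed.

(** * Simple functions and uniqueness of the Bochner integral *)

Section SimpleFunctions.
Context d (S : measurableType d) (R : realType) (X : normedModType R[i]).
Implicit Types (B : set S) (s : seq (set S * X)) (f : S -> X) (v : X).

Definition meas_sets s := forall p, p \in s -> measurable p.1.

Lemma meas_sets_cons p s : meas_sets (p :: s) -> measurable p.1 /\ meas_sets s.
Proof.
move=> h; split; first by apply: h; rewrite mem_head.
by move=> q qs; apply: h; rewrite inE qs orbT.
Qed.

Lemma meas_sets_cat s s' : meas_sets s -> meas_sets s' -> meas_sets (s ++ s').
Proof. by move=> h h' p; rewrite mem_cat => /orP[/h|/h']. Qed.

Lemma simple_eval_cons p s w :
  simple_eval (p :: s) w = (\1_(p.1) w : R[i]) *: p.2 + simple_eval s w.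
Proof. by rewrite /simple_eval big_cons. Qed.

Lemma simple_eval_in p s w : p.1 w ->
  simple_eval (p :: s) w = p.2 + simple_eval s w.
Proof. by move=> pw; rewrite simple_eval_cons indicE mem_set// scale1r. Qed.

Lemma simple_eval_out p s w : ~ p.1 w ->
  simple_eval (p :: s) w = simple_eval s w.
Proof. by move=> pw; rewrite simple_eval_cons indicE memNset// scale0r add0r. Qed.

(** Only real functions are tested for measurability, X carrying no sigma-algebra here. The
    induction cuts the domain along the first set of s; where that set holds, its value is absorbed
    into the constant v, which is why B and v are general. *)
Lemma measurable_rnorm_simple f B s v : measurable B -> meas_sets s ->
  (forall c, measurable_fun B (fun w => rnorm (f w - c))) ->
  measurable_fun B (fun w => rnorm (f w - (v + simple_eval s w))).
Proof.
move=> mB ms mf; elim: s B v ms mB mf => [|p s IH] B v ms mB mf.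
  apply: eq_measurable_fun (mf v) => w _.
  by rewrite /simple_eval big_nil addr0.
have [mp mss] := meas_sets_cons ms.
rewrite -(setUIDK B p.1).
have mBp : measurable (B `&` p.1) by exact: measurableI.
have mBNp : measurable (B `\` p.1) by exact: measurableD.
apply/measurable_funU => //; split.
- apply: (@eq_measurable_fun _ _ _ _ _ (fun w => rnorm (f w - ((v + p.2) + simple_eval s w)))).
    by move=> w /set_mem[_ pw]; rewrite simple_eval_in// addrA.
  by apply: IH => // c; apply: measurable_funS (mf c) => //; exact: subIsetl.
- apply: (@eq_measurable_fun _ _ _ _ _ (fun w => rnorm (f w - (v + simple_eval s w)))).
    by move=> w /set_mem[_ pw]; rewrite simple_eval_out.
  by apply: IH => // c; apply: measurable_funS (mf c) => //; exact: subDsetl.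
Qed.

Variable mu : {measure set S -> \bar R}.

Lemma simple_integral_cons B p s : simple_integral mu B (p :: s) =
  (fine (mu (p.1 `&` B)))%:C *: p.2 + simple_integral mu B s.
Proof. by rewrite /simple_integral big_cons. Qed.

Lemma simple_integral_cat B s s' : simple_integral mu B (s ++ s') =
  simple_integral mu B s + simple_integral mu B s'.
Proof. by rewrite /simple_integral big_cat. Qed.

Lemma simple_integral_setU B B' s : measurable B -> measurable B' ->
  (mu B < +oo)%E -> (mu B' < +oo)%E -> B `&` B' = set0 -> meas_sets s ->
  simple_integral mu (B `|` B') s = simple_integral mu B s + simple_integral mu B' s.
Proof.
move=> mB mB' muB muB' BB'; elim: s => [|p s IH] ms.
  by rewrite /simple_integral !big_nil addr0.
have [mp mss] := meas_sets_cons ms.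
rewrite !simple_integral_cons IH// addrACA -scalerDl; congr (_ *: _ + _).
rewrite -rmorphD /=; congr (_ %:C).
have fB A : measurable A -> (mu A < +oo)%E -> mu (p.1 `&` A) \is a fin_num.
  move=> mA muA; rewrite ge0_fin_numE// (le_lt_trans _ muA)// le_measure ?inE//.
  exact: measurableI.
rewrite -fineD ?fB// setIUr measureU//; [exact: measurableI..|].
by rewrite setIACA BB' setI0.
Qed.

(** The sets of s may overlap, so a termwise triangle inequality would only bound the sum of the
    norms. B is cut along the first set, and v collects the values already known to be constant on
    the current piece. *)
Lemma simple_integral_norm_gen B s v : measurable B -> (mu B < +oo)%E -> meas_sets s ->
  ((rnorm ((fine (mu B))%:C *: v + simple_integral mu B s))%:E <=
   \int[mu]_(w in B) (rnorm (v + simple_eval s w))%:E)%E.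
Proof.
elim: s B v => [|p s IH] B v mB muB ms.
  under eq_integral do rewrite /simple_eval big_nil addr0.
  rewrite integral_cst// /simple_integral big_nil addr0 rnormZ.
  have fB : mu B \is a fin_num by rewrite ge0_fin_numE.
  by rewrite ger0_norm ?fine_ge0// EFinM fineK// muleC.
have [mp mss] := meas_sets_cons ms.
have mBp : measurable (B `&` p.1) by exact: measurableI.
have mBNp : measurable (B `\` p.1) by exact: measurableD.
have sub A : measurable A -> A `<=` B -> (mu A < +oo)%E.
  by move=> mA AB; rewrite (le_lt_trans _ muB)// le_measure ?inE.
have muBp := sub _ mBp (@subIsetl _ _ _).
have muBNp := sub _ mBNp (@subDsetl _ _ _).
have BB : (B `&` p.1) `&` (B `\` p.1) = set0.
  by rewrite setDE setIACA setICr setI0.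
rewrite -[in leRHS](setUIDK B p.1) ge0_integral_setU//; last 3 first.
- apply/measurable_EFinP.
  rewrite setUIDK; apply: eq_measurable_fun (@measurable_rnorm_simple (cst (- v)) B (p :: s) 0 mB ms _).
    by move=> w _; rewrite add0r -opprD rnormN.
  by move=> c; exact: (@measurable_cst _ _ _ _ _ (rnorm (- v - c))).
- by move=> w _; rewrite lee_fin rnorm_ge0.
- by rewrite disj_set2E BB.
have e1 : (fine (mu B))%:C *: v + simple_integral mu B (p :: s) =
  ((fine (mu (B `&` p.1)))%:C *: (v + p.2) + simple_integral mu (B `&` p.1) s) +
  ((fine (mu (B `\` p.1)))%:C *: v + simple_integral mu (B `\` p.1) s).
  rewrite addrACA -simple_integral_setU// setUIDK simple_integral_cons scalerDr.
  rewrite addrA (setIC p.1); congr (_ + _).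
  rewrite addrAC -scalerDl -rmorphD /= -fineD ?ge0_fin_numE//.
  by rewrite -measureU// setUIDK.
rewrite e1 (@le_trans _ _ ((rnorm ((fine (mu (B `&` p.1)))%:C *: (v + p.2) + simple_integral mu (B `&` p.1) s))%:E +
  (rnorm ((fine (mu (B `\` p.1)))%:C *: v + simple_integral mu (B `\` p.1) s))%:E)%E)//.
  by rewrite -EFinD lee_fin rnormD.
apply: leeD.
- apply: (le_trans (IH _ _ mBp muBp mss)); rewrite le_eqVlt; apply/orP; left; apply/eqP.
  by apply: eq_integral => w /set_mem[_ pw]; rewrite simple_eval_in// addrA.
- apply: (le_trans (IH _ _ mBNp muBNp mss)); rewrite le_eqVlt; apply/orP; left; apply/eqP.
  by apply: eq_integral => w /set_mem[_ pw]; rewrite simple_eval_out.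
Qed.

Lemma simple_integral_norm B s : measurable B -> (mu B < +oo)%E -> meas_sets s ->
  ((rnorm (simple_integral mu B s))%:E <=
   \int[mu]_(w in B) (rnorm (simple_eval s w))%:E)%E.
Proof.
move=> mB muB ms; have := simple_integral_norm_gen 0 mB muB ms.
by rewrite scaler0 add0r; under eq_integral do rewrite add0r.
Qed.

Definition simple_opp s := [seq (p.1, - p.2) | p <- s].

Lemma meas_sets_opp s : meas_sets s -> meas_sets (simple_opp s).
Proof. by move=> ms p /mapP[q qs ->] /=; exact: ms qs. Qed.

Lemma simple_eval_sub s s' w :
  simple_eval (s ++ simple_opp s') w = simple_eval s w - simple_eval s' w.
Proof.
rewrite /simple_eval big_cat /=; congr (_ + _).
by rewrite big_map -sumrN; apply: eq_bigr => p _; rewrite scalerN.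
Qed.

Lemma simple_integral_sub B s s' : simple_integral mu B (s ++ simple_opp s') =
  simple_integral mu B s - simple_integral mu B s'.
Proof.
rewrite simple_integral_cat; congr (_ + _).
by rewrite /simple_integral big_map -sumrN; apply: eq_bigr => p _; rewrite scalerN.
Qed.

Lemma simple_integral_dist B s s' f : measurable B -> (mu B < +oo)%E ->
  meas_sets s -> meas_sets s' ->
  measurable_fun B (fun w => rnorm (f w - simple_eval s w)) ->
  measurable_fun B (fun w => rnorm (f w - simple_eval s' w)) ->
  ((rnorm (simple_integral mu B s - simple_integral mu B s'))%:E <=
   \int[mu]_(w in B) (rnorm (f w - simple_eval s w))%:E +
   \int[mu]_(w in B) (rnorm (f w - simple_eval s' w))%:E)%E.
Proof.
move=> mB muB ms ms' mf mf'.
rewrite -simple_integral_sub.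
have mm := meas_sets_cat ms (meas_sets_opp ms').
apply: (le_trans (simple_integral_norm mB muB mm)).
rewrite -ge0_integralD//; last 4 first.
- by move=> w _; rewrite lee_fin rnorm_ge0.
- exact/measurable_EFinP.
- by move=> w _; rewrite lee_fin rnorm_ge0.
- exact/measurable_EFinP.
apply: ge0_le_integral => //.
- by move=> w _; rewrite lee_fin rnorm_ge0.
- apply/measurable_EFinP.
  apply: eq_measurable_fun (@measurable_rnorm_simple (cst 0) B _ 0 mB mm _).
    by move=> w _; rewrite /= !add0r rnormN.
  by move=> c; exact: (@measurable_cst _ _ _ _ _ (rnorm (0 - c))).
- by apply/measurable_EFinP; exact: measurable_funD.
- move=> w _; rewrite lee_fin simple_eval_sub [X in _ <= X + _]rnorm_distC.
  exact: rnorm_dist_triangle.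
Qed.

Lemma simple_integrableP B s : measurable B -> (mu B < +oo)%E -> meas_sets s ->
  simple_integrable mu B s.
Proof.
move=> mB muB ms p ps; split; first exact: ms.
rewrite (le_lt_trans _ muB)// le_measure ?inE//; apply: measurableI => //; exact: ms.
Qed.

(** The integrals of two approximating sequences differ by at most the sum of their L1 errors. As
    [bochner_integral] is defined by choice, this identifies it with any limit found by hand. *)
Lemma bochner_integral_unique B f y y' : measurable B -> (mu B < +oo)%E ->
  is_bochner_integral mu B f y -> is_bochner_integral mu B f y' -> y = y'.
Proof.
move=> mB muB [s [si sm s0 sy]] [s' [si' sm' s0' sy']].
suff : (fun n => simple_integral mu B (s n) - simple_integral mu B (s' n)) @ \oo --> (0 : X).
  move=> h; apply/eqP; rewrite -subr_eq0; apply/eqP.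
  exact: (cvg_vec_unique (cvgB sy sy') h).
apply: (@cvg_rnorm_esqueeze _ _ _ _ (fun n =>
    \int[mu]_(w in B) (rnorm (f w - simple_eval (s n) w))%:E +
    \int[mu]_(w in B) (rnorm (f w - simple_eval (s' n) w))%:E)%E) => [n|].
  rewrite subr0; apply: simple_integral_dist => //.
    by move=> p /(si n)[].
  by move=> p /(si' n)[].
by rewrite -[X in _ --> X](adde0 0%E); apply: cvgeD.
Qed.

End SimpleFunctions.

Lemma bounded_cvg_integral0 d (S : measurableType d) (R : realType)
    (m : {measure set S -> \bar R}) (E : set S) (u : nat -> S -> R) (C : R) :
  measurable E -> (m E < +oo)%E -> (forall n, measurable_fun E (u n)) ->
  (forall n w, E w -> 0 <= u n w <= C) ->
  (forall w, E w -> u ^~ w @ \oo --> (0 : R)) ->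
  (fun n => \int[m]_(w in E) (u n w)%:E)%E @ \oo --> 0%E.
Proof.
move=> mE fE mu uC u0.
have cv : {ae m, forall x, E x -> (fun n => (u n x)%:E) @ \oo --> cst 0%E x}.
  by apply: aeW => w Ew; apply: cvg_EFin; [exact: nearW|exact: u0].
have ic : m.-integrable E (cst C%:E).
  apply/integrableP; split; first exact: measurable_cst.
  by rewrite /= integral_cst// lte_mul_pinfty.
have dom : {ae m, forall x n, E x -> (`|(u n x)%:E| <= cst C%:E x)%E}.
  by apply: aeW => w n Ew /=; rewrite lee_fin; have /andP[h ?] := uC n w Ew; rewrite ger0_norm.
have mu' n : measurable_fun E (fun x => (u n x)%:E) by apply/measurable_EFinP.
have [_ _] := dominated_convergence mE mu' (measurable_cst _) cv ic dom.
by rewrite integral0.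
Qed.

Lemma dist_max0 (R : realType) (w v : R) : `|Num.max w 0 - Num.max v 0| <= `|w - v|.
Proof.
have h1 := ler_norm (w - v); have h2 := ler_norm (v - w); rewrite distrC in h2.
by rewrite /Num.max; case: ltP => w0; case: ltP => v0; rewrite ler_norml; apply/andP; split; lra.
Qed.

(** * Riemann sums of bounded uniformly continuous functions on the half-line *)

Section RiemannSums.
Context (R : realType) (X : completeNormedModType R[i]).
Implicit Types (f : R -> X) (E : set (measurableTypeR R)).

Definition mesh (n : nat) : R := n.+1%:R^-1.

Lemma mesh_gt0 n : 0 < mesh n. Proof. by rewrite invr_gt0 ltr0n. Qed.

Definition cell (n k : nat) : set (measurableTypeR R) :=
  `[k%:R * mesh n, k.+1%:R * mesh n[%classic.

Lemma measurable_cell n k : measurable (cell n k).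
Proof. exact: measurable_itv. Qed.

(** With mesh 1/(n+1), the (n+1)^2 cells cover [0, n+1): the single index n both refines the mesh
    and exhausts the half-line. The values are taken at the left ends. *)
Definition rsum f (n : nat) : seq (set (measurableTypeR R) * X) :=
  [seq (cell n k, f (k%:R * mesh n)) | k <- iota 0 (n.+1 * n.+1)].

Lemma meas_sets_rsum f n : meas_sets (rsum f n).
Proof. by move=> p /mapP[k _ ->]; exact: measurable_cell. Qed.

Lemma rsum_eval_sum f n w : simple_eval (rsum f n) w =
  \sum_(k < n.+1 * n.+1) (\1_(cell n k) w : R[i]) *: f (k%:R * mesh n).
Proof.
rewrite -(big_mkord xpredT (fun k => (\1_(cell n k) w : R[i]) *: f (k%:R * mesh n))).
by rewrite /index_iota subn0 /simple_eval big_map.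
Qed.

Lemma cellP n k (w : R) : cell n k w <-> (k%:R <= w * n.+1%:R < k.+1%:R).
Proof. by rewrite /cell /= in_itv /= ler_pdivrMr// ltr_pdivlMr. Qed.

Lemma cell_trunc n k (w : R) : 0 <= w -> cell n k w <-> k = Num.truncn (w * n.+1%:R).
Proof.
move=> w0; rewrite cellP; split=> [/truncn_def//|->].
by rewrite truncn_itv// mulr_ge0.
Qed.

Lemma rsum_eval_in f n (w : R) : 0 <= w < n.+1%:R ->
  exists k, cell n k w /\ simple_eval (rsum f n) w = f (k%:R * mesh n).
Proof.
move=> /andP[w0 wn]; pose k := Num.truncn (w * n.+1%:R).
have kw : cell n k w by apply/cell_trunc.
exists k; split => //; rewrite rsum_eval_sum.
have kn : (k < n.+1 * n.+1)%N.
  rewrite -(ltr_nat R); have /cellP/andP[+ _] := kw => /le_lt_trans; apply.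
  by rewrite natrM ltr_pM2r.
rewrite (bigD1 (Ordinal kn))//= indicE mem_set// scale1r big1 ?addr0// => i ik.
rewrite indicE memNset ?scale0r// => /cell_trunc-/(_ w0) iE.
by move/eqP: ik; apply; apply: val_inj.
Qed.

Lemma rsum_eval_out f n (w : R) : n.+1%:R <= w -> simple_eval (rsum f n) w = 0.
Proof.
move=> wn; rewrite rsum_eval_sum big1// => i _.
rewrite indicE memNset ?scale0r// => /cellP/andP[_].
apply/negP; rewrite -leNgt; apply: le_trans (_ : (n.+1 * n.+1)%:R <= _); first by rewrite ler_nat.
by rewrite natrM ler_pM2r.
Qed.

Definition unif_cont f := forall e : R, 0 < e -> exists2 r : R, 0 < r &
  forall s t : R, 0 <= s -> 0 <= t -> `|s - t| < r -> rnorm (f s - f t) < e.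

Lemma unif_cont_measurable f E : measurable E -> E `<=` `[0, +oo[ ->
  unif_cont f -> forall c, measurable_fun E (fun w => rnorm (f w - c)).
Proof.
move=> mE E0 uf c.
(* Composing with max(w, 0) extends f from the half-line to a continuous function on the line. *)
apply: (@eq_measurable_fun _ _ _ _ _ (fun w : R => rnorm (f (Num.max w 0) - c))).
  move=> w /set_mem/E0 /=; rewrite in_itv /= andbT => w0.
  by rewrite max_l.
apply: measurable_funTS; apply: continuous_measurable_fun => w.
apply/cvgrPdist_lt => e e0; have [r r0 hr] := uf _ e0.
near=> v.
have h : rnorm (f (Num.max w 0) - f (Num.max v 0)) < e.
  apply: hr; rewrite ?le_max ?lexx ?orbT//.
  have : `|w - v| < r by near: v; exists r.
  by apply: le_lt_trans; exact: dist_max0.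
rewrite ltr_norml.
have := rnorm_dist_triangle (f (Num.max v 0)) (f (Num.max w 0)) c.
have := rnorm_dist_triangle (f (Num.max w 0)) (f (Num.max v 0)) c.
rewrite [rnorm (f (Num.max v 0) - f (Num.max w 0))]rnorm_distC => h1 h2.
apply/andP; split; lra.
Unshelve. all: by end_near.
Qed.

Definition bounded_orbit f (K : R) := forall t : R, 0 <= t -> rnorm (f t) <= K.

Lemma rsum_eval_dist f K n (w : R) : 0 <= w -> bounded_orbit f K ->
  rnorm (f w - simple_eval (rsum f n) w) <= 2 * K.
Proof.
move=> w0 fK; have K0 : 0 <= K := le_trans (rnorm_ge0 _) (fK 0 (lexx _)).
have [wn|wn] := ltP w n.+1%:R.
  have /rsum_eval_in h : 0 <= w < n.+1%:R by rewrite w0 wn.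
  have [k [_ ->]] := h f; rewrite (le_trans (rnormB _ _))// mulr2n mulrDl mul1r.
  by rewrite lerD ?fK// mulr_ge0// ltW// mesh_gt0.
rewrite rsum_eval_out// subr0 (le_trans (fK _ w0))//; lra.
Qed.

Lemma cvg_mesh : mesh @ \oo --> (0 : R).
Proof. exact: cvg_harmonic. Qed.

Lemma rsum_eval_cvg f (w : R) : 0 <= w -> unif_cont f ->
  (fun n => rnorm (f w - simple_eval (rsum f n) w)) @ \oo --> (0 : R).
Proof.
move=> w0 uf; apply/cvgrPdist_lt => e e0; have [r r0 hr] := uf _ e0.
have /cvgrPdist_lt cm := cvg_mesh; have cmr := cm _ r0.
near=> n.
rewrite sub0r normrN ger0_norm ?rnorm_ge0//.
have wn : 0 <= w < n.+1%:R.
  rewrite w0; apply: (@lt_le_trans _ _ n%:R); last by rewrite ler_nat.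
  by near: n; exact: nbhs_infty_gtr.
have [k [/= kw ->]] := rsum_eval_in f wn.
apply: hr => //; first by rewrite mulr_ge0// ltW// mesh_gt0.
move: kw; rewrite /cell /= in_itv /= => /andP[k1 k2].
rewrite ger0_norm ?subr_ge0//.
have : mesh n < r.
  have : `|0 - mesh n| < r by near: n; exact: cmr.
  by rewrite sub0r normrN ger0_norm// ltW// mesh_gt0.
move: k2; rewrite -[k.+1%:R]natr1 mulrDl mul1r; lra.
Unshelve. all: by end_near.
Qed.

(** The step functions converge to f in L1 by bounded convergence, m being finite on E;
    [simple_integral_dist] then makes their integrals a Cauchy sequence. *)
Lemma rsum_integral_cvg (m : {measure set (measurableTypeR R) -> \bar R}) E f K :
  measurable E -> E `<=` `[0, +oo[ -> (m E < +oo)%E -> unif_cont f -> bounded_orbit f K ->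
  exists2 y, is_bochner_integral m E f y &
    (fun n => simple_integral m E (rsum f n)) @ \oo --> y.
Proof.
move=> mE E0 fE uf fK.
have E0' w : E w -> 0 <= w by move=> /E0 /=; rewrite in_itv /= andbT.
have mu n : measurable_fun E (fun w => rnorm (f w - simple_eval (rsum f n) w)).
  have := @measurable_rnorm_simple _ _ _ _ f E (rsum f n) 0 mE (@meas_sets_rsum f n)
    (unif_cont_measurable mE E0 uf).
  by apply: eq_measurable_fun => w _; rewrite add0r.
have i0 : (fun n => \int[m]_(w in E) (rnorm (f w - simple_eval (rsum f n) w))%:E)%E @ \oo --> 0%E.
  apply: (@bounded_cvg_integral0 _ _ _ _ _ _ (2 * K)) => //.
    by move=> n w /E0' w0; rewrite rnorm_ge0 (rsum_eval_dist _ w0 fK).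
  by move=> w /E0' w0; exact: rsum_eval_cvg.
have [y Hy] : exists y : X, (fun n => simple_integral m E (rsum f n)) @ \oo --> y.
  have /fine_cvgP[fi ci] := i0.
  have [N _ hN] := fi.
  pose u n := simple_integral m E (rsum f n).
  pose r n := fine (\int[m]_(w in E) (rnorm (f w - simple_eval (rsum f n) w))%:E)%E.
  have uu i j : (N <= i)%N -> (N <= j)%N -> rnorm (u i - u j) <= r i + r j.
    move=> Ni Nj; rewrite -lee_fin EFinD !fineK; [|exact: hN..].
    exact: simple_integral_dist mE fE (@meas_sets_rsum f i) (@meas_sets_rsum f j) (mu i) (mu j).
  apply/cvg_ex/cauchy_cvgP/cauchy_ballP => e e0.
  have eE : e = (complex.Re e)%:C by rewrite RRe_real// gtr0_real.
  have e0' : 0 < complex.Re e by rewrite -ltcR -eE.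
  have [N2 _ hN2] : \forall n \near \oo, `|r n| < complex.Re e / 2.
    have /cvgrPdist_lt /(_ (complex.Re e / 2)) := ci; rewrite divr_gt0// => /(_ isT).
    by apply: filterS => n; rewrite sub0r normrN.
  pose V := u @` [set n | (maxn N N2 <= n)%N].
  have uV : (u @ \oo) V by exists (maxn N N2) => // n Nn; exists n.
  exists (V, V) => //= -[_ _] /= [[i Ni <-] [j Nj <-]]; rewrite -ball_normE /= rnormE eE ltcR.
  move: Ni Nj; rewrite /= !geq_max => /andP[Ni Ni2] /andP[Nj Nj2].
  apply: (le_lt_trans (uu _ _ Ni Nj)).
  have /= := hN2 _ Ni2; have /= := hN2 _ Nj2 => /(le_lt_trans (ler_norm _)) h1 /(le_lt_trans (ler_norm _)) h2.
  lra.
exists y => //; exists (rsum f); split => // n.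
by apply: simple_integrableP => //; exact: meas_sets_rsum.
Qed.

(** One and the same sequence of sums computes the integral for every measure finite on E.
    Identities between integrals for different measures can therefore be checked on the masses of
    the cells. *)
Lemma bochner_integral_rsum (m : {measure set (measurableTypeR R) -> \bar R}) E f K :
  measurable E -> E `<=` `[0, +oo[ -> (m E < +oo)%E -> unif_cont f -> bounded_orbit f K ->
  (fun n => simple_integral m E (rsum f n)) @ \oo --> bochner_integral m E f.
Proof.
move=> mE E0 fE uf fK; have [y yi yc] := rsum_integral_cvg mE E0 fE uf fK.
have := @xgetPex X 0 [set y | is_bochner_integral m E f y] (ex_intro _ y yi).
by rewrite /bochner_integral => /(bochner_integral_unique mE fE yi) <-.
Qed.

Lemma simple_integral_rsum (m : {measure set (measurableTypeR R) -> \bar R}) E f n :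
  simple_integral m E (rsum f n) =
  \sum_(k < n.+1 * n.+1) (fine (m (cell n k `&` E)))%:C *: f (k%:R * mesh n).
Proof.
rewrite -(big_mkord xpredT (fun k => (fine (m (cell n k `&` E)))%:C *: f (k%:R * mesh n))).
by rewrite /index_iota subn0 /simple_integral big_map.
Qed.

End RiemannSums.

(** * Operators attached to positive measures by a bounded semigroup *)

Definition bounded_C0 (R : realType) (X : normedModType R[i]) (T : R -> X -> X) (M : R) : Prop :=
  [/\ C0_semigroup T, 0 <= M & forall (t : R) x, 0 <= t -> rnorm (T t x) <= M * rnorm x].

Section Calculus.
Context (R : realType) (X : completeNormedModType R[i]) (T : R -> X -> X) (M : R)
  (hT : bounded_C0 T M).

Lemma Tlin (t : R) : 0 <= t -> linear (T t).
Proof. by case: hT => -[+ _ _ _ _] _ _; apply. Qed.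

Lemma T0 x : T 0 x = x.
Proof. by case: hT => -[_ _ + _ _] _ _; apply. Qed.

Lemma Tadd (s t : R) x : 0 <= s -> 0 <= t -> T (s + t) x = T s (T t x).
Proof. by case: hT => -[_ _ _ + _] _ _; apply. Qed.

Lemma Tcont x : T t x @[t --> 0^'+] --> x.
Proof. by case: hT => -[_ _ _ _ +] _ _; apply. Qed.

Lemma M0 : 0 <= M.
Proof. by case: hT. Qed.

Lemma Tbd (t : R) x : 0 <= t -> rnorm (T t x) <= M * rnorm x.
Proof. by case: hT => _ _; apply. Qed.

Local Notation pmeasure := {measure set (measurableTypeR R) -> \bar R}.
Local Notation D := (`[0, +oo[%classic : set (measurableTypeR R)).

Lemma TD t x y : 0 <= t -> T t (x + y) = T t x + T t y.
Proof. by move=> t0; have := Tlin t0 1 x y; rewrite !scale1r. Qed.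

Lemma TZ t (a : R[i]) x : 0 <= t -> T t (a *: x) = a *: T t x.
Proof.
move=> t0; have T00 : T t 0 = 0.
  by have /eqP := TD 0 0 t0; rewrite addr0 -subr_eq0 opprD addrA subrr sub0r oppr_eq0 => /eqP.
by have := Tlin t0 a x 0; rewrite !addr0 T00 addr0.
Qed.

Lemma TB t x y : 0 <= t -> T t (x - y) = T t x - T t y.
Proof. by move=> t0; rewrite TD// -[- y]scaleN1r TZ// scaleN1r. Qed.

Lemma Tsum t (I : Type) (s : seq I) (F : I -> X) : 0 <= t ->
  T t (\sum_(i <- s) F i) = \sum_(i <- s) T t (F i).
Proof.
move=> t0; elim: s => [|i s IH]; last by rewrite !big_cons TD// IH.
by rewrite !big_nil; have := TZ 0 0 t0; rewrite !scale0r.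
Qed.

Lemma Tcont0 x (e : R) : 0 < e -> exists2 r : R, 0 < r &
  forall h : R, 0 <= h -> h < r -> rnorm (T h x - x) < e.
Proof.
move=> e0; have /cvg_rnormP/(_ _ e0) [r /= r0 hr] := @Tcont x.
exists r => // h h0 hhr; move: h0; rewrite le_eqVlt => /predU1P[<-|h0].
  by rewrite T0 subrr rnorm0.
by apply: hr => //=; rewrite sub0r normrN ger0_norm// ltW.
Qed.

(** T s x - T t x = T s (x - T (t - s) x) moves the difference to 0, where strong continuity
    applies, and the bound M makes the estimate uniform in s. *)
Lemma orbit_unif_cont x : unif_cont (fun t => T t x).
Proof.
have M_ge0 := M0; move=> e e0; have e0' : 0 < e / (M + 1) by rewrite divr_gt0// ltr_wpDl.
have [r r0 hr] := Tcont0 x e0'.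
have main s t : 0 <= s -> s <= t -> t - s < r -> rnorm (T s x - T t x) < e.
  move=> s0 st tsr; have ts0 : 0 <= t - s by rewrite subr_ge0.
  have -> : T t x = T s (T (t - s) x) by rewrite -Tadd// addrC subrK.
  have -> : T s x - T s (T (t - s) x) = T s (x - T (t - s) x).
    by rewrite TB.
  apply: (le_lt_trans (Tbd _ s0)); rewrite rnorm_distC.
  apply: (@le_lt_trans _ _ ((M + 1) * rnorm (T (t - s) x - x))).
    by rewrite ler_wpM2r ?rnorm_ge0// lerDl.
  by have := hr _ ts0 tsr; rewrite ltr_pdivlMr ?ltr_wpDl// mulrC.
exists r => // s t s0 t0; have [st|st] := leP s t.
  by rewrite ler0_norm ?subr_le0// opprB; exact: main.
rewrite gtr0_norm ?subr_gt0// rnorm_distC; apply: main => //; exact: ltW.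
Qed.

Lemma orbit_bounded x : bounded_orbit (fun t => T t x) (M * rnorm x).
Proof. by move=> t t0; exact: Tbd. Qed.

(** Linearity, additivity in m, norm bounds and composition of [hp_pos] are proved on these finite
    sums and passed to the limit. *)
Definition rs (m : pmeasure) (n : nat) (x : X) : X :=
  \sum_(k < n.+1 * n.+1) (fine (m (cell n k `&` D)))%:C *: T (k%:R * mesh R n) x.

Lemma mesh_ge0 n (k : nat) : 0 <= k%:R * mesh R n.
Proof. by rewrite mulr_ge0// ltW// mesh_gt0. Qed.

Lemma bochner_rs (m : pmeasure) E x : measurable E -> E `<=` D -> (m E < +oo)%E ->
  (fun n => \sum_(k < n.+1 * n.+1) (fine (m (cell n k `&` E)))%:C *: T (k%:R * mesh R n) x)
    @ \oo --> bochner_integral m E (fun s => T s x).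
Proof.
move=> mE ED fE.
have := bochner_integral_rsum mE ED fE (orbit_unif_cont x) (orbit_bounded x).
by under eq_fun do rewrite simple_integral_rsum.
Qed.

Lemma rs_cvg (m : pmeasure) x : (m D < +oo)%E -> rs m n x @[n --> \oo] --> hp_pos T m x.
Proof. by move=> fm; apply: bochner_rs => //; exact: measurable_itv. Qed.

Lemma rsD (m : pmeasure) n x y : rs m n (x + y) = rs m n x + rs m n y.
Proof.
by rewrite /rs -big_split; apply: eq_bigr => k _; rewrite TD ?mesh_ge0// scalerDr.
Qed.

Lemma rsZ (m : pmeasure) n (a : R[i]) x : rs m n (a *: x) = a *: rs m n x.
Proof.
rewrite /rs scaler_sumr; apply: eq_bigr => k _.
by rewrite TZ ?mesh_ge0// !scalerA mulrC.
Qed.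

Lemma rsB (m : pmeasure) n x y : rs m n (x - y) = rs m n x - rs m n y.
Proof. by rewrite rsD -[- y]scaleN1r rsZ scaleN1r. Qed.

Lemma rs_norm (m : pmeasure) n x : (m D < +oo)%E ->
  rnorm (rs m n x) <= M * fine (m D) * rnorm x.
Proof.
have M_ge0 := M0; move=> fm; have mD : measurable D by exact: measurable_itv.
rewrite /rs -(simple_integral_rsum m D (fun t => T t x)) -lee_fin.
apply: (le_trans (simple_integral_norm mD fm (@meas_sets_rsum _ _ _ _))).
have fD : m D \is a fin_num by rewrite ge0_fin_numE.
rewrite mulrAC EFinM fineK// -integral_cst//.
apply: ge0_le_integral => //.
- by move=> w _; rewrite lee_fin rnorm_ge0.
- apply/measurable_EFinP.
  have h := @measurable_rnorm_simple _ _ _ X (cst 0) D _ 0 mD (@meas_sets_rsum R X (fun t => T t x) n).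
  apply: (eq_measurable_fun _ _ (h _)) => [w _|c]; first by rewrite /= !add0r rnormN.
  exact: (@measurable_cst _ _ _ _ _ (rnorm (0 - c))).
move=> w; rewrite /= in_itv /= andbT => w0; rewrite lee_fin.
have [wn|wn] := ltP w n.+1%:R.
  have /rsum_eval_in h : 0 <= w < n.+1%:R by rewrite w0 wn.
  by have [k [_ ->]] := h X (fun t => T t x); rewrite Tbd ?mesh_ge0.
by rewrite rsum_eval_out// rnorm0 mulr_ge0// rnorm_ge0.
Qed.

Lemma hp_posD (m : pmeasure) x y : (m D < +oo)%E -> hp_pos T m (x + y) = hp_pos T m x + hp_pos T m y.
Proof.
move=> fm; apply: (cvg_vec_unique (@rs_cvg _ (x + y) fm)).
by under eq_fun do rewrite rsD; exact: cvgD (@rs_cvg _ x fm) (@rs_cvg _ y fm).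
Qed.

Lemma hp_posZ (m : pmeasure) (a : R[i]) x : (m D < +oo)%E -> hp_pos T m (a *: x) = a *: hp_pos T m x.
Proof.
move=> fm; apply: (cvg_vec_unique (@rs_cvg _ (a *: x) fm)).
by under eq_fun do rewrite rsZ; apply: cvgZr; exact: (@rs_cvg _ x fm).
Qed.

Lemma hp_pos_norm (m : pmeasure) x : (m D < +oo)%E ->
  rnorm (hp_pos T m x) <= M * fine (m D) * rnorm x.
Proof. by move=> fm; apply: rnorm_cvg_le (@rs_cvg _ x fm) _ => n; exact: rs_norm. Qed.

(** The Riemann sums see m only through the masses of the cells. This is how uniqueness of the
    Laplace transform passes to operators. *)
Lemma hp_pos_congr (m m' : pmeasure) x : (m D < +oo)%E ->
  (forall n k, m (cell n k `&` D) = m' (cell n k `&` D)) ->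
  (m' D < +oo)%E -> hp_pos T m x = hp_pos T m' x.
Proof.
move=> fm mm' fm'; apply: (cvg_vec_unique (@rs_cvg _ x fm)).
rewrite (_ : (fun n => rs m n x) = (fun n => rs m' n x)); first exact: rs_cvg.
by apply/funext => n; apply: eq_bigr => k _; rewrite mm'.
Qed.

Lemma measurable_cellD n k : measurable (cell (R := R) n k `&` D).
Proof. by apply: measurableI; exact: measurable_itv. Qed.

Lemma hp_pos_measureD (m m1 m2 : pmeasure) x : (m1 D < +oo)%E -> (m2 D < +oo)%E ->
  (forall A, measurable A -> A `<=` D -> m A = (m1 A + m2 A)%E) ->
  hp_pos T m x = hp_pos T m1 x + hp_pos T m2 x.
Proof.
move=> f1 f2 mE; have mD : measurable D by exact: measurable_itv.
have fm : (m D < +oo)%E by rewrite mE// lte_add_pinfty.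
apply: (cvg_vec_unique (@rs_cvg _ x fm)).
rewrite (_ : (fun n => rs m n x) = (fun n => rs m1 n x + rs m2 n x)).
  exact: cvgD (@rs_cvg _ x f1) (@rs_cvg _ x f2).
apply/funext => n; rewrite /rs -big_split; apply: eq_bigr => k _.
have fin (m' : pmeasure) : (m' D < +oo)%E -> m' (cell n k `&` D) \is a fin_num.
  move=> f'; rewrite ge0_fin_numE// (le_lt_trans _ f')// le_measure ?inE//.
  exact: measurable_cellD.
rewrite mE; [|exact: measurable_cellD|exact: subIsetr].
by rewrite fineD ?fin// rmorphD scalerDl.
Qed.

End Calculus.

(** * Measures given by a density *)

Section Density.
Context d (S : measurableType d) (R : realType) (mu : {measure set S -> \bar R})
  (phi : S -> R) (phi0 : forall x, 0 <= phi x) (mphi : measurable_fun setT phi).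

(** The two hypotheses on phi are arguments of [dens], so that a measure structure can be attached
    to it as an instance. *)
Definition dens & (forall x, 0 <= phi x) & measurable_fun setT phi :=
  fun A : set S => (\int[mu]_(x in A) (phi x)%:E)%E.

Local Notation nu := (dens phi0 mphi).

Let dens0 : nu set0 = 0%E.
Proof. by rewrite /dens integral_set0. Qed.

Let dens_ge0 A : (0 <= nu A)%E.
Proof. by rewrite /dens integral_ge0//= => x _; rewrite lee_fin. Qed.

Let dens_sigma_additive : semi_sigma_additive nu.
Proof.
move=> /= F mF tF mUF; rewrite /dens; apply: cvg_toP.
  apply: ereal_nondecreasing_is_cvgn => m n mn.
  apply: lee_sum_nneg_natr => // k _ _; apply: integral_ge0 => /= x Fkx.
  by rewrite lee_fin.
rewrite ge0_integral_bigcup//=.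
- exact/measurable_funTS/measurableT_comp.
- by move=> x _; rewrite lee_fin.
Qed.

HB.instance Definition _ := isMeasure.Build _ _ _ nu dens0 dens_ge0 dens_sigma_additive.

Import HBNNSimple.

Let integral_dens_nnsfun D (h : {nnsfun S >-> R}) : measurable D ->
  (\int[nu]_(x in D) (h x)%:E = \int[mu]_(x in D) (h x * phi x)%:E)%E.
Proof.
move=> mD.
under [LHS]eq_integral do rewrite fimfunE -fsumEFin//.
rewrite [LHS]ge0_integral_fsum//; last 2 first.
  - by move=> r; exact/measurable_EFinP/measurableT_comp.
  - by move=> n x _; rewrite EFinM nnfun_muleindic_ge0.
under [RHS]eq_integral.
  move=> x xD; rewrite fimfunE EFinM -fsumEFin// muleC ge0_mule_fsumr; last first.
    by move=> r; rewrite EFinM nnfun_muleindic_ge0.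
  over.
rewrite [RHS]ge0_integral_fsum//; last 2 first.
  - move=> r; apply/measurable_EFinP/measurable_funM; first exact: measurable_funTS.
    exact/measurable_funM.
  - by move=> n x _; apply: mule_ge0; rewrite ?lee_fin// -lee_fin EFinM nnfun_muleindic_ge0.
apply: eq_fsbigr => r _.
rewrite integralZl_indic_nnsfun// integral_indic//= /dens.
have [->|/set0P[x0 x0r]] := eqVneq (h @^-1` [set r]) set0.
  rewrite set0I integral_set0 mule0 integral0_eq// => x _.
  by rewrite indic0 /= mulr0 mule0.
have r0 : 0 <= r by rewrite -x0r.
under [RHS]eq_integral do rewrite EFinM muleCA.
rewrite ge0_integralZl//; last 2 first.
  - apply/measurable_EFinP/measurable_funM; first exact: measurable_funTS.
    by apply: measurable_funTS.
  - by move=> x _; rewrite -EFinM lee_fin mulr_ge0.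
congr (_ * _)%E; rewrite setIC integral_mkcondr; apply: eq_integral => x _.
rewrite patchE indicE; case: ifPn => _ /=; first by rewrite mule1.
by rewrite mule0.
Qed.

Lemma ge0_integral_dens D (f : S -> \bar R) : measurable D -> measurable_fun D f ->
  (forall x, D x -> 0 <= f x)%E ->
  (\int[nu]_(x in D) f x = \int[mu]_(x in D) (f x * (phi x)%:E))%E.
Proof.
move=> mD mf f0; pose f_ := nnsfun_approx mD mf.
transitivity (limn (fun n => \int[nu]_(x in D) (f_ n x)%:E)%E).
  rewrite -monotone_convergence//=.
  - apply: eq_integral => x /[!inE] xD; apply/esym/cvg_lim => //=.
    exact: cvg_nnsfun_approx.
  - by move=> n; apply: measurableT_comp => //; exact: measurable_funTS.
  - by move=> n x _; rewrite lee_fin.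
  - by move=> x _ a b ab; rewrite lee_fin//; exact/lefP/nd_nnsfun_approx.
transitivity (limn (fun n => \int[mu]_(x in D) ((f_ n x * phi x)%:E))%E).
  by congr (limn _); apply/funext => n /=; rewrite integral_dens_nnsfun.
rewrite -monotone_convergence//=.
- apply: eq_integral => x /[!inE] xD; apply/cvg_lim => //=.
  under eq_fun do rewrite EFinM.
  by apply: cvgeZr => //; exact: cvg_nnsfun_approx.
- move=> n; apply/measurable_EFinP/measurable_funM; first exact: measurable_funTS.
  exact: measurable_funTS.
- by move=> n x _; rewrite lee_fin mulr_ge0.
- by move=> x _ a b ab; rewrite lee_fin ler_wpM2r//; exact/lefP/nd_nnsfun_approx.
Qed.

End Density.

(** * The calculus for positive measures *)

Section Laplace.
Context (R : realType).
Local Notation pmeasure := {measure set (measurableTypeR R) -> \bar R}.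
Local Notation D := (`[0, +oo[%classic : set (measurableTypeR R)).
Implicit Types (m : pmeasure) (z : R).

Lemma measurable_halfline : measurable D.
Proof. exact: measurable_itv. Qed.

Lemma halflineP (s : R) : D s <-> 0 <= s.
Proof. by rewrite /= in_itv /= andbT. Qed.

Definition lap m z : R := \int[m]_(s in D) expR (- (s * z)).
Definition elap m z : \bar R := (\int[m]_(s in D) (expR (- (s * z)))%:E)%E.

Lemma measurable_expMz z : measurable_fun setT (fun s : measurableTypeR R => expR (- (s * z))).
Proof.
apply: measurableT_comp => //; apply: measurableT_comp => //.
exact: measurable_funM.
Qed.

Lemma elap_ge0 m z : (0 <= elap m z)%E.
Proof. by apply: integral_ge0 => s _; rewrite lee_fin expR_ge0. Qed.

Lemma elap_le m z : 0 <= z -> (elap m z <= m D)%E.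
Proof.
move=> z0; rewrite -[leRHS]mul1e -integral_cst//.
apply: ge0_le_integral => //.
- by apply/measurable_EFinP/measurable_funTS; exact: measurable_expMz.
- move=> s /halflineP s0; rewrite lee_fin -expR0 ler_expR oppr_le0.
  exact: mulr_ge0.
Qed.

Lemma lapE m z : (m D < +oo)%E -> 0 <= z -> (lap m z)%:E = elap m z.
Proof.
move=> fm z0; rewrite /lap /Rintegral fineK// ge0_fin_numE ?elap_ge0//.
by rewrite (le_lt_trans _ fm)// elap_le.
Qed.

Lemma lap_ge0 m z : 0 <= lap m z.
Proof. by apply: Rintegral_ge0 => s _; rewrite expR_ge0. Qed.

Lemma lap_le m z c : (m D <= c%:E)%E -> 0 <= z -> lap m z <= c.
Proof.
move=> mc z0; rewrite -lee_fin lapE// ?(le_lt_trans mc) ?ltry//.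
by rewrite (le_trans _ mc)// elap_le.
Qed.

End Laplace.

Section PositiveCalculus.
Context (R : realType) (X : completeNormedModType R[i]) (T : R -> X -> X) (M : R)
  (hT : bounded_C0 T M).
Local Notation pmeasure := {measure set (measurableTypeR R) -> \bar R}.
Local Notation D := (`[0, +oo[%classic : set (measurableTypeR R)).
Implicit Types (m : pmeasure) (z : R) (f : R -> R) (F : X -> X).

(** The measure stays hidden: sums, products and series only track the symbol on ]0, +oo[, the
    operator and a bound on the mass. Uniqueness of the Laplace transform later shows that the
    symbol determines the operator. *)
Definition pcalc f F (c : R) := exists m, [/\ (m D <= c%:E)%E,
  forall z, 0 < z -> f z = lap m z & forall x, F x = hp_pos T m x].

Lemma pcalc_lty m (c : R) : (m D <= c%:E)%E -> (m D < +oo)%E.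
Proof. by move=> /le_lt_trans; apply; rewrite ltry. Qed.

Lemma pcalc_ge0 f F c : pcalc f F c -> 0 <= c.
Proof. by move=> [m [mc _ _]]; rewrite -lee_fin (le_trans _ mc). Qed.

Lemma pcalcD f F c f' F' c' : pcalc f F c -> pcalc f' F' c' ->
  pcalc (fun z => f z + f' z) (fun x => F x + F' x) (c + c').
Proof.
move=> [m [mc mf mF]] [m' [mc' mf' mF']].
have fm := pcalc_lty mc; have fm' := pcalc_lty mc'.
have mmD : (measure_add m m' D <= (c + c')%:E)%E by rewrite measure_addE EFinD leeD.
exists (measure_add m m'); split => // [z z0|x].
  rewrite mf// mf'//; apply: EFin_inj; rewrite EFinD !lapE ?ltW//; last exact: pcalc_lty mmD.
  rewrite /elap ge0_integral_measure_add//.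
  by apply/measurable_EFinP/measurable_funTS; exact: measurable_expMz.
rewrite mF mF' (@hp_pos_measureD _ _ _ _ hT (measure_add m m') m m' x fm fm')//.
by move=> A _ _; exact: measure_addE.
Qed.

Lemma pcalcZ f F c (k : R) : 0 <= k -> pcalc f F c ->
  pcalc (fun z => k * f z) (fun x => k%:C *: F x) (k * c).
Proof.
move=> k0 [m [mc mf mF]]; have fm := pcalc_lty mc.
pose m' := mscale (NngNum k0) m.
have mD' : (m' D <= (k * c)%:E)%E by rewrite /m' /= /mscale /= EFinM lee_wpmul2l.
exists m'; split => // [z z0|x].
  rewrite mf//; apply: EFin_inj; rewrite EFinM !lapE ?ltW//; last exact: pcalc_lty mD'.
  rewrite /elap ge0_integral_mscale//.
  by apply/measurable_EFinP/measurable_funTS; exact: measurable_expMz.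
rewrite mF; apply: (cvg_vec_unique _ (rs_cvg hT (x := x) (pcalc_lty mD'))).
rewrite (_ : (fun n => rs T m' n x) = (fun n => k%:C *: rs T m n x)).
  by apply: cvgZr; exact: (rs_cvg hT (x := x) fm).
apply/funext => n; rewrite /rs scaler_sumr; apply: eq_bigr => i _.
rewrite scalerA -rmorphM /m' /= /mscale /= fineM//.
rewrite ge0_fin_numE// (le_lt_trans _ fm)// le_measure ?inE//; exact: measurable_cellD.
Qed.

(** Against the Dirac mass at h, a Riemann sum of the orbit is the value at h of the step function,
    which converges to T h x. *)
Lemma pcalc_translation (h : R) : 0 <= h -> pcalc (fun z => expR (- (h * z))) (T h) 1.
Proof.
move=> h0; pose m : pmeasure := @dirac _ (measurableTypeR R) h R.
have fm : (m D < +oo)%E by rewrite /m /= /dirac ltry.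
exists m; split => [|z z0|x].
- by rewrite /m /= /dirac lee_fin indicE; case: (_ \in _).
- apply: EFin_inj; rewrite lapE ?ltW// /elap integral_dirac//.
  + by rewrite diracE mem_set ?mul1e//; exact/halflineP.
  + by apply/measurable_EFinP/measurable_funTS; exact: measurable_expMz.
- apply: (cvg_vec_unique _ (rs_cvg hT (x := x) fm)).
  have := rsum_eval_cvg h0 (orbit_unif_cont hT x).
  move=> /(cvg_rnorm_squeeze _); apply; apply: nearW => n.
  rewrite rnorm_distC rsum_eval_sum.
  rewrite le_eqVlt; apply/orP; left; apply/eqP; congr (rnorm (_ - _)).
  apply: eq_bigr => k _; congr (_ *: _).
  rewrite /= /dirac !indicE in_setI [h \in D]mem_set ?andbT; last exact/halflineP.
  by case: (_ \in _).
Qed.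

Lemma integral_expMz (a h : R) : 0 < a -> 0 < h ->
  (\int[@lebesgue_measure R]_(s in `[0%R, h]) (expR (- (s * a)))%:E = ((1 - expR (- (h * a))) / a)%:E)%E.
Proof.
move=> a0 h0.
(* The integral is read off from the probability of [0, h] under the exponential law with parameter
   a. *)
have := @exponential_prob_itv0c R a h h0.
rewrite /exponential_prob.
have -> : (\int[@lebesgue_measure R]_(s in `[0%R, h]) (exponential_pdf a s)%:E =
    \int[@lebesgue_measure R]_(s in `[0%R, h]) (a%:E * (expR (- (s * a)))%:E))%E.
  apply: eq_integral => s /set_mem /=; rewrite in_itv /= => /andP[s0 _].
  by rewrite exponential_pdfE// EFinM mulNr mulrC.
rewrite ge0_integralZl_EFin//; last 2 first.
- by apply/measurable_EFinP/measurable_funTS; exact: measurable_expMz.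
- exact: ltW.
move=> e; rewrite mulrC EFinM EFinB mulrC -mulNr -e muleA -EFinM mulVf ?gt_eqF// mul1e.
by [].
Qed.

Lemma pcalc_dens (phi : measurableTypeR R -> R) (f : R -> R) (c : R) (phi0 : forall s, 0 <= phi s)
    (mphi : measurable_fun setT phi) :
  (\int[@lebesgue_measure R]_(s in D) (phi s)%:E <= c%:E)%E ->
  (forall z, 0 < z -> ((f z)%:E =
    \int[@lebesgue_measure R]_(s in D) (expR (- (s * z)) * phi s)%:E)%E) ->
  pcalc f (hp_pos T (dens (@lebesgue_measure R) phi0 mphi)) c.
Proof.
move=> phic fE; set m := dens _ _ _; have mc : (m D <= c%:E)%E by [].
exists m; split => // z z0.
apply: EFin_inj; rewrite fE// lapE ?ltW//; last exact: pcalc_lty mc.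
rewrite /elap ge0_integral_dens//.
by apply/measurable_EFinP/measurable_funTS; exact: measurable_expMz.
Qed.

Lemma pcalc_dens_itv (phi : R -> R) (h : R) (f : R -> R) (c : R) :
  (forall s, 0 <= phi s * \1_(`[0%R, h]%classic : set R) s) -> measurable_fun setT phi ->
  (\int[@lebesgue_measure R]_(s in `[0%R, h]) (phi s)%:E <= c%:E)%E ->
  (forall z, 0 < z -> ((f z)%:E =
    \int[@lebesgue_measure R]_(s in `[0%R, h]) (expR (- (s * z)) * phi s)%:E)%E) ->
  exists F, pcalc f F c.
Proof.
move=> phi0 mphi phic fE.
have mphi' : measurable_fun setT (fun s : measurableTypeR R => phi s * \1_(`[0%R, h]%classic : set R) s).
  by apply: measurable_funM.
have DI : D `&` `[0%R, h]%classic = `[0%R, h]%classic.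
  by apply/setIidPr => s /=; rewrite !in_itv /= andbT => /andP[].
have key (k : R -> R) : (\int[@lebesgue_measure R]_(s in D) (k s * \1_(`[0%R, h]%classic : set R) s)%:E =
    \int[@lebesgue_measure R]_(s in `[0%R, h]) (k s)%:E)%E.
  rewrite -[X in _ = integral _ X _]DI integral_mkcondr; apply: eq_integral => s _.
  by rewrite patchE indicE; case: ifPn => _; rewrite ?mulr1 ?mulr0.
exists (hp_pos T (dens (@lebesgue_measure R) phi0 mphi')); apply: pcalc_dens.
  by rewrite key.
by move=> z z0; rewrite fE//; under [RHS]eq_integral do rewrite mulrA; rewrite key.
Qed.

(** This is t times the Cesàro mean; unlike the mean it has a symbol of mass t with a plain density,
    the indicator of [0, t]. *)
Definition integrated (t : R) (x : X) : X :=
  bochner_integral (@lebesgue_measure R) `[0%R, t] (fun s => T s x).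

Lemma lebesgue_itv0 (t : R) : 0 <= t -> (@lebesgue_measure R `[0%R, t] = t%:E)%E.
Proof.
by rewrite lebesgue_measure_itv /= lte_fin oppr0 adde0; case: ltgtP => // <-.
Qed.

(** The Bochner integral over [0, t] for Lebesgue measure and [hp_pos] for the density 1 on [0, t]
    have the same Riemann sums. *)
Lemma pcalc_integrated (t : R) : 0 < t ->
  pcalc (fun z => (1 - expR (- (t * z))) / z) (integrated t) t.
Proof.
move=> t0; have t0' := ltW t0.
have phi0 s : 0 <= \1_(`[0%R, t]%classic : set R) s :> R by [].
have mphi : measurable_fun setT (\1_(`[0%R, t]%classic : set R) : measurableTypeR R -> R) by [].
have DI : `[0%R, t]%classic `&` D = `[0%R, t]%classic.
  by apply/setIidPl => s /=; rewrite !in_itv /= andbT => /andP[].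
have dE A : measurable A -> dens (@lebesgue_measure R) phi0 mphi A = @lebesgue_measure R (`[0%R, t] `&` A).
  by move=> mA; rewrite /dens integral_indic.
have [m [mc mf mF]] : pcalc (fun z => (1 - expR (- (t * z))) / z)
    (hp_pos T (dens (@lebesgue_measure R) phi0 mphi)) t.
  apply: pcalc_dens.
    by rewrite integral_indic// DI; have := lebesgue_itv0 t0' => /= ->.
  move=> z z0; rewrite -integral_expMz// -[X in integral _ X _]DI setIC integral_mkcondr.
  apply: eq_integral => s _; rewrite patchE indicE.
  by case: ifPn => _; rewrite ?mulr1 ?mulr0.
exists m; split => // x; rewrite -mF.
have tD : `[0%R, t]%classic `<=` D by move=> s /=; rewrite !in_itv /= andbT => /andP[].
have ft : (@lebesgue_measure R `[0%R, t] < +oo)%E by rewrite lebesgue_itv0// ltry.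
apply: (cvg_vec_unique (bochner_rs hT (m := lebesgue_measure) (x := x) _ tD ft)) => //.
have fd : (dens (@lebesgue_measure R) phi0 mphi D < +oo)%E by rewrite dE// DI.
suff <- : (fun n => rs T (dens (@lebesgue_measure R) phi0 mphi) n x) =
    (fun n => \sum_(k < n.+1 * n.+1) (fine (lebesgue_measure (cell n k `&` `[0, t])))%:C *:
      T (k%:R * mesh R n) x) by exact: (rs_cvg hT (x := x) fd).
apply/funext => n; apply: eq_bigr => k _; congr ((fine _)%:C *: _).
rewrite -[RHS](congr1 lebesgue_measure (setIC _ _)).
by apply: (etrans (dE _ (@measurable_cellD _ _ _))); rewrite setICA DI setIC.
Qed.

Lemma nneseries_cvg_fine (a : nat -> R) (l : \bar R) : (forall n, 0 <= a n) ->
  l \is a fin_num -> (\sum_(k <oo) (a k)%:E = l)%E ->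
  (fun N => \sum_(k < N) a k) @ \oo --> fine l.
Proof.
move=> a0 fl al.
have : (fun n => \sum_(0 <= k < n) (a k)%:E)%E @ \oo --> l.
  by rewrite -al; apply: is_cvg_ereal_nneg_natsum => k _; rewrite lee_fin.
rewrite -[in X in _ --> X -> _](fineK fl) => /fine_cvgP[_].
under [X in X @ _ --> _ -> _]eq_fun do rewrite /= sumEFin /= big_mkord.
by [].
Qed.

(** The sum of the measures has mass at most C. What remains after N terms is the operator of the
    tail measure, bounded by M times a mass tending to 0. *)
Lemma pcalc_series (f_ : nat -> R -> R) (F_ : nat -> X -> X) (c_ : nat -> R) (C : R) :
  (forall n, pcalc (f_ n) (F_ n) (c_ n)) -> (forall N, \sum_(n < N) c_ n <= C) ->
  exists f F, [/\ pcalc f F C,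
    forall z, 0 < z -> (fun N => \sum_(n < N) f_ n z) @ \oo --> f z &
    forall x, (fun N => \sum_(n < N) F_ n x) @ \oo --> F x].
Proof.
move=> /choice[m_ m_P] cC.
have mc n : (m_ n D <= (c_ n)%:E)%E by have [] := m_P n.
have mf n z : 0 < z -> f_ n z = lap (m_ n) z by have [_ + _] := m_P n; apply.
have mF n x : F_ n x = hp_pos T (m_ n) x by have [_ _] := m_P n; apply.
have fm n : (m_ n D < +oo)%E := pcalc_lty (mc n).
pose m : pmeasure := mseries m_ 0.
have mC : (m D <= C%:E)%E.
  apply: lime_le; first by apply: is_cvg_ereal_nneg_natsum => k _.
  apply: nearW => n; apply: (@le_trans _ _ (\sum_(0 <= k < n) (c_ k)%:E)%E).
    by apply: lee_sum => k _; exact: mc.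
  by rewrite sumEFin lee_fin big_mkord.
have fmm := pcalc_lty mC.
exists (lap m), (hp_pos T m); split; first by exists m.
- move=> z z0; rewrite -[lap m z]/(fine (lap m z)%:E) lapE ?ltW//.
  under eq_fun do under eq_bigr do rewrite mf//.
  have l0 n : 0 <= lap (m_ n) z by exact: lap_ge0.
  have fl : elap m z \is a fin_num by rewrite -lapE// ltW.
  apply: (nneseries_cvg_fine l0 fl).
  rewrite /elap ge0_integral_measure_series//.
    by apply: eq_eseriesr => n _; rewrite lapE ?ltW.
  by apply/measurable_EFinP/measurable_funTS; exact: measurable_expMz.
- move=> x; under eq_fun do under eq_bigr do rewrite mF.
  have splitm N A : m A = (msum m_ N A + mseries m_ N A)%E.
    by rewrite /m /= /msum -(big_mkord xpredT (m_ ^~ A)); exact: nneseries_split.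
  have ftail N : (mseries m_ N D < +oo)%E.
    by rewrite (le_lt_trans _ fmm)// (splitm N) leeDr.
  have fsum N : (msum m_ N D < +oo)%E.
    by rewrite (le_lt_trans _ fmm)// (splitm N) leeDl.
  have hsum N : hp_pos T (msum m_ N) x = \sum_(n < N) hp_pos T (m_ n) x.
    elim: N => [|N IH].
      rewrite big_ord0; apply: (cvg_vec_unique (rs_cvg hT (x := x) (fsum 0%N))).
      rewrite (_ : (fun n => _) = cst 0); first exact: cvg_cst.
      apply/funext => n; rewrite /rs big1// => k _.
      by rewrite /= /msum big_ord0 /= scale0r.
    rewrite big_ord_recr /= -IH (@hp_pos_measureD _ _ _ _ hT _ (msum m_ N) (m_ N) x (fsum N) (fm N))//.
    by move=> A _ _; rewrite /= /msum big_ord_recr.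
  have hm N : hp_pos T m x = \sum_(n < N) hp_pos T (m_ n) x + hp_pos T (mseries m_ N) x.
    rewrite -hsum (@hp_pos_measureD _ _ _ _ hT _ (msum m_ N) (mseries m_ N) x (fsum N) (ftail N))//.
    by move=> A _ _; exact: splitm.
  apply: (@cvg_rnorm_squeeze _ _ _ _ _ _ _
    (fun N => M * (fine (m D) - \sum_(n < N) fine (m_ n D)) * rnorm x)).
    apply: nearW => N; rewrite rnorm_distC (hm N) addrC addKr.
    apply: (le_trans (hp_pos_norm hT x (ftail N))).
    rewrite ler_wpM2r ?rnorm_ge0// ler_wpM2l ?(M0 hT)// lerBrDr.
    have -> : fine (m D) = \sum_(n < N) fine (m_ n D) + fine (mseries m_ N D).
      rewrite (splitm N D) fineD; last 2 first.
      - by rewrite ge0_fin_numE// fsum.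
      - by rewrite ge0_fin_numE// ftail.
      by rewrite {1}/msum sum_fine// => n _; rewrite ge0_fin_numE.
    by rewrite addrC.
  rewrite -[X in _ --> X](mul0r (rnorm x)); apply: cvgMr_tmp.
  rewrite -[X in _ --> X](mulr0 M); apply: cvgMl_tmp.
  rewrite -[X in _ --> X](subrr (fine (m D))); apply: cvgB; first exact: cvg_cst.
  have l0 n : 0 <= fine (m_ n D) by exact: fine_ge0.
  have fl : m D \is a fin_num by rewrite ge0_fin_numE.
  apply: (nneseries_cvg_fine l0 fl).
  by apply: eq_eseriesr => n _; rewrite fineK// ge0_fin_numE.
Qed.

(** The product measure below is formed from finite measures on the whole line, obtained by
    restriction to the half-line; this brings their integrals back to m. *)
Lemma ge0_integral_mfrestr m (fm : (m D < +oo)%E) (g : R -> \bar R) :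
  measurable_fun [set: measurableTypeR R] g -> (forall s, (0 <= g s)%E) ->
  (\int[mfrestr (@measurable_halfline R) fm]_s g s = \int[m]_(s in D) g s)%E.
Proof.
move=> mg g0; have i0 (s : measurableTypeR R) : 0 <= (\1_D s : R) by [].
have mi : measurable_fun [set: measurableTypeR R] (\1_D : _ -> R) by [].
rewrite (@eq_measure_integral _ _ _ _ (dens m i0 mi)).
  rewrite ge0_integral_dens// [RHS]integral_mkcond; apply: eq_integral => s _.
  by rewrite patchE indicE; case: ifPn => _; rewrite ?mule1 ?mule0.
by move=> A mA _; rewrite /= /dens integral_indic// setIC.
Qed.

Definition pos_part (s : R) : R := Num.max s 0.

Lemma pos_part_ge0 s : 0 <= pos_part s.
Proof. by rewrite le_max lexx orbT. Qed.

Lemma pos_part_id s : 0 <= s -> pos_part s = s.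
Proof. exact: max_l. Qed.

Lemma measurable_pos_part : measurable_fun [set: measurableTypeR R] (pos_part : _ -> measurableTypeR R).
Proof. exact: measurable_maxr. Qed.

(** A step function of two variables approximating f (a + b). For an orbit, its integral over a
    product measure is the composition of two Riemann sums. *)
Definition rsum2 (f : R -> X) n (a b : R) : X :=
  simple_eval (rsum (fun s => simple_eval (rsum (fun t => f (s + t)) n) b) n) a.

Lemma rsum2_in (f : R -> X) n (a b : R) : 0 <= a < n.+1%:R -> 0 <= b < n.+1%:R ->
  exists k l, [/\ cell n k a, cell n l b & rsum2 f n a b = f (k%:R * mesh R n + l%:R * mesh R n)].
Proof.
move=> an bn; rewrite /rsum2.
have [k [ka ->]] := rsum_eval_in (fun s => simple_eval (rsum (fun t => f (s + t)) n) b) an.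
by have [l [lb ->]] := rsum_eval_in (fun t => f (k%:R * mesh R n + t)) bn; exists k, l.
Qed.

Lemma rsum2_out (f : R -> X) n (a b : R) : n.+1%:R <= a \/ n.+1%:R <= b -> rsum2 f n a b = 0.
Proof.
rewrite /rsum2 => -[h|h]; first by rewrite rsum_eval_out.
by rewrite rsum_eval_sum big1// => k _; rewrite rsum_eval_out// scaler0.
Qed.

Lemma rsum2_norm (f : R -> X) K n (a b : R) : 0 <= a -> 0 <= b -> bounded_orbit f K ->
  rnorm (rsum2 f n a b) <= K.
Proof.
move=> a0 b0 fK; have K0 : 0 <= K := le_trans (rnorm_ge0 _) (fK 0 (lexx _)).
have [an|an] := ltP a n.+1%:R; last by rewrite rsum2_out ?rnorm0//; left.
have [bn|bn] := ltP b n.+1%:R; last by rewrite rsum2_out ?rnorm0//; right.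
have an' : 0 <= a < n.+1%:R by rewrite a0.
have bn' : 0 <= b < n.+1%:R by rewrite b0.
have [k [l [_ _ ->]]] := rsum2_in f an' bn'.
by apply: fK; rewrite addr_ge0// mesh_ge0.
Qed.

Lemma rsum2_cvg (f : R -> X) (a b : R) : 0 <= a -> 0 <= b -> unif_cont f ->
  (fun n => rnorm (f (a + b) - rsum2 f n a b)) @ \oo --> (0 : R).
Proof.
move=> a0 b0 uf; apply/cvgrPdist_lt => e e0; have [r r0 hr] := uf _ e0.
have r2 : 0 < r / 2 by rewrite divr_gt0.
have /cvgrPdist_lt cm := @cvg_mesh R; have cmr := cm _ r2.
near=> n.
rewrite sub0r normrN ger0_norm ?rnorm_ge0//.
have an : 0 <= a < n.+1%:R.
  rewrite a0; apply: (@lt_le_trans _ _ n%:R); last by rewrite ler_nat.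
  by near: n; exact: nbhs_infty_gtr.
have bn : 0 <= b < n.+1%:R.
  rewrite b0; apply: (@lt_le_trans _ _ n%:R); last by rewrite ler_nat.
  by near: n; exact: nbhs_infty_gtr.
have [k [l [ka lb ->]]] := rsum2_in f an bn.
have hm : mesh R n < r / 2.
  have : `|0 - mesh R n| < r / 2 by near: n; exact: cmr.
  by rewrite sub0r normrN ger0_norm// ltW// mesh_gt0.
apply: hr; [exact: addr_ge0|by rewrite addr_ge0// mesh_ge0|].
move: ka lb; rewrite /cell /= !in_itv /= => /andP[k1 k2] /andP[l1 l2].
move: k2 l2; rewrite -[k.+1%:R]natr1 -[l.+1%:R]natr1 !mulrDl mul1r => k2 l2.
rewrite ger0_norm; lra.
Unshelve. all: by end_near.
Qed.

(** * Convolution of measures and composition of operators *)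

Section Convolution.
Context (m1 m2 : pmeasure) (f1 : (m1 D < +oo)%E) (f2 : (m2 D < +oo)%E).

Let a1 : {finite_measure set (measurableTypeR R) -> \bar R} := mfrestr (@measurable_halfline R) f1.
Let a2 : {finite_measure set (measurableTypeR R) -> \bar R} := mfrestr (@measurable_halfline R) f2.

Local Notation RR := (measurableTypeR R * measurableTypeR R)%type.

Let P : {measure set RR -> \bar R} := (a1 \x a2)%E.

(* The positive parts only matter on a null set; they make the sum land in the half-line. *)
Definition posadd (p : RR) : measurableTypeR R := pos_part p.1 + pos_part p.2.

Lemma measurable_posadd : measurable_fun setT posadd.
Proof.
by apply: measurable_funD; apply: measurableT_comp => //; exact: measurable_pos_part.
Qed.

Definition conv : pmeasure :=
  measure_function_pushforward__canonical__measure_function_Measure P measurable_posadd.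

Let PsetT : P setT = (m1 D * m2 D)%E.
Proof.
transitivity (a1 setT * a2 setT)%E; first by rewrite -setXTT; exact: product_measure1E.
by rewrite /a1 /a2 /= /mfrestr /mrestr !setTI.
Qed.

Let finP : (P setT < +oo)%E.
Proof. by rewrite PsetT lte_mul_pinfty// ge0_fin_numE. Qed.

Lemma posadd_ge0 p : D (posadd p).
Proof. by apply/halflineP; rewrite addr_ge0// pos_part_ge0. Qed.

Lemma posadd_preimageD : posadd @^-1` D = setT.
Proof. by apply/seteqP; split => // p _; exact: posadd_ge0. Qed.

Lemma convD : conv D = (m1 D * m2 D)%E.
Proof. by rewrite /conv /= /pushforward posadd_preimageD PsetT. Qed.

Lemma elap_conv z : 0 <= z -> elap conv z = (elap m1 z * elap m2 z)%E.
Proof.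
move=> z0; rewrite /elap /conv (ge0_integral_pushforward measurable_posadd)//; last first.
  by apply/measurable_EFinP/measurable_funTS; exact: measurable_expMz.
rewrite posadd_preimageD.
pose e (s : measurableTypeR R) := expR (- (pos_part s * z)).
have me : measurable_fun setT e.
  exact: measurableT_comp (measurable_expMz z) measurable_pos_part.
have ee (m : pmeasure) : (\int[m]_(s in D) (e s)%:E = elap m z)%E.
  by apply: eq_integral => s /set_mem/halflineP s0; rewrite /e pos_part_id.
rewrite (@fubini_tonelli1 _ _ _ _ _ a1 a2); last 2 first.
- by apply/measurable_EFinP; exact: measurableT_comp (measurable_expMz z) measurable_posadd.
- by move=> p; rewrite /= lee_fin expR_ge0.
rewrite /fubini_F /=.
have inner s : (\int[a2]_t (expR (- (posadd (s, t) * z)))%:E = (e s)%:E * elap m2 z)%E.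
  under eq_integral do rewrite /posadd /= mulrDl opprD expRD EFinM.
  rewrite ge0_integralZl//; last exact/measurable_EFinP.
  congr (_ * _)%E; rewrite -ee -(@ge0_integral_mfrestr m2 f2 (fun s => (e s)%:E))//.
    exact/measurable_EFinP.
  by move=> t; rewrite lee_fin expR_ge0.
under eq_integral do rewrite inner.
rewrite ge0_integralZr//; last 3 first.
- exact/measurable_EFinP.
- by move=> t _; rewrite lee_fin expR_ge0.
- exact: elap_ge0.
rewrite (@ge0_integral_mfrestr m1 f1 (fun s => (e s)%:E)) ?ee//.
- exact/measurable_EFinP.
- by move=> t; rewrite lee_fin expR_ge0.
Qed.

Let pcell n k : set (measurableTypeR R) := pos_part @^-1` cell n k.

Let measurable_pcell n k : measurable (pcell n k).
Proof. by rewrite -[pcell n k]setTI; apply: measurable_pos_part => //; exact: measurable_cell. Qed.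

Let pcellD n k : pcell n k `&` D = cell n k `&` D.
Proof.
apply/seteqP; split => s [h /[dup] sD /halflineP s0]; split => //.
  by move: h; rewrite /pcell /preimage /= pos_part_id.
by rewrite /pcell /preimage /= pos_part_id.
Qed.

Let s1 x n : seq (set RR * X) :=
  [seq (posadd @^-1` cell n k, T (k%:R * mesh R n) x) | k <- iota 0 (n.+1 * n.+1)].

Let s2 x n : seq (set RR * X) :=
  [seq (pcell n k `*` pcell n l, T (k%:R * mesh R n + l%:R * mesh R n) x)
     | k <- iota 0 (n.+1 * n.+1), l <- iota 0 (n.+1 * n.+1)].

Let meas_s1 x n : meas_sets (s1 x n).
Proof.
move=> p /mapP[k _ ->] /=; rewrite -[_ @^-1` _]setTI.
by apply: measurable_posadd => //; exact: measurable_cell.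
Qed.

Let meas_s2 x n : meas_sets (s2 x n).
Proof. by move=> p /allpairsP[[k l] /= [_ _ ->]]; apply: measurableX; exact: measurable_pcell. Qed.

Let iota_sum (V : nmodType) N (g : nat -> V) : \sum_(k <- iota 0 N) g k = \sum_(k < N) g k.
Proof. by rewrite -(big_mkord xpredT g) /index_iota subn0. Qed.

Let eval_s1 x n p : simple_eval (s1 x n) p = simple_eval (rsum (fun t => T t x) n) (posadd p).
Proof. by rewrite rsum_eval_sum /simple_eval big_map iota_sum. Qed.

Let eval_s2 x n p : simple_eval (s2 x n) p = rsum2 (fun t => T t x) n (pos_part p.1) (pos_part p.2).
Proof.
rewrite /rsum2 rsum_eval_sum /simple_eval big_allpairs_dep iota_sum.
apply: eq_bigr => k _; rewrite big_map [in RHS]iota_sum iota_sum scaler_sumr.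
apply: eq_bigr => l _; rewrite scalerA; congr (_ *: _) => /=.
by rewrite !indicE in_setX -natrM mulnb.
Qed.

Let int_s1 x n : simple_integral P setT (s1 x n) = rs T conv n x.
Proof.
rewrite /rs /simple_integral big_map iota_sum; apply: eq_bigr => k _ /=.
by rewrite /pushforward preimage_setI posadd_preimageD.
Qed.

Let int_s2 x n : simple_integral P setT (s2 x n) = rs T m1 n (rs T m2 n x).
Proof.
rewrite /rs /simple_integral big_allpairs_dep iota_sum; apply: eq_bigr => k _.
rewrite iota_sum (Tsum hT) ?mesh_ge0// scaler_sumr; apply: eq_bigr => l _.
transitivity ((fine (P ((pcell n k `*` pcell n l) `&` setT)))%:C *:
  T (k%:R * mesh R n + l%:R * mesh R n) x); first by [].
rewrite (TZ hT) ?mesh_ge0// scalerA (Tadd hT) ?mesh_ge0//; congr (_ *: _).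
rewrite setIT -rmorphM; congr (_%:C).
transitivity (fine (a1 (pcell n k) * a2 (pcell n l))%E).
  by congr fine; exact: product_measure1E.
rewrite /a1 /a2 /= /mfrestr /mrestr !pcellD fineM//.
- rewrite ge0_fin_numE// (le_lt_trans _ f1)// le_measure ?inE//; exact: measurable_cellD.
- rewrite ge0_fin_numE// (le_lt_trans _ f2)// le_measure ?inE//; exact: measurable_cellD.
Qed.

(** The Riemann sum for the convolution and the composition of the Riemann sums for m1 and m2 are
    integrals, over the same product measure, of two step functions. Both stay bounded and tend to
    the orbit at the sum of the coordinates, so the norm of their difference integrates to 0 in the
    limit. *)
Lemma hp_conv x : hp_pos T conv x = hp_pos T m1 (hp_pos T m2 x).
Proof.
have fc : (conv D < +oo)%E by rewrite convD -PsetT.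
have dist0 : (fun n => rs T conv n x - rs T m1 n (rs T m2 n x)) @ \oo --> (0 : X).
  have K0 : 0 <= M * rnorm x by rewrite mulr_ge0 ?(M0 hT)// rnorm_ge0.
  have mm n : meas_sets (s1 x n ++ simple_opp (s2 x n)).
    by apply: meas_sets_cat; [exact: meas_s1|apply: meas_sets_opp; exact: meas_s2].
  pose u n p := rnorm (simple_eval (s1 x n ++ simple_opp (s2 x n)) p).
  have mu n : measurable_fun [set: RR] (u n).
    apply: (@eq_measurable_fun _ _ _ _ _ _ _ _
      (@measurable_rnorm_simple _ _ _ X (cst 0) setT _ 0 measurableT (mm n) _)) => [p _|c].
      by rewrite /= !add0r rnormN.
    exact: (@measurable_cst _ _ _ _ _ (rnorm (0 - c))).
  have bd n p : simple_eval (rsum (fun t => T t x) n) (posadd p) = 0 \/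
      rnorm (simple_eval (rsum (fun t => T t x) n) (posadd p)) <= M * rnorm x.
    have [h|h] := ltP (posadd p) n.+1%:R; last by left; rewrite rsum_eval_out.
    have pn : 0 <= posadd p < n.+1%:R by rewrite h addr_ge0// pos_part_ge0.
    have [k [_ ->]] := rsum_eval_in (fun t => T t x) pn.
    by right; apply: (Tbd hT); rewrite mesh_ge0.
  apply: (@cvg_rnorm_esqueeze _ _ _ _ (fun n => \int[P]_(p in setT) (u n p)%:E)%E) => [n|].
    rewrite subr0 -int_s1 -int_s2 -simple_integral_sub.
    by apply: simple_integral_norm.
  apply: (@bounded_cvg_integral0 _ _ _ _ _ _ (2 * (M * rnorm x))) => //.
    move=> n p _; rewrite rnorm_ge0 /= /u simple_eval_sub eval_s1 eval_s2.
    rewrite (le_trans (rnormB _ _))// mulr2n mulrDl mul1r lerD//.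
      by have [->|//] := bd n p; rewrite rnorm0.
    by apply: rsum2_norm; [exact: pos_part_ge0..|exact: orbit_bounded].
  move=> p _.
  have p10 := pos_part_ge0 p.1; have p20 := pos_part_ge0 p.2.
  have p0 : 0 <= posadd p by rewrite addr_ge0.
  have c1 := rsum_eval_cvg p0 (orbit_unif_cont hT x).
  have c2 := rsum2_cvg p10 p20 (orbit_unif_cont hT x).
  apply: (@squeeze_cvgr _ _ _ _ (cst 0)); last 2 first.
  - exact: cvg_cst.
  - by have := cvgD c1 c2; rewrite addr0; apply.
  apply: nearW => n; rewrite /= rnorm_ge0 /= /u simple_eval_sub eval_s1 eval_s2.
  by rewrite [X in _ <= X + _]rnorm_distC; exact: rnorm_dist_triangle.
(* The operators [rs T m1 n] are bounded uniformly in n, so the limit of the inner sums may be taken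
   inside them. *)
have lim2 : (fun n => rs T m1 n (rs T m2 n x)) @ \oo --> hp_pos T m1 (hp_pos T m2 x).
  have /cvg_rnorm0P d2 := rs_cvg hT (x := x) f2.
  have /cvg_rnorm0P d1 := rs_cvg hT (x := hp_pos T m2 x) f1.
  apply: (@cvg_rnorm_squeeze _ _ _ _ _ _ _ (fun n =>
    M * fine (m1 D) * rnorm (rs T m2 n x - hp_pos T m2 x) +
    rnorm (rs T m1 n (hp_pos T m2 x) - hp_pos T m1 (hp_pos T m2 x)))).
    apply: nearW => n.
    apply: (le_trans (rnorm_dist_triangle (rs T m1 n (hp_pos T m2 x)) _ _)).
    rewrite lerD2r -(rsB hT); exact: rs_norm.
  rewrite -[X in _ --> X](addr0 0); apply: cvgD => //.
  by rewrite -[X in _ --> X](mulr0 (M * fine (m1 D))); exact: cvgMl_tmp.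
apply: (cvg_vec_unique (rs_cvg hT (x := x) fc)).
have h := cvgD dist0 lim2; rewrite add0r in h.
suff -> : (fun n => rs T conv n x) = (fun n => rs T conv n x - rs T m1 n (rs T m2 n x)) +
  (fun n => rs T m1 n (rs T m2 n x)) by exact: h.
by apply/funext => n; rewrite -[RHS]/(_ - _ + _) subrK.
Qed.

End Convolution.

Lemma pcalcM f F c f' F' c' : pcalc f F c -> pcalc f' F' c' ->
  pcalc (fun z => f z * f' z) (fun x => F (F' x)) (c * c').
Proof.
move=> pf; have c0 := pcalc_ge0 pf; move: pf => [m [mc mf mF]] [m' [mc' mf' mF']].
have fm := pcalc_lty mc; have fm' := pcalc_lty mc'.
have mD : (conv fm fm' D <= (c * c')%:E)%E by rewrite convD EFinM lee_pmul.
exists (conv fm fm'); split => // [z z0|x].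
  rewrite mf// mf'//; apply: EFin_inj; rewrite EFinM !lapE ?ltW//; last exact: pcalc_lty mD.
  by rewrite elap_conv// ltW.
by rewrite mF mF' hp_conv.
Qed.

Lemma pcalc_op_norm f F c x : pcalc f F c -> rnorm (F x) <= M * c * rnorm x.
Proof.
move=> [m [mc _ ->]]; have fm := pcalc_lty mc.
apply: (le_trans (hp_pos_norm hT x fm)); rewrite ler_wpM2r ?rnorm_ge0// ler_wpM2l ?(M0 hT)//.
by rewrite -lee_fin fineK// ge0_fin_numE.
Qed.

Lemma pcalc_opD f F c x y : pcalc f F c -> F (x + y) = F x + F y.
Proof. by move=> [m [mc _ mF]]; rewrite !mF (hp_posD hT)//; exact: pcalc_lty mc. Qed.

Lemma pcalc_opZ f F c (a : R[i]) x : pcalc f F c -> F (a *: x) = a *: F x.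
Proof. by move=> [m [mc _ mF]]; rewrite !mF (hp_posZ hT)//; exact: pcalc_lty mc. Qed.

Lemma pcalc_le f F c z : pcalc f F c -> 0 < z -> 0 <= f z <= c.
Proof.
by move=> [m [mc mf _]] z0; rewrite mf// lap_ge0 lap_le// ltW.
Qed.

End PositiveCalculus.

(** * Uniqueness of the Laplace transform *)

Section BernsteinPolynomials.
Context (R : realType).
Implicit Types (F G : nat -> R) (x a : R).

(* The expectation of F over a binomial variable with parameters n and x,
   as a polynomial in x, computed by conditioning on the first trial. *)
Fixpoint bern n F : {poly R} :=
  if n is n'.+1 then 'X * bern n' (F \o S) + (1 - 'X) * bern n' F else (F 0%N)%:P.

Lemma bernS n F x : (bern n.+1 F).[x] = x * (bern n (F \o S)).[x] + (1 - x) * (bern n F).[x].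
Proof. by rewrite /= !hornerE. Qed.

Lemma bern_at0 n F : (bern n F).[0] = F 0%N.
Proof.
elim: n F => [|n IH] F; first by rewrite /= hornerC.
by rewrite bernS IH mul0r add0r subr0 mul1r.
Qed.

Lemma bern_le n F G x : 0 <= x <= 1 -> (forall k, (k <= n)%N -> F k <= G k) ->
  (bern n F).[x] <= (bern n G).[x].
Proof.
move=> /andP[x0 x1]; elim: n F G => [|n IH] F G FG; first by rewrite /= !hornerC FG.
rewrite !bernS lerD// ler_wpM2l ?subr_ge0// IH// => k kn /=.
  by apply: FG.
by apply: FG; exact: leqW.
Qed.

Lemma bern_lin n F G x a : (bern n (fun k => F k + a * G k)).[x] =
  (bern n F).[x] + a * (bern n G).[x].
Proof.
elim: n F G => [|n IH] F G; first by rewrite /= !hornerC.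
by rewrite !bernS (IH (F \o S) (G \o S)) IH; ring.
Qed.

Lemma bern_cst n x a : (bern n (fun=> a)).[x] = a.
Proof.
elim: n => [|n IH]; first by rewrite /= hornerC.
by rewrite bernS [_ \o S](_ : _ = (fun=> a))// IH; ring.
Qed.

(** Variance plus squared bias of a binomial variable. The centre a is arbitrary because
    conditioning on a successful trial shifts it by 1. *)
Lemma bern_sqr n x a :
  (bern n (fun k => (k%:R - a) ^+ 2)).[x] = n%:R * x * (1 - x) + (n%:R * x - a) ^+ 2.
Proof.
elim: n a => [|n IH] a; first by rewrite /= hornerC; ring.
rewrite bernS (_ : _ \o S = (fun k : nat => (k%:R - (a - 1)) ^+ 2)); last first.
  by apply/funext => k /=; rewrite -natr1; congr (_ ^+ 2); ring.
by rewrite !IH -natr1; ring.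
Qed.

(** Chebyshev's argument in the form y <= e + y^2 / e, which reduces a Lipschitz bound to the second
    moment. The parameter e is left free; the estimate is useful when e^2 n is of order 1 or
    more. *)
Lemma bern_approx n (phi : R -> R) (L e x : R) : (0 < n)%N -> 0 <= x <= 1 -> 0 < e -> 0 <= L ->
  (forall u v, 0 <= u <= 1 -> 0 <= v <= 1 -> `|phi u - phi v| <= L * `|u - v|) ->
  `|(bern n (fun k => phi (k%:R / n%:R))).[x] - phi x| <= L * (e + (e * n%:R)^-1).
Proof.
move=> n0 x01 e0 L0 phiL; have n0' : 0 < n%:R :> R by rewrite ltr0n.
pose G k := L * (e + (k%:R - n%:R * x) ^+ 2 / (e * n%:R ^+ 2)).
have FG k : (k <= n)%N -> `|phi (k%:R / n%:R) - phi x| <= G k.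
  move=> kn; have kn1 : 0 <= (k%:R / n%:R : R) <= 1.
    by rewrite divr_ge0//= ler_pdivrMr// mul1r ler_nat.
  apply: (le_trans (phiL _ _ kn1 x01)); rewrite /G ler_wpM2l//.
  have -> : (k%:R - n%:R * x) ^+ 2 / (e * n%:R ^+ 2) = `|k%:R / n%:R - x| ^+ 2 / e.
    by rewrite real_normK ?num_real//; field; rewrite !gt_eqF.
  set y := `|_|; have y0 : 0 <= y by exact: normr_ge0.
  rewrite -lerBlDl ler_pdivlMr//; have := sqr_ge0 (y - e); nra.
have eG : (bern n G).[x] <= L * (e + (e * n%:R)^-1).
  have -> : (bern n G).[x] = L * e + L / (e * n%:R ^+ 2) * (n%:R * x * (1 - x) + (n%:R * x - n%:R * x) ^+ 2).
    rewrite -bern_sqr -[X in _ = X + _](bern_cst n x (L * e)) -bern_lin.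
    by congr ((bern n _).[x]); apply/funext => k; rewrite /G mulrDr mulrA; congr (_ + _); rewrite mulrAC.
  rewrite subrr expr0n addr0 [leRHS]mulrDr lerD2l.
  have -> : L / (e * n%:R ^+ 2) * (n%:R * x * (1 - x)) = L * ((e * n%:R)^-1 * (x * (1 - x))).
    by field; rewrite !gt_eqF.
  rewrite ler_wpM2l//.
  rewrite -[X in _ <= X]mulr1 ler_wpM2l ?invr_ge0 ?mulr_ge0// ?ltW//.
  by move: x01 => /andP[x0 x1]; nra.
have shift : (bern n (fun k => phi (k%:R / n%:R))).[x] - phi x =
    (bern n (fun k => phi (k%:R / n%:R) - phi x)).[x].
  rewrite -[X in _ - X](bern_cst n x (phi x)) -mulN1r -bern_lin.
  by congr ((bern n _).[x]); apply/funext => k; rewrite mulN1r.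
rewrite shift ler_norml; apply/andP; split.
  rewrite lerNl; apply: le_trans eG; rewrite -subr_ge0.
  have := @bern_lin n G (fun k => phi (k%:R / n%:R) - phi x) x 1.
  rewrite mul1r opprK => <-; rewrite -[leLHS](bern_cst n x 0); apply: bern_le => // k kn.
  by have := FG k kn; rewrite ler_norml => /andP[h _]; lra.
apply: le_trans eG; apply: bern_le => // k kn.
by have := FG k kn; rewrite ler_norml => /andP[_].
Qed.

End BernsteinPolynomials.

Section BoundedIntegrals.
Context d (S : measurableType d) (R : realType) (m : {measure set S -> \bar R}) (E : set S)
  (mE : measurable E) (fE : (m E < +oo)%E).

Lemma bounded_integrable (u : S -> R) (C : R) : measurable_fun E u ->
  (forall s, E s -> `|u s| <= C) -> m.-integrable E (EFin \o u).
Proof.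
move=> mu uC; apply: (@le_integrable _ _ _ m E mE _ (cst C%:E)).
- exact/measurable_EFinP.
- by move=> s Es /=; rewrite lee_fin (le_trans (uC _ Es))// ler_norm.
- apply/integrableP; split; first exact: measurable_cst.
  by rewrite /= integral_cst// lte_mul_pinfty.
Qed.

Lemma Rintegral_dist (u v : S -> R) (e C : R) : measurable_fun E u -> measurable_fun E v ->
  (forall s, E s -> `|u s| <= C) -> (forall s, E s -> `|u s - v s| <= e) ->
  `|\int[m]_(s in E) u s - \int[m]_(s in E) v s| <= e * fine (m E).
Proof.
move=> mu mv uC uv.
have iu := bounded_integrable mu uC.
have iv : m.-integrable E (EFin \o v).
  apply: (bounded_integrable (C := C + e)) => // s Es.
  rewrite -[v s](subrK (u s)) addrC (le_trans (ler_normD _ _))// lerD ?uC//.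
  by rewrite distrC uv.
rewrite -RintegralB//; apply: (le_trans (le_normr_Rintegral mE _)).
  exact: (integrableB mE iu iv).
rewrite -Rintegral_cst//; apply: le_Rintegral => //.
- by apply: integrable_norm; exact: (integrableB mE iu iv).
- apply/integrableP; split; first exact: measurable_cst.
  by rewrite /= integral_cst// lte_mul_pinfty.
Qed.

Lemma Rintegral_sum (u : nat -> S -> R) (N : nat) :
  (forall i, m.-integrable E (EFin \o u i)) ->
  \int[m]_(s in E) (\sum_(i < N) u i s) = \sum_(i < N) \int[m]_(s in E) u i s.
Proof.
move=> iu; have iS n : m.-integrable E (EFin \o (fun s => \sum_(i < n) u i s)).
  elim: n => [|n IH].
    by have := integrable0 m E; apply: eq_integrable => // s _ /=; rewrite big_ord0.
  have := integrableD mE IH (iu n); apply: eq_integrable => // s _ /=.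
  by rewrite big_ord_recr.
elim: N => [|N IH].
  rewrite big_ord0; under eq_Rintegral do rewrite big_ord0.
  by rewrite Rintegral_cst// mul0r.
under eq_Rintegral do rewrite big_ord_recr /=.
by rewrite big_ord_recr /= -IH (RintegralD mE (iS N) (iu N)).
Qed.

Lemma bounded_cvg_Rintegral (u_ : nat -> S -> R) (u : S -> R) (C : R) :
  (forall n, measurable_fun E (u_ n)) -> measurable_fun E u ->
  (forall n s, E s -> `|u_ n s| <= C) ->
  (forall s, E s -> u_ ^~ s @ \oo --> u s) ->
  (fun n => \int[m]_(s in E) u_ n s) @ \oo --> \int[m]_(s in E) u s.
Proof.
move=> mu_ mu uC uu.
have cv : {ae m, forall x, E x -> (fun n => (u_ n x)%:E) @ \oo --> (EFin \o u) x}.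
  by apply: aeW => w Ew; apply: cvg_EFin; [exact: nearW|exact: uu].
have ic : m.-integrable E (cst C%:E).
  apply/integrableP; split; first exact: measurable_cst.
  by rewrite /= integral_cst// lte_mul_pinfty.
have dom : {ae m, forall x n, E x -> (`|(u_ n x)%:E| <= cst C%:E x)%E}.
  by apply: aeW => w n Ew /=; rewrite lee_fin uC.
have mu' n : measurable_fun E (fun x => (u_ n x)%:E) by apply/measurable_EFinP.
have [iu _] := dominated_convergence mE mu' (iffRL (measurable_EFinP _ _) mu) cv ic dom.
have fu : (\int[m]_(x in E) (EFin \o u) x)%E \is a fin_num by exact: integrable_fin_num iu.
by rewrite -(fineK fu) => /fine_cvgP[_].
Qed.

End BoundedIntegrals.

Section LaplaceUniqueness.
Context (R : realType).
Local Notation pmeasure := {measure set (measurableTypeR R) -> \bar R}.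
Local Notation D := (`[0, +oo[%classic : set (measurableTypeR R)).

Lemma expRN_itv (s : R) : 0 <= s -> 0 <= expR (- s) <= 1.
Proof. by move=> s0; rewrite expR_ge0 -expR0 ler_expR oppr_le0. Qed.

Lemma measurable_expRN : measurable_fun [set: measurableTypeR R] (fun s : R => expR (- s)).
Proof. by do 2 apply: measurableT_comp => //. Qed.

Lemma integral_poly_expRN (m : pmeasure) (p : {poly R}) : (m D < +oo)%E ->
  \int[m]_(s in D) p.[expR (- s)] = \sum_(i < size p) p`_i * lap m i%:R.
Proof.
move=> fm; have mD := @measurable_halfline R.
have iu i : m.-integrable D (EFin \o (fun s : R => expR (- (s * i%:R)))).
  apply: (bounded_integrable mD fm (C := 1)).
    by apply: measurable_funTS; exact: measurable_expMz.
  move=> s /halflineP s0; rewrite ger0_norm ?expR_ge0//.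
  by rewrite -expR0 ler_expR oppr_le0 mulr_ge0.
under eq_Rintegral => s _.
  rewrite horner_coef.
  under eq_bigr => i _ do rewrite -expRM_natl mulrN [i%:R * s]mulrC.
  over.
rewrite (Rintegral_sum mD (u := fun i s => p`_i * expR (- (s * i%:R)))).
  by apply: eq_bigr => i _; rewrite RintegralZl.
by move=> i; exact: (integrableZl mD (p`_i) (iu i)).
Qed.

(** The transforms are only known to agree at z > 0, so the total mass, which is their value at 0,
    must not enter. The condition p.[0] = 0 removes that term. *)
Lemma integral_poly_unique (m m' : pmeasure) (p : {poly R}) : (m D < +oo)%E -> (m' D < +oo)%E ->
  (forall z, 0 < z -> lap m z = lap m' z) -> p.[0] = 0 ->
  \int[m]_(s in D) p.[expR (- s)] = \int[m']_(s in D) p.[expR (- s)].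
Proof.
move=> fm fm' mm' p0; rewrite !integral_poly_expRN//; apply: eq_bigr => -[[|i] /= ilt] _.
  by rewrite -horner_coef0 p0 !mul0r.
by rewrite mm'// ltr0n.
Qed.

(* The Bernstein polynomials of a continuous function of e^-s are integrated by the
   values of the Laplace transform at the integers. *)
Lemma integral_lipschitz_unique (m m' : pmeasure) (phi : R -> R) (L : R) :
  (m D < +oo)%E -> (m' D < +oo)%E ->
  (forall z, 0 < z -> lap m z = lap m' z) -> phi 0 = 0 -> 0 <= L ->
  measurable_fun setT phi ->
  (forall u v, 0 <= u <= 1 -> 0 <= v <= 1 -> `|phi u - phi v| <= L * `|u - v|) ->
  \int[m]_(s in D) phi (expR (- s)) = \int[m']_(s in D) phi (expR (- s)).
Proof.
move=> fm fm' mm' phi0 L0 mphi phiL; have mD := @measurable_halfline R.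
have mphie : measurable_fun D (fun s : measurableTypeR R => phi (expR (- s))).
  by apply: measurable_funTS; apply: measurableT_comp => //; exact: measurable_expRN.
have bphi s : D s -> `|phi (expR (- s))| <= L.
  move=> /halflineP s0; have es := expRN_itv s0.
  have := phiL _ 0 es; rewrite lexx ler01 => /(_ isT).
  rewrite phi0 !subr0 => h; apply: (le_trans h); rewrite -[leRHS]mulr1 ler_wpM2l//.
  by rewrite ger0_norm ?expR_ge0//; case/andP: es.
pose p n : {poly R} := bern n (fun k => phi (k%:R / n%:R)).
have mp n : measurable_fun D (fun s : measurableTypeR R => (p n).[expR (- s)]).
  apply: measurable_funTS; apply: (measurableT_comp (f := fun x : R => (p n).[x])).
    by apply: continuous_measurable_fun; exact: continuous_horner.
  exact: measurable_expRN.
have close (n : nat) (e : R) : (0 < n)%N -> 0 < e ->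
    `|\int[m]_(s in D) phi (expR (- s)) - \int[m']_(s in D) phi (expR (- s))| <=
    (L * (e + (e * n%:R)^-1)) * (fine (m D) + fine (m' D)).
  move=> n0 e0.
  have pu := integral_poly_unique fm fm' mm' (p := p n).
  rewrite bern_at0 mul0r phi0 in pu.
  have ap s : D s -> `|phi (expR (- s)) - (p n).[expR (- s)]| <= L * (e + (e * n%:R)^-1).
    by move=> /halflineP s0; rewrite distrC; apply: bern_approx => //; exact: expRN_itv.
  have h1 := Rintegral_dist mD fm mphie (mp n) bphi ap.
  have h2 := Rintegral_dist mD fm' mphie (mp n) bphi ap.
  rewrite mulrDr; apply: le_trans (lerD h1 h2).
  rewrite [X in _ <= _ + X]distrC -pu//.
  rewrite (le_trans _ (ler_normD _ _))//.
  by rewrite addrA subrK.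
apply/eqP; rewrite -subr_eq0 -normr_eq0; apply/eqP.
set d := `|_| in close *.
have d0 : 0 <= d by exact: normr_ge0.
set K := fine (m D) + fine (m' D) in close.
have K0 : 0 <= K by rewrite addr_ge0// fine_ge0.
have small (e : R) : 0 < e -> d <= L * (2 * e) * K.
  (* With n > 1/e^2 the term 1/(e n) is at most e. *)
  move=> e0; pose n := (Num.truncn ((e * e)^-1)).+1.
  have hn : (e * e)^-1 < n%:R by rewrite truncnS_gt.
  have := close n e isT e0; move=> /le_trans; apply.
  rewrite ler_wpM2r// ler_wpM2l// mulr2n mulrDl mul1r lerD2l.
  rewrite -div1r ler_pdivrMr ?mulr_gt0 ?ltr0n// mulrA mulrC.
  by move: (ltW hn); rewrite -[_^-1]div1r ler_pdivrMr ?mulr_gt0.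
apply/eqP; rewrite eq_le d0 andbT; apply/ler_addgt0Pl => e e0; rewrite addr0.
have c0 : 0 < L * 2 * K + 1 by rewrite ltr_wpDl// !mulr_ge0.
have := small (e / (L * 2 * K + 1)); rewrite divr_gt0// => /(_ isT) /le_trans; apply.
have -> : L * (2 * (e / (L * 2 * K + 1))) * K = e * ((L * 2 * K) / (L * 2 * K + 1)) by ring.
rewrite -[leRHS]mulr1 ler_wpM2l ?(ltW e0)// ler_pdivrMr// mul1r; lra.
Qed.

Definition ramp (theta : R) (n : nat) (x : R) : R :=
  Num.max 0 (Num.min 1 (n%:R * (x - theta))).

Lemma ramp_lipschitz theta n u v : `|ramp theta n u - ramp theta n v| <= n%:R * `|u - v|.
Proof.
have h : `|n%:R * (u - theta) - n%:R * (v - theta)| = n%:R * `|u - v|.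
  by rewrite -mulrBr normrM ger0_norm//; congr (_ * `|_|); ring.
rewrite -h /ramp ![Num.max 0 _]maxC; apply: (le_trans (dist_max0 _ _)).
set a := n%:R * (u - theta); set b := n%:R * (v - theta).
have h1 := ler_norm (a - b); have h2 := ler_norm (b - a); rewrite distrC in h2.
by rewrite /Num.min; case: ltP => ?; case: ltP => ?; rewrite ler_norml; apply/andP; split; lra.
Qed.

Lemma measurable_ramp theta n : measurable_fun setT (ramp theta n).
Proof.
apply: measurable_maxr => //; apply: measurable_minr => //.
by apply: measurable_funM => //; exact: measurable_funB.
Qed.

Lemma ramp_norm theta n x : `|ramp theta n x| <= 1.
Proof.
have r0 : 0 <= ramp theta n x by rewrite le_max lexx.
by rewrite ger0_norm// ge_max ler01 ge_min lexx.
Qed.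

Lemma ramp_cvg (theta x : R) :
  (fun n => ramp theta n x) @ \oo --> (\1_(`]theta, +oo[%classic : set R) x : R).
Proof.
rewrite indicE; have [h|h] := ltP theta x.
  rewrite mem_set /=; last by rewrite in_itv /= h.
  apply: cvg_near_cst; near=> n.
  have : (x - theta)^-1 < n%:R by near: n; exact: nbhs_infty_gtr.
  rewrite -[_^-1]mul1r ltr_pdivrMr ?subr_gt0// => nx.
  by rewrite /ramp min_l ?max_r// ltW.
rewrite memNset /=; last by rewrite in_itv /= ltNge h.
apply: cvg_near_cst; apply: nearW => n.
have xt : n%:R * (x - theta) <= 0 by rewrite mulr_ge0_le0// subr_le0.
by rewrite /ramp min_r ?max_l// (le_trans xt).
Unshelve. all: by end_near.
Qed.

(** The condition s < b reads e^(-s) > e^(-b). The indicator of ]e^(-b), +oo[ is the bounded limit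
    of Lipschitz ramps, which vanish at 0 because the threshold is positive, so that
    [integral_lipschitz_unique] applies to each of them. *)
Lemma lap_unique_itv (m m' : pmeasure) (b : R) : (m D < +oo)%E -> (m' D < +oo)%E ->
  (forall z, 0 < z -> lap m z = lap m' z) -> m `[0, b[%classic = m' `[0, b[%classic.
Proof.
move=> fm fm' mm'; have mD := @measurable_halfline R.
have fin (mu : pmeasure) : (mu D < +oo)%E -> mu (`[0, b[%classic : set R) \is a fin_num.
  move=> fmu; rewrite ge0_fin_numE// (le_lt_trans _ fmu)// le_measure ?inE//.
  by move=> s /=; rewrite !in_itv /= andbT => /andP[].
pose theta := expR (- b).
pose I (s : measurableTypeR R) : R := \1_(`]theta, +oo[%classic : set R) (expR (- s)).
have mI : measurable_fun D I.
  apply: measurable_funTS; apply: (measurableT_comp (f := \1_(`]theta, +oo[%classic : set R) : R -> R)) => //.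
  exact: measurable_expRN.
have lim (mu : pmeasure) : (mu D < +oo)%E ->
    (fun n => \int[mu]_(s in D) ramp theta n (expR (- s))) @ \oo --> \int[mu]_(s in D) I s.
  move=> fmu; apply: (bounded_cvg_Rintegral mD fmu (C := 1)) => //.
  - move=> n; apply: measurable_funTS; apply: (measurableT_comp (f := ramp theta n)).
      exact: measurable_ramp.
    exact: measurable_expRN.
  - by move=> n s _; exact: ramp_norm.
  - by move=> s _; exact: ramp_cvg.
have value (mu : pmeasure) : (mu D < +oo)%E -> (\int[mu]_(s in D) I s)%:E = mu (`[0, b[%classic : set R).
  move=> fmu; have IE s : I s = \1_(`]-oo, b[%classic : set R) s.
    rewrite /I !indicE; have [sb|sb] := ltP s b.
      by rewrite !mem_set//= in_itv /= ?sb// andbT ltr_expR ltrN2.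
    by rewrite !memNset//= in_itv /= ?andbT ?ltr_expR ?ltrN2; apply/negP; rewrite -leNgt.
  under eq_Rintegral do rewrite IE.
  rewrite /Rintegral integral_indic//.
  have -> : `]-oo, b[%classic `&` D = `[0, b[%classic :> set R.
    apply/seteqP; split => s /=; rewrite !in_itv /= andbT; first by move=> [-> ->].
    by move=> /andP[].
  by rewrite fineK// fin.
rewrite -!value//; congr (_%:E).
apply: (@cvg_unique _ (@Rhausdorff R) _ _ _ _ (lim m fm)).
suff -> : (fun n => \int[m]_(s in D) ramp theta n (expR (- s))) =
    (fun n => \int[m']_(s in D) ramp theta n (expR (- s))) by exact: lim.
apply/funext => n; apply: (@integral_lipschitz_unique m m' _ n%:R) => //.
- have t0 : n%:R * (0 - theta) <= 0 by rewrite sub0r mulrN oppr_le0 mulr_ge0// expR_ge0.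
  by rewrite /ramp max_l// ge_min t0 orbT.
- exact: measurable_ramp.
- by move=> u v _ _; exact: ramp_lipschitz.
Qed.

Lemma lap_unique_cell (m m' : pmeasure) n k : (m D < +oo)%E -> (m' D < +oo)%E ->
  (forall z, 0 < z -> lap m z = lap m' z) -> m (cell n k `&` D) = m' (cell n k `&` D).
Proof.
move=> fm fm' mm'.
have cE : cell n k `&` D = `[0, k.+1%:R * mesh R n[%classic `\` `[0, k%:R * mesh R n[%classic.
  rewrite /cell; apply/seteqP; split => s /=; rewrite !in_itv /= ?andbT.
    by move=> [/andP[h1 ->] h2]; split; rewrite ?h2//; apply/negP; rewrite -leNgt.
  by move=> [/andP[-> ->] /negP]; rewrite -leNgt => ->.
have sub : `[0, k%:R * mesh R n[%classic `<=` (`[0, k.+1%:R * mesh R n[%classic : set R).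
  move=> s /=; rewrite !in_itv /= => /andP[-> /lt_le_trans]; apply.
  by rewrite ler_wpM2r ?ler_nat// ltW// mesh_gt0.
have fin (mu : pmeasure) b : (mu D < +oo)%E -> (mu (`[0%R, b[%classic : set R) < +oo)%E.
  move=> fmu; rewrite (le_lt_trans _ fmu)// le_measure ?inE//.
  by move=> s /=; rewrite !in_itv /= andbT => /andP[].
rewrite cE !measureD//; [|exact: fin..].
rewrite (setIidr sub).
by congr (_ - _)%E; exact: lap_unique_itv.
Qed.

End LaplaceUniqueness.

Lemma hp_pos_unique (R : realType) (X : completeNormedModType R[i]) (T : R -> X -> X) (M : R)
    (m m' : {measure set (measurableTypeR R) -> \bar R}) x : bounded_C0 T M ->
  (m `[0%R, +oo[%classic < +oo)%E -> (m' `[0%R, +oo[%classic < +oo)%E ->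
  (forall z, 0 < z -> lap m z = lap m' z) -> hp_pos T m x = hp_pos T m' x.
Proof.
move=> hT fm fm' mm'; apply: (hp_pos_congr hT) => // n k.
exact: lap_unique_cell.
Qed.

(** * The signed calculus *)

Lemma real_cvg_le (R : realType) (u : nat -> R) (l C : R) :
  u @ \oo --> l -> (forall n, u n <= C) -> l <= C.
Proof.
move=> ul uC; rewrite -(cvg_lim (@Rhausdorff R) ul).
by apply: limr_le; [apply/cvg_ex; eexists; exact: ul|exact: nearW].
Qed.

Section SignedCalculus.
Context (R : realType) (X : completeNormedModType R[i]) (T : R -> X -> X) (M : R)
  (hT : bounded_C0 T M).
Implicit Types (f g : R -> R) (F : X -> X) (c : R) (x : X).

Local Notation pc p := (pcalc T p.1.1 p.1.2 p.2).

Local Notation triple := ((R -> R) * (X -> X) * R)%type.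

Let padd (p q : triple) : triple :=
  ((fun z => p.1.1 z + q.1.1 z), (fun x => p.1.2 x + q.1.2 x), p.2 + q.2).
Let pmul (p q : triple) : triple :=
  ((fun z => p.1.1 z * q.1.1 z), (fun x => p.1.2 (q.1.2 x)), p.2 * q.2).
Let pscale (k : R) (p : triple) : triple :=
  ((fun z => k * p.1.1 z), (fun x => k%:C *: p.1.2 x), k * p.2).

Let pc_add p q : pc p -> pc q -> pc (padd p q). Proof. exact: (pcalcD hT). Qed.
Let pc_mul p q : pc p -> pc q -> pc (pmul p q). Proof. exact: (pcalcM hT). Qed.
Let pc_scale k p : 0 <= k -> pc p -> pc (pscale k p). Proof. exact: (pcalcZ hT). Qed.

(* The total mass of the two measures is at most c; [op f] is f(A), and takes the
   junk value 0 when f is not such a difference. *)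
Definition hpc f c := exists p q : (R -> R) * (X -> X) * R,
  [/\ pc p, pc q, p.2 + q.2 <= c & forall z, 0 < z -> f z = p.1.1 z - q.1.1 z].

Definition op f x : X := xget 0 [set y | exists p q : (R -> R) * (X -> X) * R,
  [/\ pc p, pc q, forall z, 0 < z -> f z = p.1.1 z - q.1.1 z & y = p.1.2 x - q.1.2 x]].

Lemma pcalc_unique f F c g G (c' : R) x : pcalc T f F c -> pcalc T g G c' ->
  (forall z, 0 < z -> f z = g z) -> F x = G x.
Proof.
move=> [m [mc mf ->]] [m' [mc' mf' ->]] fg.
apply: (hp_pos_unique x hT (pcalc_lty mc) (pcalc_lty mc')) => z z0.
by rewrite -mf// -mf'// fg.
Qed.

(** Two decompositions p - q = p' - q' give p' + q = p + q', an identity between transforms of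
    positive measures, to which uniqueness applies. *)
Lemma opE f p q x : pc p -> pc q -> (forall z, 0 < z -> f z = p.1.1 z - q.1.1 z) ->
  op f x = p.1.2 x - q.1.2 x.
Proof.
move=> pp pq fE; rewrite /op.
have := @xgetPex X 0 [set y | exists p q : (R -> R) * (X -> X) * R,
  [/\ pc p, pc q, forall z, 0 < z -> f z = p.1.1 z - q.1.1 z & y = p.1.2 x - q.1.2 x]]
  (ex_intro _ _ (ex_intro _ p (ex_intro _ q (And4 pp pq fE erefl)))).
move=> [p' [q' [pp' pq' fE' ->]]].
have h : p'.1.2 x + q.1.2 x = p.1.2 x + q'.1.2 x.
  apply: (pcalc_unique x (pcalcD hT pp' pq) (pcalcD hT pp pq')) => z z0.
  by have := fE z z0; rewrite fE'//; lra.
by apply/eqP; rewrite subr_eq addrAC -h addrK.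
Qed.

Lemma op_ext f g x : (forall z, 0 < z -> f z = g z) -> op f x = op g x.
Proof.
move=> fg; rewrite /op; congr (xget 0 _); apply/seteqP; split => y [p [q [pp pq fE ->]]];
  by exists p, q; split => // z z0; rewrite -fE// fg.
Qed.

Lemma hpc_ext f g c : (forall z, 0 < z -> f z = g z) -> hpc f c -> hpc g c.
Proof.
by move=> fg [p [q [pp pq pqc fE]]]; exists p, q; split => // z z0; rewrite -fg// fE.
Qed.

Lemma hpcW f c c' : c <= c' -> hpc f c -> hpc f c'.
Proof.
by move=> cc' [p [q [pp pq pqc fE]]]; exists p, q; split => //; exact: le_trans cc'.
Qed.

Lemma hpc_ge0 f c : hpc f c -> 0 <= c.
Proof.
move=> [p [q [/pcalc_ge0 p0 /pcalc_ge0 q0 pqc _]]]; exact: le_trans (addr_ge0 p0 q0) pqc.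
Qed.

Lemma hpc_le f c z : hpc f c -> 0 < z -> `|f z| <= c.
Proof.
move=> [p [q [pp pq pqc fE]]] z0; rewrite fE//.
have /andP[p0 p1] := pcalc_le pp z0; have /andP[q0 q1] := pcalc_le pq z0.
by rewrite ler_norml; apply/andP; split; lra.
Qed.

Lemma op_norm f c x : hpc f c -> rnorm (op f x) <= M * c * rnorm x.
Proof.
move=> [p [q [pp pq pqc fE]]]; rewrite (opE x pp pq fE) (le_trans (rnormB _ _))//.
apply: (le_trans (lerD (pcalc_op_norm hT x pp) (pcalc_op_norm hT x pq))).
by rewrite -mulrDl -mulrDr ler_wpM2r ?rnorm_ge0// ler_wpM2l// (M0 hT).
Qed.

Lemma op_addv f c x y : hpc f c -> op f (x + y) = op f x + op f y.
Proof.
move=> [p [q [pp pq pqc fE]]]; rewrite !(opE _ pp pq fE).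
by rewrite (pcalc_opD hT x y pp) (pcalc_opD hT x y pq) opprD addrACA.
Qed.

Lemma op_scalev f c (a : R[i]) x : hpc f c -> op f (a *: x) = a *: op f x.
Proof.
move=> [p [q [pp pq pqc fE]]]; rewrite !(opE _ pp pq fE).
by rewrite (pcalc_opZ hT a x pp) (pcalc_opZ hT a x pq) scalerBr.
Qed.

Lemma op_oppv f c x : hpc f c -> op f (- x) = - op f x.
Proof. by move=> fc; rewrite -scaleN1r (op_scalev _ _ fc) scaleN1r. Qed.

Lemma op_subv f c x y : hpc f c -> op f (x - y) = op f x - op f y.
Proof. by move=> fc; rewrite (op_addv _ _ fc) (op_oppv _ fc). Qed.

Lemma op_cvg f c (I : Type) (Fl : set_system I) {FF : Filter Fl} (u : I -> X) l : hpc f c ->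
  u @ Fl --> l -> (fun i => op f (u i)) @ Fl --> op f l.
Proof.
move=> fc /cvg_rnorm0P ul; apply: (@cvg_rnorm_squeeze _ _ _ _ _ _ _ (fun i => M * c * rnorm (u i - l))).
  by apply: nearW => i; rewrite -(op_subv _ _ fc); exact: op_norm.
by rewrite -[X in _ --> X](mulr0 (M * c)); exact: cvgMl_tmp.
Qed.

Lemma pcalc_hpc f F c : pcalc T f F c -> hpc f c /\ op f =1 F.
Proof.
move=> fF; have F0 := pcalcZ hT (lexx 0) fF.
have fE z : 0 < z -> f z = (f, F, c).1.1 z - ((fun z => 0 * f z), (fun x => 0%:C *: F x), 0 * c).1.1 z.
  by move=> _ /=; rewrite mul0r subr0.
split; first by exists (f, F, c), ((fun z => 0 * f z), (fun x => 0%:C *: F x), 0 * c); split => //=; rewrite mul0r addr0.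
by move=> x; rewrite (@opE f (f, F, c) ((fun z => 0 * f z), (fun x => 0%:C *: F x), 0 * c))//= scale0r subr0.
Qed.

Lemma hpcD f g c c' : hpc f c -> hpc g c' -> hpc (fun z => f z + g z) (c + c').
Proof.
move=> [p [q [pp pq pqc fE]]] [p' [q' [pp' pq' pqc' gE]]].
exists (padd p p'), (padd q q'); split => /=; [exact: pc_add|exact: pc_add|by rewrite addrACA lerD|].
by move=> z z0; rewrite fE// gE//; ring.
Qed.

Lemma opD f g c c' x : hpc f c -> hpc g c' -> op (fun z => f z + g z) x = op f x + op g x.
Proof.
move=> [p [q [pp pq pqc fE]]] [p' [q' [pp' pq' pqc' gE]]].
rewrite (opE x pp pq fE) (opE x pp' pq' gE) (opE x (pc_add pp pp') (pc_add pq pq')) /=.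
  by rewrite opprD addrACA.
by move=> z z0; rewrite fE// gE//; ring.
Qed.

Lemma hpcN f c : hpc f c -> hpc (fun z => - f z) c.
Proof.
move=> [p [q [pp pq pqc fE]]]; exists q, p; split => //; first by rewrite addrC.
by move=> z z0; rewrite fE// opprB.
Qed.

Lemma opN f c x : hpc f c -> op (fun z => - f z) x = - op f x.
Proof.
move=> [p [q [pp pq pqc fE]]]; rewrite (opE x pp pq fE) (opE x pq pp) ?opprB//.
by move=> z z0; rewrite fE// opprB.
Qed.

Lemma hpcB f g c c' : hpc f c -> hpc g c' -> hpc (fun z => f z - g z) (c + c').
Proof. by move=> fc /hpcN; exact: hpcD. Qed.

Lemma opB f g c c' x : hpc f c -> hpc g c' -> op (fun z => f z - g z) x = op f x - op g x.
Proof. by move=> fc gc; rewrite (opD _ fc (hpcN gc)) (opN _ gc). Qed.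

Lemma hpcM f g c c' : hpc f c -> hpc g c' -> hpc (fun z => f z * g z) (c * c').
Proof.
move=> [p [q [pp pq pqc fE]]] [p' [q' [pp' pq' pqc' gE]]].
have [p0 q0] := (pcalc_ge0 pp, pcalc_ge0 pq); have [p0' q0'] := (pcalc_ge0 pp', pcalc_ge0 pq').
exists (padd (pmul p p') (pmul q q')), (padd (pmul p q') (pmul q p')); split => /=.
- exact: (pc_add (pc_mul pp pp') (pc_mul pq pq')).
- exact: (pc_add (pc_mul pp pq') (pc_mul pq pp')).
- have -> : p.2 * p'.2 + q.2 * q'.2 + (p.2 * q'.2 + q.2 * p'.2) = (p.2 + q.2) * (p'.2 + q'.2) by ring.
  by apply: ler_pM => //; exact: addr_ge0.
- by move=> z z0; rewrite fE// gE//; ring.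
Qed.

Lemma opM f g c c' x : hpc f c -> hpc g c' -> op (fun z => f z * g z) x = op f (op g x).
Proof.
move=> [p [q [pp pq pqc fE]]] [p' [q' [pp' pq' pqc' gE]]].
rewrite (opE x (pc_add (pc_mul pp pp') (pc_mul pq pq')) (pc_add (pc_mul pp pq') (pc_mul pq pp'))) /=; last first.
  by move=> z z0; rewrite fE// gE//; ring.
rewrite (opE x pp' pq' gE) (opE _ pp pq fE).
rewrite (pcalc_opD hT _ _ pp) (pcalc_opD hT _ _ pq) -[- q'.1.2 x]scaleN1r.
rewrite (pcalc_opZ hT _ _ pp) (pcalc_opZ hT _ _ pq) !scaleN1r.
by rewrite opprD addrACA opprB.
Qed.

Lemma hpc1 : hpc (fun=> 1) 1 /\ op (fun=> 1) =1 id.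
Proof.
have [h1 h2] := pcalc_hpc (pcalc_translation hT (lexx 0)).
have e z : 0 < z -> expR (- (0 * z)) = 1 :> R by rewrite mul0r oppr0 expR0.
split; first exact: hpc_ext e h1.
by move=> x; rewrite -(op_ext x e) h2 (T0 hT).
Qed.

Lemma hpcZ f c (k : R) : hpc f c -> hpc (fun z => k * f z) (`|k| * c).
Proof.
have pos f' c' (l : R) : 0 <= l -> hpc f' c' -> hpc (fun z => l * f' z) (l * c').
  move=> l0 [p [q [pp pq pqc fE]]].
  exists (pscale l p), (pscale l q); split; [exact: pc_scale|exact: pc_scale| |].
    by rewrite /= -mulrDr ler_wpM2l.
  by move=> z z0 /=; rewrite fE// mulrBr.
move=> fc; have [k0|k0] := leP 0 k; first by rewrite ger0_norm//; exact: pos.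
rewrite ltr0_norm//; apply: hpc_ext (pos _ _ (- k) _ (hpcN fc)); last by rewrite oppr_ge0 ltW.
by move=> z _; rewrite mulrNN.
Qed.

Lemma hpc_cst (k : R) : hpc (fun=> k) `|k|.
Proof.
by have := hpcZ k hpc1.1; rewrite !mulr1.
Qed.

Lemma op_cst (k : R) x : op (fun=> k) x = k%:C *: x.
Proof.
have [k0|k0] := leP 0 k.
  have [_ e] := pcalc_hpc (pcalcZ hT k0 (pcalc_translation hT (lexx 0))).
  rewrite -[in RHS](T0 hT x) -e; apply: op_ext => z z0.
  by rewrite mul0r oppr0 expR0 mulr1.
have k0' : 0 <= - k by rewrite oppr_ge0 ltW.
have [h e] := pcalc_hpc (pcalcZ hT k0' (pcalc_translation hT (lexx 0))).
have -> : k%:C *: x = - op (fun z => - k * expR (- (0 * z))) x.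
  by rewrite e (T0 hT) rmorphN scaleNr opprK.
rewrite -(opN _ h); apply: op_ext => z z0.
by rewrite mul0r oppr0 expR0 mulr1 opprK.
Qed.

Lemma opZ f c (k : R) x : hpc f c -> op (fun z => k * f z) x = k%:C *: op f x.
Proof. by move=> fc; rewrite (opM x (hpc_cst k) fc) op_cst. Qed.

Lemma bounded_sum_cvg (c : nat -> R) (C : R) : (forall n, 0 <= c n) ->
  (forall N, \sum_(n < N) c n <= C) ->
  exists2 l, (fun N => \sum_(n < N) c n) @ \oo --> l & forall N, \sum_(n < N) c n <= l.
Proof.
move=> c0 cC.
have ns : {homo (fun N => \sum_(n < N) c n) : n m / (n <= m)%N >-> n <= m}.
  by apply/nondecreasing_seqP => n; rewrite big_ord_recr /= lerDl.
have ub : has_ubound (range (fun N => \sum_(n < N) c n)).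
  by exists C => _ [N _ <-].
exists (sup (range (fun N => \sum_(n < N) c n))); first exact: nondecreasing_cvgn.
by move=> N; apply: ub_le_sup => //; exists N.
Qed.

(** Summable masses let the positive and the negative parts be summed separately. The limit symbol f
    is prescribed, so the lemma also identifies the sum. *)
Lemma hpc_series (f_ : nat -> R -> R) f (c_ : nat -> R) C :
  (forall n, hpc (f_ n) (c_ n)) -> (forall N, \sum_(n < N) c_ n <= C) ->
  (forall z, 0 < z -> (fun N => \sum_(n < N) f_ n z) @ \oo --> f z) ->
  hpc f C /\ forall x, (fun N => \sum_(n < N) op (f_ n) x) @ \oo --> op f x.
Proof.
move=> /choice[p_ /choice[q_ h]] cC fcv.
have pp n : pc (p_ n) by have [] := h n.
have pq n : pc (q_ n) by have [] := h n.
have pqc n : (p_ n).2 + (q_ n).2 <= c_ n by have [] := h n.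
have fE n z : 0 < z -> f_ n z = (p_ n).1.1 z - (q_ n).1.1 z by have [_ _ _] := h n; apply.
have p0 n : 0 <= (p_ n).2 := pcalc_ge0 (pp n).
have q0 n : 0 <= (q_ n).2 := pcalc_ge0 (pq n).
have [l1 cl1 ul1] : exists2 l, (fun N => \sum_(n < N) (p_ n).2) @ \oo --> l & forall N, \sum_(n < N) (p_ n).2 <= l.
  apply: (bounded_sum_cvg (C := C) p0) => N; apply: le_trans (cC N).
  by apply: ler_sum => n _; apply: le_trans (pqc n); rewrite lerDl.
have [l2 cl2 ul2] : exists2 l, (fun N => \sum_(n < N) (q_ n).2) @ \oo --> l & forall N, \sum_(n < N) (q_ n).2 <= l.
  apply: (bounded_sum_cvg (C := C) q0) => N; apply: le_trans (cC N).
  by apply: ler_sum => n _; apply: le_trans (pqc n); rewrite lerDr.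
have [g1 [G1 [pg1 cg1 cG1]]] := pcalc_series hT pp ul1.
have [g2 [G2 [pg2 cg2 cG2]]] := pcalc_series hT pq ul2.
have l12 : l1 + l2 <= C.
  apply: (real_cvg_le (cvgD cl1 cl2)) => N.
  rewrite -[X in X <= _]/(_ + _) -big_split /=.
  by apply: le_trans (cC N); apply: ler_sum => n _.
have gE z : 0 < z -> f z = (g1, G1, l1).1.1 z - (g2, G2, l2).1.1 z.
  move=> z0 /=; apply: (@cvg_unique _ (@Rhausdorff R) _ _ _ _ (fcv z z0)).
  have e : (fun N => \sum_(n < N) f_ n z) =
      (fun N => \sum_(n < N) (p_ n).1.1 z - \sum_(n < N) (q_ n).1.1 z).
    by apply/funext => N; rewrite -sumrB; apply: eq_bigr => n _; exact: fE.
  by rewrite e; exact: cvgB (cg1 z z0) (cg2 z z0).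
split; first by exists (g1, G1, l1), (g2, G2, l2).
move=> x; rewrite (@opE f (g1, G1, l1) (g2, G2, l2))//=.
have e : (fun N => \sum_(n < N) op (f_ n) x) =
    (fun N => \sum_(n < N) (p_ n).1.2 x - \sum_(n < N) (q_ n).1.2 x).
  apply/funext => N; rewrite -sumrB; apply: eq_bigr => n _.
  exact: (opE x (pp n) (pq n) (fE n)).
by rewrite e; exact: cvgB (cG1 x) (cG2 x).
Qed.

Lemma hpcX f c n : hpc f c -> hpc (fun z => f z ^+ n) (c ^+ n).
Proof.
move=> fc; elim: n => [|n IH]; first by apply: hpc_ext hpc1.1 => z _; rewrite expr0.
have h := hpcM fc IH; rewrite -exprS in h.
by apply: hpc_ext h => z _; rewrite exprS.
Qed.

Lemma sum_geometric (x : R) N : x != 1 -> \sum_(n < N) x ^+ n = (1 - x ^+ N) / (1 - x).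
Proof.
move=> x1; have x1' : 1 - x != 0 by rewrite subr_eq0 eq_sym.
elim: N => [|N IH]; first by rewrite big_ord0 expr0 subrr mul0r.
by rewrite big_ord_recr /= IH exprS; field.
Qed.

Lemma cvg_geometric_sum (x : R) : `|x| < 1 ->
  (fun N => \sum_(n < N) x ^+ n) @ \oo --> (1 - x)^-1.
Proof.
move=> x1; have xn1 : x != 1 by apply/eqP => xE; rewrite xE normr1 ltxx in x1.
have -> : (fun N => \sum_(n < N) x ^+ n) = (fun N => (1 - x ^+ N) * (1 - x)^-1).
  by apply/funext => N; exact: sum_geometric.
have h : (fun N => (1 - x ^+ N) * (1 - x)^-1) @ \oo --> (1 - 0) * (1 - x)^-1.
  apply: cvgMr_tmp; have h := cvg_expr x1.
  have h1 : (fun _ : nat => 1 : R) @ \oo --> (1 : R) by exact: cvg_cst.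
  exact: cvgB h1 h.
by rewrite subr0 mul1r in h.
Qed.

Lemma hpc_neumann f a : a < 1 -> hpc f a -> hpc (fun z => (1 - f z)^-1) (1 - a)^-1.
Proof.
move=> a1 fa; have a0 := hpc_ge0 fa.
apply: (hpc_series (f_ := fun n z => f z ^+ n) (c_ := fun n => a ^+ n) _ _ _).1.
- by move=> n; exact: hpcX.
- move=> N; rewrite sum_geometric ?lt_eqF// ler_pdivrMr ?subr_gt0// mulVf ?subr_eq0 ?gt_eqF//.
  by rewrite gerBl exprn_ge0.
- by move=> z z0; apply: cvg_geometric_sum; exact: le_lt_trans (hpc_le fa z0) a1.
Qed.

Lemma dominated_cvg_Rintegral d (S : measurableType d) (m : {measure set S -> \bar R}) (E : set S)
    (u_ : nat -> S -> R) (u g : S -> R) : measurable E ->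
  (forall n, measurable_fun E (u_ n)) ->
  m.-integrable E (EFin \o g) ->
  (forall n s, E s -> `|u_ n s| <= g s) ->
  (forall s, E s -> u_ ^~ s @ \oo --> u s) ->
  (fun n => \int[m]_(s in E) u_ n s) @ \oo --> \int[m]_(s in E) u s.
Proof.
move=> mE mu_ ig ug uu.
have mu : measurable_fun E u by apply: (measurable_fun_cvg mu_) => s Es; exact: uu.
have cv : {ae m, forall x : S, E x -> (fun n => (u_ n x)%:E) @ \oo --> (EFin \o u) x}.
  by apply: aeW => w Ew; apply: cvg_EFin; [exact: nearW|exact: uu].
have dom : {ae m, forall (x : S) n, E x -> (`|(u_ n x)%:E| <= (EFin \o g) x)%E}.
  by apply: aeW => w n Ew /=; rewrite lee_fin ug.
have mu' n : measurable_fun E (fun s => (u_ n s)%:E) by apply/measurable_EFinP.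
have [iu _] := dominated_convergence mE mu' (iffRL (measurable_EFinP _ _) mu) cv ig dom.
have fu : (\int[m]_(x in E) (EFin \o u) x)%E \is a fin_num by exact: integrable_fin_num iu.
by rewrite -(fineK fu) => /fine_cvgP[_].
Qed.

(** Expanding 1 / (1 - theta psi) in powers of psi separates s from z: the symbol is the power
    series in psi with coefficients the integrals of phi theta^n. These are nonnegative, so the mass
    is at most the value of the same series at c0. An integral of a family of symbols is thus
    obtained without integrating operators. *)
Lemma hpc_geometric_integral d (S : measurableType d) (m : {measure set S -> \bar R}) (K : set S)
    (phi theta : S -> R) (psi : R -> R) (c0 I : R) :
  measurable K -> measurable_fun K phi -> measurable_fun K theta ->
  (forall s, K s -> 0 <= phi s) -> (forall s, K s -> 0 <= theta s <= 1) ->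
  hpc psi c0 -> (forall s, K s -> theta s * c0 < 1) ->
  m.-integrable K (EFin \o (fun s => phi s / (1 - theta s * c0))) ->
  \int[m]_(s in K) (phi s / (1 - theta s * c0)) <= I ->
  hpc (fun z => \int[m]_(s in K) (phi s / (1 - theta s * psi z))) I.
Proof.
move=> mK mphi mth phi0 th01 hpsi thc ig iI; have c00 := hpc_ge0 hpsi.
have mterm n (x : R) : measurable_fun K (fun s => phi s * (theta s * x) ^+ n).
  apply: measurable_funM => //; apply: measurable_funX; exact: measurable_funM.
have pos s : K s -> 0 < 1 - theta s * c0 by move=> Ks; rewrite subr_gt0 thc.
have th0 s : K s -> 0 <= theta s by move=> /th01/andP[].
have bnd (x : R) n s : K s -> `|x| <= c0 ->
    `|phi s * (theta s * x) ^+ n| <= phi s * (theta s * c0) ^+ n.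
  move=> Ks xc; rewrite normrM ger0_norm ?phi0// ler_wpM2l ?phi0// normrX normrM.
  rewrite [`|theta s|]ger0_norm ?th0//.
  by apply: lerXn2r; rewrite ?nnegrE ?mulr_ge0 ?th0// ler_wpM2l ?th0.
have sumle s N : K s -> \sum_(n < N) phi s * (theta s * c0) ^+ n <= phi s / (1 - theta s * c0).
  move=> Ks; rewrite -mulr_sumr ler_wpM2l ?phi0// sum_geometric ?lt_eqF ?thc//.
  rewrite ler_pdivrMr ?pos// mulVf ?gt_eqF ?pos// gerBl exprn_ge0// mulr_ge0// th0//.
have mdom : measurable_fun K (fun s => phi s / (1 - theta s * c0)).
  by case/integrableP : ig => /measurable_EFinP.
have iterm n (x : R) : `|x| <= c0 -> m.-integrable K (EFin \o (fun s => phi s * (theta s * x) ^+ n)).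
  move=> xc; apply: (le_integrable mK _ _ ig); first exact/measurable_EFinP.
  move=> s Ks /=; rewrite lee_fin [leRHS]ger0_norm; last by rewrite divr_ge0 ?phi0// ltW// pos.
  apply: (le_trans (bnd x n s Ks xc)); apply: le_trans (sumle s n.+1 Ks).
  rewrite big_ord_recr /= lerDr sumr_ge0// => i _.
  by rewrite mulr_ge0 ?phi0// exprn_ge0// mulr_ge0// th0.
have iphi n : m.-integrable K (EFin \o (fun s => phi s * theta s ^+ n)).
  apply: (le_integrable mK _ _ ig).
    by apply/measurable_EFinP; apply: measurable_funM => //; exact: measurable_funX.
  move=> s Ks /=; rewrite lee_fin normrM [`|phi s|]ger0_norm ?phi0// normrM [`|phi s|]ger0_norm ?phi0//.
  rewrite ler_wpM2l ?phi0// normrX [`|theta s|]ger0_norm ?th0// [leRHS]ger0_norm; last first.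
    by rewrite invr_ge0 ltW// pos.
  apply: (@le_trans _ _ 1); first by apply: exprn_ile1; [exact: th0|case/andP: (th01 s Ks)].
  by rewrite -[leLHS]invr1 lef_pV2 ?posrE ?pos// gerBl mulr_ge0// th0.
pose a n := \int[m]_(s in K) (phi s * theta s ^+ n).
have aE n (x : R) : \int[m]_(s in K) (phi s * (theta s * x) ^+ n) = a n * x ^+ n.
  rewrite /a -RintegralZr//; apply: eq_Rintegral => s _.
  by rewrite exprMn mulrA.
have a0 n : 0 <= a n.
  by apply: Rintegral_ge0 => s Ks; rewrite mulr_ge0 ?phi0// exprn_ge0// th0.
apply: (hpc_series (f_ := fun n z => a n * psi z ^+ n) (c_ := fun n => a n * c0 ^+ n) _ _ _).1.
- by move=> n; rewrite -[X in X * _](ger0_norm (a0 n)); apply: hpcZ; exact: hpcX.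
- move=> N; apply: le_trans iI.
  have c0n : `|c0| <= c0 by rewrite ger0_norm.
  under eq_bigr do rewrite -aE.
  rewrite -(Rintegral_sum mK (u := fun n s => phi s * (theta s * c0) ^+ n)); last first.
    by move=> i; exact: iterm.
  apply: le_Rintegral => //; last by move=> s Ks; exact: sumle.
  apply: (le_integrable mK _ _ ig).
    apply/measurable_EFinP; apply: measurable_sum => n; exact: mterm.
  move=> s Ks /=; rewrite lee_fin [leRHS]ger0_norm; last by rewrite divr_ge0 ?phi0// ltW// pos.
  rewrite ger0_norm ?sumle//; apply: sumr_ge0 => n _.
  by rewrite mulr_ge0 ?phi0// exprn_ge0// mulr_ge0// th0.
- move=> z z0; have pz := hpc_le hpsi z0.
  have sm (n : nat) s : K s -> `|\sum_(i < n) phi s * (theta s * psi z) ^+ i| <= phi s / (1 - theta s * c0).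
    move=> Ks; apply: (le_trans (ler_norm_sum _ _ _)); apply: le_trans (sumle s n Ks).
    by apply: ler_sum => i _; exact: bnd.
  have <- : (fun N => \int[m]_(s in K) \sum_(n < N) phi s * (theta s * psi z) ^+ n) =
      (fun N => \sum_(n < N) a n * psi z ^+ n).
    apply/funext => N; rewrite (Rintegral_sum mK (u := fun n s => phi s * (theta s * psi z) ^+ n)).
      by apply: eq_bigr => n _; exact: aE.
    by move=> i; exact: iterm.
  have lt1 s : K s -> `|theta s * psi z| < 1.
    move=> Ks; apply: le_lt_trans (thc s Ks); rewrite normrM ger0_norm ?th0//.
    by rewrite ler_wpM2l ?th0.
  have mS n : measurable_fun K (fun s => \sum_(i < n) phi s * (theta s * psi z) ^+ i).
    by apply: measurable_sum => i; exact: mterm.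
  apply: (dominated_cvg_Rintegral mK mS ig sm) => s Ks.
  have h := cvg_geometric_sum (lt1 s Ks).
  have -> : (fun n => \sum_(i < n) phi s * (theta s * psi z) ^+ i) =
      (fun n => phi s * \sum_(i < n) (theta s * psi z) ^+ i).
    by apply/funext => n; rewrite mulr_sumr.
  exact: cvgMl_tmp h.
Qed.
End SignedCalculus.

(** * Resolvents, and their estimate by integrated orbits *)

Section Resolvent.
Context (R : realType) (X : completeNormedModType R[i]) (T : R -> X -> X) (M : R)
  (hT : bounded_C0 T M).
Implicit Types (f g : R -> R) (F : X -> X) (c z : R) (x : X).

Lemma pcalc_ext f g F c : (forall z, 0 < z -> f z = g z) -> pcalc T f F c -> pcalc T g F c.
Proof.
by move=> fg [m [mc mf mF]]; exists m; split => // z z0; rewrite -fg// mf.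
Qed.

Lemma pcalc_geometric (d h : R) : 0 <= d -> d < 1 -> 0 <= h ->
  exists F, pcalc T (fun z => (1 - d * expR (- (h * z)))^-1) F (1 - d)^-1.
Proof.
move=> d0 d1 h0.
have ht n : 0 <= n%:R * h by rewrite mulr_ge0.
have pt n := pcalcZ hT (exprn_ge0 n d0) (pcalc_translation hT (ht n)).
have bd N : \sum_(n < N) d ^+ n * 1 <= (1 - d)^-1.
  under eq_bigr do rewrite mulr1.
  rewrite sum_geometric ?lt_eqF// ler_pdivrMr ?subr_gt0// mulVf ?subr_eq0 ?gt_eqF//.
  by rewrite gerBl exprn_ge0.
have [f [F [pf cf _]]] := pcalc_series hT pt bd.
exists F; apply: pcalc_ext pf => z z0.
apply: (@cvg_unique _ (@Rhausdorff R) _ _ _ _ (cf z z0)).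
have dz : `|d * expR (- (h * z))| < 1.
  rewrite ger0_norm ?mulr_ge0 ?expR_ge0//; apply: le_lt_trans d1.
  by rewrite ler_piMr// -expR0 ler_expR oppr_le0 mulr_ge0// ltW.
have := cvg_geometric_sum dz.
suff -> : (fun n => \sum_(i < n) (d * expR (- (h * z))) ^+ i) =
    (fun N => \sum_(n < N) d ^+ n * expR (- (n%:R * h * z))) by [].
apply/funext => N; apply: eq_bigr => n _; rewrite exprMn; congr (_ * _).
by rewrite -expRM_natl mulrN mulrA.
Qed.

Let meas_exp (p : R) : measurable_fun setT (fun s : R => expR (- (p * s))).
Proof.
apply: eq_measurable_fun (measurable_expMz p) => s _; by rewrite mulrC.
Qed.

(** The density e^(-ps) on the half-line is rebuilt from its part on [0, 1]: translated by n and
    multiplied by e^(-pn), that part becomes the one on [n, n+1]. On symbols this is a geometric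
    series. *)
Lemma pcalc_resolvent (p : R) : 0 < p -> exists F, pcalc T (fun z => (z + p)^-1) F p^-1.
Proof.
move=> p0.
have [F1 pF1] : exists F, pcalc T (fun z => (1 - expR (- (1 * (z + p)))) / (z + p)) F ((1 - expR (- (1 * p))) / p).
  apply: (@pcalc_dens_itv _ _ _ (fun s => expR (- (p * s))) 1).
  - by move=> s; rewrite mulr_ge0// expR_ge0.
  - exact: meas_exp.
  - rewrite -integral_expMz// le_eqVlt; apply/orP; left; apply/eqP.
    by apply: eq_integral => s _; rewrite mulrC.
  - move=> z z0; rewrite -integral_expMz ?addr_gt0//.
    by apply: eq_integral => s _; rewrite -expRD mulrDr opprD [p * s]mulrC.
have d1 : expR (- p) < 1 :> R by rewrite -expR0 ltr_expR oppr_lt0.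
have [F2 pF2] := pcalc_geometric (expR_ge0 (- p)) d1 ler01.
have e : (1 - expR (- p))^-1 * ((1 - expR (- (1 * p))) / p) = p^-1.
  by rewrite mul1r mulrA mulVf ?mul1r// subr_eq0 gt_eqF.
have := pcalcM hT pF2 pF1; rewrite e => h.
exists (fun x => F2 (F1 x)); apply: pcalc_ext h => z z0.
rewrite !mul1r -expRD -opprD [p + z]addrC mulrA mulVf ?mul1r//.
by rewrite subr_eq0 gt_eqF// -expR0 ltr_expR oppr_lt0 addr_gt0.
Qed.

Lemma hpc_resolvent (p : R) : 0 < p -> hpc T (fun z => (z + p)^-1) p^-1.
Proof. by move=> p0; have [F /(pcalc_hpc hT)[]] := pcalc_resolvent p0. Qed.

(** The symbol is the transform of the density 1 - e^(-ps) on [0, h], which is at most p h there. It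
    measures what is lost on the first cell when e^(-ps) is replaced by its value at the left
    end. *)
Lemma hpc_resolvent_defect (p h : R) : 0 < p -> 0 < h ->
  hpc T (fun z => (1 - expR (- (h * z))) / z -
    (1 - expR (- (p * h)) * expR (- (h * z))) / (z + p)) (p * h ^+ 2).
Proof.
move=> p0 h0; have h0' := ltW h0.
have ft : (@lebesgue_measure R `[0%R, h] < +oo)%E by rewrite lebesgue_itv0// ltry.
have mh : measurable (`[0%R, h]%classic : set (measurableTypeR R)) by [].
suff [F pF] : exists F, pcalc T (fun z => (1 - expR (- (h * z))) / z -
    (1 - expR (- (p * h)) * expR (- (h * z))) / (z + p)) F (p * h ^+ 2).
  exact: (pcalc_hpc hT pF).1.
apply: (@pcalc_dens_itv _ _ _ (fun s => 1 - expR (- (p * s))) h).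
- move=> s; rewrite indicE; case: (boolP (s \in _)) => [/set_mem /=|_]; rewrite ?mulr0//.
  rewrite in_itv /= => /andP[s0 _]; rewrite mulr1 subr_ge0.
  by rewrite -expR0 ler_expR oppr_le0 mulr_ge0// ltW.
- apply: measurable_funB => //; exact: meas_exp.
- apply: (@le_trans _ _ (\int[@lebesgue_measure R]_(s in `[0%R, h]) (p * h)%:E)%E).
    apply: ge0_le_integral => //.
    + move=> s /=; rewrite in_itv /= => /andP[s0 _]; rewrite lee_fin subr_ge0.
      by rewrite -expR0 ler_expR oppr_le0 mulr_ge0// ltW.
    + apply/measurable_EFinP; apply: measurable_funTS; apply: measurable_funB => //; exact: meas_exp.
    + move=> s /=; rewrite in_itv /= => /andP[s0 sh]; rewrite lee_fin.
      apply: (@le_trans _ _ (p * s)); last by rewrite ler_pM2l.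
      by have := expR_ge1Dx (- (p * s)); lra.
  rewrite integral_cst//; have := lebesgue_itv0 h0' => /= ->.
  by rewrite -EFinM expr2 mulrA.
- move=> z z0; have zp0 : 0 < z + p by rewrite addr_gt0.
  have ei (a : R) : 0 < a -> lebesgue_measure.-integrable `[0, h] (EFin \o (fun s => expR (- (s * a)))).
    move=> a0; apply: (bounded_integrable mh ft (C := 1)).
      by apply: measurable_funTS; exact: measurable_expMz.
    move=> s /=; rewrite in_itv /= => /andP[s0 _]; rewrite ger0_norm ?expR_ge0//.
    by rewrite -expR0 ler_expR oppr_le0 mulr_ge0// ltW.
  transitivity (\int[@lebesgue_measure R]_(s in `[0%R, h]) ((expR (- (s * z)))%:E - (expR (- (s * (z + p))))%:E))%E.
    rewrite integralB_EFin//; [|exact: ei|exact: ei].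
    rewrite !integral_expMz// -EFinB; congr (_ - (1 - _) / _)%:E.
    by rewrite -expRD -opprD; congr (expR (- _)); ring.
  apply: eq_integral => s _; rewrite -EFinB; congr _%:E.
  by rewrite mulrBr mulr1 -expRD; congr (_ - expR _); ring.
Qed.

(* (z+p)^-1 = \int p e^(-ps) (1-e^(-sz))/z ds, discretized with step h. *)
Lemma resolvent_bound (p a b : R) (x : X) : 0 < p -> 0 <= a ->
  (forall t, 0 < t -> rnorm (integrated T t x) <= a * t + b) ->
  rnorm (op T (fun z => (z + p)^-1) x) <= a / p + b.
Proof.
move=> p0 a0 hx; have M0 := M0 hT; have nx := rnorm_ge0 x.
suff key h : 0 < h -> h <= 1 -> rnorm (op T (fun z => (z + p)^-1) x) <=
    a / p + b + h * (a + M * (1 + p) * rnorm x).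
  apply/ler_addgt0Pr => e e0; set K := a + M * (1 + p) * rnorm x in key.
  have K0 : 0 <= K by rewrite addr_ge0// !mulr_ge0// addr_ge0// ltW.
  pose h := Num.min 1 (e / (K + 1)).
  have h0 : 0 < h by rewrite lt_min ltr01 divr_gt0// ltr_wpDl.
  apply: (le_trans (key h h0 _)); first by rewrite ge_min lexx.
  rewrite lerD2l; apply: (@le_trans _ _ (h * (K + 1))); first by rewrite ler_wpM2l ?(ltW h0)// lerDl.
  by rewrite -ler_pdivlMr ?ltr_wpDl// ge_min lexx orbT.
move=> h0 h1; have h0' := ltW h0.
pose d : R := expR (- (p * h)).
have d0 : 0 <= d := expR_ge0 _.
have d1 : d < 1 by rewrite -expR0 ltr_expR oppr_lt0 mulr_gt0.
have d1' : 0 < 1 - d by rewrite subr_gt0.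
(* This is d (1 + p h) <= 1, that is 1 + p h <= e^(p h). *)
have dinv : (1 - d)^-1 <= (1 + p * h) / (p * h).
  have ph0 : 0 < p * h by rewrite mulr_gt0.
  have E : d * (1 + p * h) <= 1.
    have := expR_ge1Dx (p * h); rewrite -(ler_pM2l (expR_gt0 (- (p * h)))).
    by rewrite -expRD addNr expR0.
  rewrite -[leLHS]mul1r ler_pdivrMr// mulrAC ler_pdivlMr//; nra.
(* The step function equal to d^k on [k h, (k+1) h) is the sum of the multiples d^n (1 - d) of the
   indicators of [0, (n+1) h], an Abel summation. Each indicator acts as [integrated], to which the
   hypothesis applies. *)
pose fn (n : nat) (z : R) := (d ^+ n * (1 - d)) * ((1 - expR (- (n.+1%:R * h * z))) / z).
pose cn (n : nat) := (d ^+ n * (1 - d)) * (n.+1%:R * h).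
have nh n : 0 < n.+1%:R * h :> R by rewrite mulr_gt0.
have dn0 n : 0 <= d ^+ n * (1 - d) by rewrite mulr_ge0 ?exprn_ge0// ltW.
have pfn n := pcalc_hpc hT (pcalcZ hT (dn0 n) (pcalc_integrated hT (nh n))).
have hfn n : hpc T (fn n) (cn n) := (pfn n).1.
have cnE N : \sum_(n < N) cn n = h * (\sum_(n < N) d ^+ n - N%:R * d ^+ N).
  elim: N => [|N IH]; first by rewrite !big_ord0 mul0r subr0 mulr0.
  by rewrite !big_ord_recr /= IH /cn exprS -natr1; ring.
have sd N : \sum_(n < N) d ^+ n <= (1 - d)^-1.
  rewrite sum_geometric ?lt_eqF// ler_pdivrMr// mulVf ?gt_eqF//.
  by rewrite gerBl exprn_ge0.
have cnh N : \sum_(n < N) cn n <= h * (1 - d)^-1.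
  rewrite cnE ler_wpM2l// (le_trans _ (sd N))// gerBl mulr_ge0// exprn_ge0//.
pose fh z := (1 - expR (- (h * z))) / z / (1 - d * expR (- (h * z))).
have cfh z : 0 < z -> (fun N => \sum_(n < N) fn n z) @ \oo --> fh z.
  move=> z0; pose w : R := expR (- (h * z)).
  have w0 : 0 <= w := expR_ge0 _.
  have w1 : w <= 1 by rewrite -expR0 ler_expR oppr_le0 mulr_ge0// ltW.
  have dw1 : d * w < 1 by apply: le_lt_trans d1; rewrite ler_piMr.
  have h1' : `|d| < 1 by rewrite ger0_norm.
  have h2' : `|d * w| < 1 by rewrite ger0_norm// mulr_ge0.
  have e : (fun N => \sum_(n < N) fn n z) =
      (fun N => ((1 - d) / z) * (\sum_(n < N) d ^+ n - w * \sum_(n < N) (d * w) ^+ n)).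
    apply/funext => N; rewrite mulr_sumr -sumrB mulr_sumr; apply: eq_bigr => n _.
    rewrite /fn exprMn; have -> : expR (- (n.+1%:R * h * z)) = w * w ^+ n :> R.
      by rewrite -exprS -expRM_natl; congr expR; ring.
    by field; rewrite gt_eqF.
  rewrite e; have -> : fh z = ((1 - d) / z) * ((1 - d)^-1 - w * (1 - d * w)^-1).
    by rewrite /fh -/w; field; rewrite !gt_eqF// subr_gt0.
  have g1 := cvg_geometric_sum h1'; have g2 := cvg_geometric_sum h2'.
  have g3 : (fun N => w * \sum_(n < N) (d * w) ^+ n) @ \oo --> w * (1 - d * w)^-1 by exact: cvgMl_tmp g2.
  have g4 : (fun N => \sum_(n < N) d ^+ n - w * \sum_(n < N) (d * w) ^+ n) @ \oo -->
      (1 - d)^-1 - w * (1 - d * w)^-1 by exact: cvgB g1 g3.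
  exact: cvgMl_tmp g4.
have [hfh ofh] := hpc_series hT hfn cnh cfh.
have b1 : rnorm (op T fh x) <= a * (1 + p * h) / p + b.
  apply: rnorm_cvg_le (ofh x) _ => N.
  apply: le_trans; first exact: rnorm_sum.
  apply: (@le_trans _ _ (\sum_(n < N) (d ^+ n * (1 - d)) * (a * (n.+1%:R * h) + b))).
    apply: ler_sum => n _; rewrite (pfn n).2 rnormZ ger0_norm//.
    by rewrite ler_wpM2l// hx.
  have -> : \sum_(n < N) (d ^+ n * (1 - d)) * (a * (n.+1%:R * h) + b) =
      a * \sum_(n < N) cn n + b * (1 - d) * \sum_(n < N) d ^+ n.
    by rewrite !mulr_sumr -big_split /=; apply: eq_bigr => n _; rewrite /cn; ring.
  apply: lerD.
    rewrite -mulrA ler_wpM2l//; apply: (le_trans (cnh N)).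
    apply: (@le_trans _ _ (h * ((1 + p * h) / (p * h)))); first by rewrite ler_wpM2l.
    by rewrite le_eqVlt; apply/orP; left; apply/eqP; field; rewrite !gt_eqF.
  (* The hypothesis at t -> 0+ forces b >= 0. *)
  have b0 : 0 <= b.
    apply/ler_addgt0Pr => e e0; have t0 : 0 < e / (a + 1) by rewrite divr_gt0// ltr_wpDl.
    apply: (le_trans (rnorm_ge0 _)); apply: (le_trans (hx _ t0)).
    rewrite addrC lerD2l mulrCA ler_piMr ?(ltW e0)// ler_pdivrMr ?ltr_wpDl// mul1r lerDl//.
  rewrite -mulrA ler_piMr//; rewrite -ler_pdivlMl// mulr1; exact: sd.
have [F2 pF2] := pcalc_geometric d0 d1 h0'.
have hv := (pcalc_hpc hT pF2).1.
have hb := hpc_resolvent_defect p0 h0.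
have hvb := hpcM hT hv hb.
(* The discretization error repeats on every cell the defect of the first one, with the factor d^k
   e^(-k h z), hence the geometric series in front of the defect. *)
have e : op T (fun z => (z + p)^-1) x = op T fh x - op T (fun z => (1 - d * expR (- (h * z)))^-1 * ((1 - expR (- (h * z))) / z -
    (1 - d * expR (- (h * z))) / (z + p))) x.
  rewrite -(opB hT x hfh hvb); apply: op_ext => z z0; rewrite /fh.
  have w1 : d * expR (- (h * z)) < 1.
    apply: le_lt_trans d1; rewrite ler_piMr// -expR0 ler_expR oppr_le0 mulr_ge0// ltW//.
  rewrite -/d; move: (expR (- (h * z))) w1 => w w1; move: (d) w1 => d' w1.
  have w2 : 0 < 1 - d' * w by rewrite subr_gt0.
  by field; rewrite !gt_eqF// addr_gt0.
rewrite e (le_trans (rnormB _ _))//.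
apply: (le_trans (lerD b1 (op_norm hT x hvb))).
have : M * ((1 - d)^-1 * (p * h ^+ 2)) * rnorm x <= M * (h * (1 + p)) * rnorm x.
  rewrite ler_wpM2r// ler_wpM2l//.
  apply: (@le_trans _ _ ((1 + p * h) / (p * h) * (p * h ^+ 2))).
    by rewrite ler_wpM2r// mulr_ge0 ?exprn_ge0// ltW.
  have -> : (1 + p * h) / (p * h) * (p * h ^+ 2) = h * (1 + p * h).
    by field; rewrite !gt_eqF.
  by rewrite ler_wpM2l// lerD2l ler_piMr// ltW.
have -> : a * (1 + p * h) / p = a / p + a * h by field; rewrite gt_eqF.
lra.
Qed.

End Resolvent.

(** * Holomorphic extensions and the regularizer *)

Section ComplexLaplace.
Context (R : realType).
Implicit Types (a b x y s t : R) (z h w : R[i]).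
Local Notation D := (`[0%R, +oo[%classic : set R).

Lemma mvt0 (f df : R -> R) b : (forall x, is_derive x 1 f (df x)) ->
  exists2 c, `|c| <= `|b| & f b - f 0 = df c * b.
Proof.
move=> fd.
have cf u v : {within `[u, v], continuous f}.
  apply: derivable_within_continuous => x _; exact: (@ex_derive _ _ _ _ _ _ _ (fd x)).
have [b0|b0] := leP 0 b.
  have [c] := MVT_segment b0 (fun x _ => fd x) (cf 0 b).
  rewrite in_itv /= => /andP[c0 cb] ->; exists c; last by rewrite subr0.
  by rewrite !ger0_norm.
have [c] := MVT_segment (ltW b0) (fun x _ => fd x) (cf b 0).
rewrite in_itv /= => /andP[cb c0] e; exists c; last by rewrite -opprB e; ring.
by rewrite !ler0_norm ?lerN2// ltW.
Qed.

Lemma sin_le b : `|sin b| <= `|b|.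
Proof.
have [c _ e] := mvt0 b (@is_derive_sin R); move: e; rewrite sin0 subr0 => ->.
by rewrite normrM ler_piMl// cos_max.
Qed.

Lemma cos_sub1_le b : `|cos b - 1| <= `|b|.
Proof.
have [c _ e] := mvt0 b (@is_derive_cos R); move: e; rewrite cos0 => ->.
by rewrite normrM ler_piMl// normrN sin_max.
Qed.

Lemma cos_sub1_le2 b : `|cos b - 1| <= `|b| ^+ 2.
Proof.
have [c cb e] := mvt0 b (@is_derive_cos R); move: e; rewrite cos0 => ->.
by rewrite normrM expr2 ler_wpM2r// normrN (le_trans (sin_le _)).
Qed.

Lemma sin_subid_le2 b : `|sin b - b| <= `|b| ^+ 2.
Proof.
have [c cb e] := mvt0 b (@is_derive_sin R); move: e; rewrite sin0 subr0 => ->.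
have -> : cos c * b - b = (cos c - 1) * b by ring.
by rewrite normrM expr2 ler_wpM2r// (le_trans (cos_sub1_le _)).
Qed.

Lemma expR_sub1_le a : `|expR a - 1| <= `|a| * expR `|a|.
Proof.
have [a0|a0] := leP 0 a.
  rewrite (ger0_norm a0) ger0_norm ?subr_ge0 ?pexpR_ge1//; last by rewrite -expR0 ler_expR.
  have := expR_ge1Dx (- a); rewrite -(ler_pM2l (expR_gt0 a)) -expRD addrN expR0; lra.
rewrite (ltr0_norm a0) ler0_norm ?subr_le0 ?expR_le1 ?(ltW a0)//.
have h1 : 1 <= expR (- a) by rewrite -expR0 ler_expR oppr_ge0 ltW.
have := expR_ge1Dx a; nra.
Qed.

Lemma expR_sub1_subid_le a : `|expR a - 1 - a| <= `|a| ^+ 2 * expR `|a|.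
Proof.
have h1 := expR_ge1Dx a; rewrite ger0_norm; last by lra.
have h2 : expR a - 1 - a <= a * (expR a - 1).
  by have := expR_ge1Dx (- a); rewrite -(ler_pM2l (expR_gt0 a)) -expRD addrN expR0; lra.
apply: (le_trans h2); apply: (le_trans (ler_norm _)).
by rewrite normrM expr2 -mulrA ler_wpM2l// expR_sub1_le.
Qed.

Lemma expR_cos_taylor a b : `|expR a * cos b - 1 - a| <= (`|a| + `|b|) ^+ 2 * expR `|a|.
Proof.
have -> : expR a * cos b - 1 - a = (expR a - 1 - a) + expR a * (cos b - 1) by ring.
apply: (le_trans (ler_normD _ _)); rewrite normrM [`|expR a|]ger0_norm ?expR_ge0//.
have ea : expR a <= expR `|a| by rewrite ler_expR ler_norm.
have h : expR a * `|cos b - 1| <= expR `|a| * `|b| ^+ 2.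
  by apply: ler_pM; rewrite ?expR_ge0// cos_sub1_le2.
apply: (le_trans (lerD (expR_sub1_subid_le a) h)).
rewrite [expR _ * _]mulrC -mulrDl ler_wpM2r ?expR_ge0//.
have := normr_ge0 a; have := normr_ge0 b; nra.
Qed.

Lemma expR_sin_taylor a b : `|expR a * sin b - b| <= (`|a| + `|b|) ^+ 2 * expR `|a|.
Proof.
have -> : expR a * sin b - b = (expR a - 1) * b + expR a * (sin b - b) by ring.
apply: (le_trans (ler_normD _ _)); rewrite !normrM [`|expR a|]ger0_norm ?expR_ge0//.
have ea : expR a <= expR `|a| by rewrite ler_expR ler_norm.
have h : expR a * `|sin b - b| <= expR `|a| * `|b| ^+ 2.
  by apply: ler_pM; rewrite ?expR_ge0// sin_subid_le2.
have h' : `|expR a - 1| * `|b| <= `|a| * expR `|a| * `|b|.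
  by rewrite ler_wpM2r// expR_sub1_le.
apply: (le_trans (lerD h' h)).
rewrite [expR _ * _]mulrC mulrAC -mulrDl ler_wpM2r ?expR_ge0//.
have := normr_ge0 a; have := normr_ge0 b; nra.
Qed.

Definition rec x y s : R := expR (- (s * x)) * cos (s * y).
Definition imc x y s : R := - (expR (- (s * x)) * sin (s * y)).

Lemma Re_cexp x y s : complex.Re (cexp (- s%:C * (x +i* y))) = rec x y s.
Proof.
rewrite /cexp /rec /=; simpc => /=.
by rewrite cosN.
Qed.

Lemma Im_cexp x y s : complex.Im (cexp (- s%:C * (x +i* y))) = imc x y s.
Proof.
rewrite /cexp /imc /=; simpc => /=.
by rewrite sinN mulrN.
Qed.

Lemma laplace_posE (m : {measure set (measurableTypeR R) -> \bar R}) x y :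
  laplace_pos m (x +i* y) = (\int[m]_(s in D) rec x y s) +i* (\int[m]_(s in D) imc x y s).
Proof.
rewrite /laplace_pos; congr (_ +i* _).
  by apply: eq_Rintegral => s _; rewrite -Re_cexp.
by apply: eq_Rintegral => s _; rewrite -Im_cexp.
Qed.

Lemma rec_bound x y s : `|rec x y s| <= expR (- (s * x)).
Proof. by rewrite normrM ger0_norm ?expR_ge0// ler_piMr ?expR_ge0// cos_max. Qed.

Lemma imc_bound x y s : `|imc x y s| <= expR (- (s * x)).
Proof. by rewrite normrN normrM ger0_norm ?expR_ge0// ler_piMr ?expR_ge0// sin_max. Qed.

Lemma expR_decay x s : 0 < x -> 0 <= s -> s ^+ 2 * expR (- (s * x)) <= 2 / x ^+ 2.
Proof.
move=> x0 s0; have sx : 0 <= s * x by rewrite mulr_ge0// ltW.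
have := @expR_ge1Dxn R (s * x) 1 sx; rewrite (_ : 2`! = 2)%N// => h.
rewrite ler_pdivlMr ?exprn_gt0// mulrAC -exprMn expRN ler_pdivrMr ?expR_gt0//.
by lra.
Qed.

(** For |a| <= x/2 half of the decay of e^(-sx) survives and absorbs the factor s^2 of the Taylor
    remainder: s^2 e^(-sx/2) <= 8/x^2. The 16 comes from the cosine and sine remainders together. *)
Lemma rec_imc_taylor x y a b s : 0 < x -> 0 <= s -> `|a| <= x / 2 ->
  `|rec (x + a) (y + b) s - rec x y s - (a * - (s * rec x y s) - b * - (s * imc x y s))| <=
     16 / x ^+ 2 * (`|a| + `|b|) ^+ 2 /\
  `|imc (x + a) (y + b) s - imc x y s - (a * - (s * imc x y s) + b * - (s * rec x y s))| <=
     16 / x ^+ 2 * (`|a| + `|b|) ^+ 2.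
Proof.
move=> x0 s0 ax.
set E := expR (- (s * x)); set A := expR (- (s * a)).
have EA : expR (- (s * (x + a))) = E * A by rewrite -expRD -opprD -mulrDr.
have P := expR_cos_taylor (- (s * a)) (s * b); have Q := expR_sin_taylor (- (s * a)) (s * b).
rewrite -/A in P Q.
have bnd : E * ((`|- (s * a)| + `|s * b|) ^+ 2 * expR `|- (s * a)|) <= 8 / x ^+ 2 * (`|a| + `|b|) ^+ 2.
  rewrite normrN !normrM (ger0_norm s0) -mulrDr exprMn.
  apply: (@le_trans _ _ ((s ^+ 2 * expR (- (s * (x / 2)))) * (`|a| + `|b|) ^+ 2)).
    have h : E * expR (s * `|a|) <= expR (- (s * (x / 2))).
      rewrite -expRD ler_expR.
      have : s * `|a| <= s * (x / 2) by rewrite ler_wpM2l.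
      lra.
    have -> : E * (s ^+ 2 * (`|a| + `|b|) ^+ 2 * expR (s * `|a|)) =
      (E * expR (s * `|a|)) * (s ^+ 2 * (`|a| + `|b|) ^+ 2) by ring.
    have -> : s ^+ 2 * expR (- (s * (x / 2))) * (`|a| + `|b|) ^+ 2 =
      expR (- (s * (x / 2))) * (s ^+ 2 * (`|a| + `|b|) ^+ 2) by ring.
    by rewrite ler_wpM2r// mulr_ge0// ?exprn_ge0// addr_ge0.
  rewrite ler_wpM2r ?exprn_ge0 ?addr_ge0//.
  have x2 : 0 < x / 2 by rewrite divr_gt0.
  apply: (le_trans (expR_decay x2 s0)).
  by rewrite le_eqVlt; apply/orP; left; apply/eqP; field; rewrite gt_eqF.
have E0 : 0 <= E := expR_ge0 _.
have two (c d : R) : `|c| <= 1 -> `|d| <= 1 ->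
   `|E * (c * (A * cos (s * b) - 1 - - (s * a)) + d * (A * sin (s * b) - s * b))| <= 16 / x ^+ 2 * (`|a| + `|b|) ^+ 2.
  move=> c1 d1; rewrite normrM (ger0_norm E0).
  apply: (@le_trans _ _ (E * (((`|- (s * a)| + `|s * b|) ^+ 2 * expR `|- (s * a)|) *+ 2))).
    rewrite ler_wpM2l// mulr2n; apply: (le_trans (ler_normD _ _)); apply: lerD.
      by rewrite normrM (le_trans _ P)// ler_piMl.
    by rewrite normrM (le_trans _ Q)// ler_piMl.
  by rewrite mulrnAr mulr2n; apply: (le_trans (lerD bnd bnd)); lra.
split.
  have := two (cos (s * y)) (- sin (s * y)); rewrite normrN => /(_ (cos_max _) (sin_max _)).
  apply: le_trans; rewrite le_eqVlt; apply/orP; left; apply/eqP; congr (`|_|).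
  by rewrite /rec /imc EA mulrDr cosD -/E; ring.
have := two (- sin (s * y)) (- cos (s * y)); rewrite !normrN => /(_ (sin_max _) (cos_max _)).
apply: le_trans; rewrite le_eqVlt; apply/orP; left; apply/eqP; congr (`|_|).
by rewrite /rec /imc EA mulrDr sinD -/E; ring.
Qed.

Lemma measurable_rec x y : measurable_fun setT (rec x y : measurableTypeR R -> R).
Proof.
apply: measurable_funM; first exact: measurable_expMz.
apply: (@measurableT_comp _ _ _ _ _ _ (@cos R)); first exact: continuous_measurable_fun (@continuous_cos R).
exact: measurable_funM.
Qed.

Lemma measurable_imc x y : measurable_fun setT (imc x y : measurableTypeR R -> R).
Proof.
apply: measurable_funN; apply: measurable_funM; first exact: measurable_expMz.
apply: (@measurableT_comp _ _ _ _ _ _ (@sin R)); first exact: continuous_measurable_fun (@continuous_sin R).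
exact: measurable_funM.
Qed.

Lemma Rintegral_bounded (m : {measure set (measurableTypeR R) -> \bar R}) (u : R -> R) C :
  (m D < +oo)%E -> measurable_fun D (u : measurableTypeR R -> R) ->
  (forall s, 0 <= s -> `|u s| <= C) -> `|\int[m]_(s in D) u s| <= C * fine (m D).
Proof.
move=> fm mu uC; have mD := @measurable_halfline R.
have := @Rintegral_dist _ _ _ m D mD fm u (fun=> 0) C C mu (@measurable_cst _ _ _ _ _ _).
rewrite (_ : \int[m]_(s in D) 0 = 0) ?subr0; last by rewrite Rintegral_cst ?mul0r.
by apply=> s /halflineP s0; rewrite ?subr0; exact: uC.
Qed.

(** Differentiation under the integral: p + i q is the complex derivative, and the two linear forms
    are the real and imaginary parts of (a + i b)(p + i q). The derivative is integrable because s
    e^(-sx) <= 1/x. *)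
Lemma laplace_pos_taylor (m : {measure set (measurableTypeR R) -> \bar R}) x y :
  (m D < +oo)%E -> 0 < x -> exists p q K, forall a b, `|a| <= x / 2 ->
  `|\int[m]_(s in D) rec (x + a) (y + b) s - \int[m]_(s in D) rec x y s - (a * p - b * q)| <=
     K * (`|a| + `|b|) ^+ 2 /\
  `|\int[m]_(s in D) imc (x + a) (y + b) s - \int[m]_(s in D) imc x y s - (a * q + b * p)| <=
     K * (`|a| + `|b|) ^+ 2.
Proof.
move=> fm x0; have mD := @measurable_halfline R.
pose p := \int[m]_(s in D) - (s * rec x y s); pose q := \int[m]_(s in D) - (s * imc x y s).
exists p, q, (16 / x ^+ 2 * fine (m D)) => a b ax.
have mr u v : measurable_fun D (rec u v : measurableTypeR R -> R) by apply: measurable_funTS; exact: measurable_rec.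
have mi u v : measurable_fun D (imc u v : measurableTypeR R -> R) by apply: measurable_funTS; exact: measurable_imc.
have msr u v : measurable_fun D ((fun s => - (s * rec u v s)) : measurableTypeR R -> R).
  by apply: measurable_funN; apply: measurable_funM => //; exact: measurable_id.
have msi u v : measurable_fun D ((fun s => - (s * imc u v s)) : measurableTypeR R -> R).
  by apply: measurable_funN; apply: measurable_funM => //; exact: measurable_id.
have e1 u s : 0 <= u -> 0 <= s -> expR (- (s * u)) <= 1.
  by move=> u0 s0; rewrite -expR0 ler_expR oppr_le0 mulr_ge0.
have xa : 0 <= x + a by move: ax; rewrite ler_norml => /andP[]; lra.
have es s : 0 <= s -> s * expR (- (s * x)) <= x^-1.
  move=> s0; rewrite expRN ler_pdivrMr ?expR_gt0// mulrC ler_pdivlMr//.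
  by apply: le_trans (expR_ge1Dx _); rewrite lerDr.
have ir u v : 0 <= u -> m.-integrable D (EFin \o rec u v).
  move=> u0; apply: (bounded_integrable mD fm (C := 1) (mr u v)) => s /halflineP s0.
  exact: le_trans (rec_bound _ _ _) (e1 _ _ u0 s0).
have ii u v : 0 <= u -> m.-integrable D (EFin \o imc u v).
  move=> u0; apply: (bounded_integrable mD fm (C := 1) (mi u v)) => s /halflineP s0.
  exact: le_trans (imc_bound _ _ _) (e1 _ _ u0 s0).
have isr : m.-integrable D (EFin \o (fun s => - (s * rec x y s))).
  apply: (bounded_integrable mD fm (C := x^-1) (msr x y)) => s /halflineP s0.
  rewrite normrN normrM (ger0_norm s0); apply: le_trans (es s s0).
  by rewrite ler_wpM2l// rec_bound.
have isi : m.-integrable D (EFin \o (fun s => - (s * imc x y s))).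
  apply: (bounded_integrable mD fm (C := x^-1) (msi x y)) => s /halflineP s0.
  rewrite normrN normrM (ger0_norm s0); apply: le_trans (es s s0).
  by rewrite ler_wpM2l// imc_bound.
have iZ k u : m.-integrable D (EFin \o u) -> m.-integrable D (EFin \o (fun s : R => k * u s)).
  by move=> iu; have := integrableZl mD k iu; apply: eq_integrable.
have iB u v : m.-integrable D (EFin \o u) -> m.-integrable D (EFin \o v) ->
    m.-integrable D (EFin \o (fun s : R => u s - v s)).
  by move=> iu iv; have := integrableB mD iu iv; apply: eq_integrable.
have iD u v : m.-integrable D (EFin \o u) -> m.-integrable D (EFin \o v) ->
    m.-integrable D (EFin \o (fun s : R => u s + v s)).
  by move=> iu iv; have := integrableD mD iu iv; apply: eq_integrable.
have key s (s0 : 0 <= s) := rec_imc_taylor y b x0 s0 ax.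
split.
- rewrite {1}/p /q -!RintegralZl//.
  rewrite -RintegralB//; [|exact: ir|exact: ir (ltW x0)].
  rewrite -RintegralB//; [|exact: iZ|exact: iZ].
  rewrite -RintegralB//; [|by apply: iB; apply: ir => //; exact: ltW|by apply: iB; exact: iZ].
  rewrite mulrAC; apply: Rintegral_bounded => // [|s s0]; last exact: (key s s0).1.
  by apply: measurable_funB; apply: measurable_funB => //; exact: measurable_funM.
- rewrite {1}/p /q -!RintegralZl//.
  rewrite -RintegralB//; [|exact: ii|exact: ii (ltW x0)].
  rewrite -RintegralD//; [|exact: iZ|exact: iZ].
  rewrite -RintegralB//; [|by apply: iB; apply: ii => //; exact: ltW|by apply: iD; exact: iZ].
  rewrite mulrAC; apply: Rintegral_bounded => // [|s s0]; last exact: (key s s0).2.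
  by apply: measurable_funB; [apply: measurable_funB|apply: measurable_funD] => //; exact: measurable_funM.
Qed.

Lemma normc_le_ReIm (w : R[i]) : `|w| <= (`|complex.Re w| + `|complex.Im w|)%:C.
Proof.
case: w => a b /=; have -> : a +i* b = a%:C + 'i%C * b%:C by simpc.
apply: (le_trans (ler_normD _ _)).
have nC (u : R) : `|u%:C| = `|u|%:C by rewrite normc_def /= expr0n addr0 sqrtr_sqr.
by rewrite normrM normCi mul1r !nC rmorphD.
Qed.

Lemma derivable_laplace_pos (m : {measure set (measurableTypeR R) -> \bar R}) z :
  (m D < +oo)%E -> 0 < complex.Re z ->
  derivable (laplace_pos m : R[i]^o -> R[i]^o) z 1.
Proof.
case: z => x y /= fm x0.
have [p [q [K0 h0]]] := laplace_pos_taylor y fm x0.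
pose K := `|K0| + 1.
have K1 : 0 < K by rewrite ltr_wpDl.
have h a b : `|a| <= x / 2 ->
  `|\int[m]_(s in D) rec (x + a) (y + b) s - \int[m]_(s in D) rec x y s - (a * p - b * q)| <=
     K * (`|a| + `|b|) ^+ 2 /\
  `|\int[m]_(s in D) imc (x + a) (y + b) s - \int[m]_(s in D) imc x y s - (a * q + b * p)| <=
     K * (`|a| + `|b|) ^+ 2.
  move=> /(h0 _ b)[h1 h2]; have KK : K0 * (`|a| + `|b|) ^+ 2 <= K * (`|a| + `|b|) ^+ 2.
    by rewrite ler_wpM2r ?exprn_ge0 ?addr_ge0// (le_trans (ler_norm _))// lerDl.
  by split; [exact: le_trans h1 KK|exact: le_trans h2 KK].
apply/cvg_ex; exists (p +i* q : R[i]^o).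
apply/cvgrPdist_le => /= e e0.
have er : (complex.Re e)%:C = e by rewrite RRe_real// gtr0_real.
have er0 : 0 < complex.Re e by rewrite -ltcR er.
(* For an increment of modulus rho, (|a| + |b|)^2 <= 4 rho^2, and the real and imaginary errors add:
   this gives the 8. *)
pose d := Num.min (x / 2) (complex.Re e / (8 * K)).
have d0 : 0 < d by rewrite lt_min !divr_gt0// mulr_gt0.
near=> w.
have w0 : w != 0 by near: w; exact: (@nbhs_dnbhs_neq (R[i]^o) 0).
have wd : `|w| <= d%:C.
  near: w; apply: (@dnbhs0_le R[i] (R[i]^o)); by rewrite ltcR.
move: (w) w0 wd => [a b] w0; rewrite normc_def lecR /= => wd.
set rho := Num.sqrt _ in wd; have nw : `|a +i* b| = rho%:C by rewrite normc_def.
have rho0 : 0 < rho by rewrite -ltcR -nw normr_gt0.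
have ar : `|a| <= rho.
  by have := normc_ge_Re (a +i* b); rewrite nw lecR.
have br : `|b| <= rho.
  have := normc_ge_Re ('i%C * (a +i* b)); rewrite normrM normCi mul1r nw lecR /=.
  by rewrite mul0r mul1r sub0r normrN.
have ax : `|a| <= x / 2.
  by apply: (le_trans ar); apply: (le_trans wd); rewrite ge_min lexx.
have [h1 h2] := h a b ax.
set L := laplace_pos m _ - _.
have LE : L - (a +i* b) * (p +i* q) =
   (\int[m]_(s in D) rec (x + a) (y + b) s - \int[m]_(s in D) rec x y s - (a * p - b * q)) +i*
   (\int[m]_(s in D) imc (x + a) (y + b) s - \int[m]_(s in D) imc x y s - (a * q + b * p)).
  rewrite /L.
  have -> : (a +i* b : R[i]^o) *: 1 + (x +i* y) = (x + a) +i* (y + b).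
    transitivity ((a +i* b) * 1 + (x +i* y)); first by [].
    by rewrite mulr1 addrC; simpc.
  by rewrite !laplace_posE; simpc.
have e1 (l : R[i]) : (p +i* q) - (a +i* b)^-1 * l = - ((a +i* b)^-1 * (l - (a +i* b) * (p +i* q))).
  by rewrite mulrBr mulrA mulVf// mul1r opprB.
have -> : (p +i* q : R[i]^o) - (a +i* b)^-1 *: (L : R[i]^o) = - ((a +i* b)^-1 * (L - (a +i* b) * (p +i* q))).
  exact: e1.
rewrite normrN normrM normfV ler_pdivrMl ?normr_gt0// LE.
apply: (le_trans (normc_le_ReIm _)); rewrite nw -er -rmorphM lecR /=.
have hr : K * (`|a| + `|b|) ^+ 2 <= 4 * K * rho ^+ 2.
  rewrite mulrAC [_ * K]mulrC ler_pM2l//.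
  have -> : 4 * rho ^+ 2 = (2 * rho) ^+ 2 by ring.
  apply: lerXn2r; rewrite ?nnegrE ?addr_ge0 ?mulr_ge0 ?(ltW rho0)//.
  by rewrite mulr_natl mulr2n lerD.
have rd : rho * (8 * K) <= complex.Re e.
  by rewrite -ler_pdivlMr ?mulr_gt0//; apply: (le_trans wd); rewrite ge_min lexx orbT.
apply: le_trans (_ : rho * (rho * (8 * K)) <= _); last by rewrite ler_pM2l.
apply: (le_trans (lerD (le_trans h1 hr) (le_trans h2 hr))).
by rewrite le_eqVlt; apply/orP; left; apply/eqP; ring.
Unshelve. all: by end_near.
Qed.

End ComplexLaplace.

Section Extension.
Context (R : realType) (X : completeNormedModType R[i]) (T : R -> X -> X) (M : R)
  (hT : bounded_C0 T M).
Implicit Types (a b t s c : R) (z w : R[i]) (x y : X).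
Local Notation D := (`[0%R, +oo[%classic : set R).
Local Notation fmeasure := {finite_measure set (measurableTypeR R) -> \bar R}.
Local Notation pmeasure := {measure set (measurableTypeR R) -> \bar R}.

Lemma finite_measure_lty (m : fmeasure) : (m D < +oo)%E.
Proof. by rewrite -ge0_fin_numE//; apply: fin_num_measure; exact: measurable_halfline. Qed.

(** The fields of [cmeasure] are finite on the whole line, so m is restricted to the half-line,
    which changes neither its transform nor its operator. *)
Lemma pcalc_finite (f : R -> R) F c : pcalc T f F c -> exists m : fmeasure,
  [/\ (m D <= c%:E)%E, forall z : R, 0 < z -> f z = lap m z & forall x, F x = hp_pos T m x].
Proof.
move=> [m [mc mf mF]]; have fm := pcalc_lty mc.
pose m' : fmeasure := mfrestr (@measurable_halfline R) fm.
have mm' A : measurable A -> A `<=` D -> m' A = m A.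
  by move=> mA AD; rewrite /m' /= /mfrestr /mrestr setIidl.
have m'D : m' D = m D by apply: mm' => //; exact: measurable_halfline.
exists m'; split; first by rewrite m'D.
- by move=> z z0; rewrite mf// /lap /Rintegral; congr (fine _); apply: eq_measure_integral => A mA AD; rewrite -mm'.
- move=> x; rewrite mF; apply: (hp_pos_congr hT x fm); last exact: finite_measure_lty.
  by move=> n k; apply/esym/mm'; [exact: measurable_cellD|move=> s []].
Qed.

Lemma laplace_pos_real (m : pmeasure) t : laplace_pos m t%:C = (lap m t)%:C.
Proof.
rewrite laplace_posE /lap; congr (_ +i* _).
  by apply: eq_Rintegral => s _; rewrite /rec mulr0 cos0 mulr1.
transitivity (\int[m]_(s in D) (0 : R)).
  by apply: eq_Rintegral => s _; rewrite /imc mulr0 sin0 mulr0 oppr0.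
by rewrite Rintegral_cst ?mul0r//; exact: measurable_halfline.
Qed.

Lemma derivable_laplace (nu : cmeasure R) z : 0 < complex.Re z ->
  derivable (laplace nu : R[i]^o -> R[i]^o) z 1.
Proof.
move=> z0; have d (m : fmeasure) := derivable_laplace_pos (finite_measure_lty m) z0.
have h1 := derivableB (d (re_pos nu)) (d (re_neg nu)).
have h2 := derivableZ (k := 'i%C) (derivableB (d (im_pos nu)) (d (im_neg nu))).
have h := derivableD h1 h2.
exact: h.
Qed.

Lemma exists_cmeasure (m m' : fmeasure) : exists nu : cmeasure R,
  (forall z, 0 < complex.Re z -> laplace nu z = laplace_pos m z - laplace_pos m' z) /\
  forall x, hp T nu x = hp_pos T m x - hp_pos T m' x.
Proof.
have [m0 [m0D _ m0F]] := pcalc_finite (pcalcZ hT (lexx 0) (pcalc_translation hT (lexx 0))).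
rewrite mul0r in m0D.
exists (CMeasure m m' m0 m0); split=> [z z0|x].
  by rewrite /laplace /= subrr mulr0 addr0.
by rewrite /hp /= subrr scaler0 addr0.
Qed.

Lemma hpc_cmeasure (f : R -> R) c : hpc T f c -> exists nu : cmeasure R,
  (forall t : R, 0 < t -> laplace nu t%:C = (f t)%:C) /\ forall x, hp T nu x = op T f x.
Proof.
move=> [p [q [pp pq _ fE]]].
have [m [_ mf mF]] := pcalc_finite pp; have [m' [_ mf' mF']] := pcalc_finite pq.
have [nu [nuL nuH]] := exists_cmeasure m m'; exists nu; split.
  by move=> t t0; rewrite nuL//= !laplace_pos_real -mf// -mf'// -rmorphB fE.
by move=> x; rewrite nuH (opE hT x pp pq fE) mF mF'.
Qed.

Lemma laplace_pos_dirac0 z : laplace_pos (@dirac _ (measurableTypeR R) 0 R) z = 1.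
Proof.
case: z => a b; rewrite laplace_posE.
have h (u : R -> R) : measurable_fun setT (u : measurableTypeR R -> R) ->
    \int[@dirac _ (measurableTypeR R) 0 R]_(s in D) u s = u 0.
  move=> mu; rewrite /Rintegral integral_dirac//=; last by apply/measurable_EFinP/measurable_funTS.
  by rewrite indicE mem_set ?mul1r//; exact/halflineP.
rewrite !h; [|exact: measurable_imc|exact: measurable_rec].
by rewrite /rec /imc !mul0r oppr0 expR0 cos0 sin0 mulr0 oppr0 mul1r.
Qed.

(** The measure is the Dirac mass at 0 minus the measure of (z+1)^-1. Its transform has no zero in
    the half-plane, since at a + i b the real part of the second transform is at most 1/(a+1) <
    1. *)
Lemma regularizer : exists nu : cmeasure R,
  [/\ forall z, 0 < complex.Re z -> laplace nu z != 0,
   forall t : R, 0 < t -> laplace nu t%:C = (t / (t + 1))%:C &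
   forall x, hp T nu x = op T (fun t => t / (t + 1)) x].
Proof.
have f0 : ((@dirac _ (measurableTypeR R) 0%R R) D < +oo)%E.
  by rewrite /= /dirac ltry.
pose m0 : fmeasure := mfrestr (@measurable_halfline R) f0.
have m0D : (m0 D <= 1%:E)%E.
  by rewrite /m0 /= /mfrestr /mrestr setIid /dirac lee_fin indicE; case: (_ \in _).
have L0 z : laplace_pos m0 z = 1.
  rewrite -(laplace_pos_dirac0 z) /laplace_pos /Rintegral; congr (fine _ +i* fine _);
  by apply: eq_measure_integral => A mA AD; rewrite /m0 /= /mfrestr /mrestr setIidl.
have p0 : pcalc T (lap m0) (hp_pos T m0) 1 by exists m0.
have [F1 pF1] := pcalc_resolvent hT ltr01.
have [m1 [m1D m1f m1F]] := pcalc_finite pF1.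
have [nu [nuL nuH]] := exists_cmeasure m0 m1; exists nu; split.
- case=> a b /= a0; rewrite nuL// L0 laplace_posE; apply/eqP => /(congr1 (@complex.Re R)) /=.
  have h : \int[m1]_(s in D) rec a b s <= lap m1 a.
    have e s : 0 <= s -> expR (- (s * a)) <= 1.
      by move=> s0; rewrite -expR0 ler_expR oppr_le0 mulr_ge0// ltW.
    have mD := @measurable_halfline R; have fm := finite_measure_lty m1.
    apply: le_Rintegral => //.
    + apply: (bounded_integrable mD fm (C := 1)).
        by apply: measurable_funTS; exact: measurable_rec.
      by move=> s /halflineP s0; exact: le_trans (rec_bound _ _ _) (e s s0).
    + apply: (bounded_integrable mD fm (C := 1)).
        by apply: measurable_funTS; exact: measurable_expMz.
      by move=> s /halflineP s0; rewrite ger0_norm ?expR_ge0// e.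
    + by move=> s _; exact: le_trans (ler_norm _) (rec_bound _ _ _).
  move: h; rewrite -m1f// => h.
  have : (a + 1)^-1 < 1 by rewrite invf_lt1 ?addr_gt0// ltrDr.
  lra.
- move=> t t0; rewrite nuL//= L0 laplace_pos_real -m1f// -(rmorph1 (real_complex R)) -rmorphB.
  by congr (_%:C); field; rewrite gt_eqF ?addr_gt0.
- move=> x; rewrite nuH -m1F; apply/esym.
  have fE (z : R) : 0 < z -> z / (z + 1) = lap m0 z - (z + 1)^-1.
    move=> z0; have : laplace_pos m0 z%:C = 1 by exact: L0.
    rewrite laplace_pos_real => /(congr1 (@complex.Re R)) /= ->.
    by field; rewrite gt_eqF ?addr_gt0.
  exact: (@opE _ _ _ _ hT _ (lap m0, hp_pos T m0, 1) ((fun t => (t + 1)^-1), F1, 1^-1) x p0 pF1 fE).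
Qed.

(* The extension of f is the quotient of two Laplace transforms; the denominator
   does not vanish, so that s and f only have to be compared on the reals. *)
Lemma ext_hp_real_dom (f s : R -> R) c x y :
  injective (op T (fun t => t / (t + 1))) -> hpc T s c ->
  (forall t, 0 < t -> s t = t / (t + 1) * f t) ->
  op T (fun t => t / (t + 1)) y = op T s x ->
  op_dom (ext_hp_real T f) x.
Proof.
move=> inj hs sE yx.
have [nu [nu0 nuL nuH]] := regularizer.
have [sigma [sL sH]] := hpc_cmeasure hs.
exists y; exists (fun z => laplace sigma z / laplace nu z).
  split=> [z z0|t t0].
    have h1 := derivable_laplace (nu := sigma) z0.
    have h2 := derivableV (f := (laplace nu : R[i]^o -> R[i]^o)) (nu0 z z0) (derivable_laplace (nu := nu) z0).
    exact: derivableM h1 h2.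
  rewrite sL// nuL// sE// -fmorphV -rmorphM; congr (_%:C).
  by field; rewrite !gt_eqF ?addr_gt0.
exists nu, sigma; split; last by rewrite /= nuH sH.
split; first by move=> u v; rewrite !nuH; exact: inj.
by move=> z z0; rewrite mulrC divfK// nu0.
Qed.

End Extension.

(** * Injectivity of the regularizer when A has dense range *)

Section Injectivity.
Context (R : realType) (X : completeNormedModType R[i]) (T : R -> X -> X) (M : R)
  (hT : bounded_C0 T M).
Implicit Types (a b t s c l : R) (x y w : X).

Lemma hpc_resolvent_compl l : 0 < l -> hpc T (fun t => t / (t + l)) 2.
Proof.
move=> l0; have h := hpcB hT (hpc1 hT).1 (hpcZ hT l (hpc_resolvent hT l0)).
rewrite gtr0_norm// divff ?gt_eqF// in h.
apply: hpc_ext h => t t0; by field; rewrite gt_eqF ?addr_gt0.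
Qed.

Lemma op_translation h x : 0 <= h -> op T (fun z => expR (- (h * z))) x = T h x.
Proof. by move=> h0; rewrite (pcalc_hpc hT (pcalc_translation hT h0)).2. Qed.

(** The symbol factors as (1 - e^(-hz)) / (hz), of mass 1, times z/(z+l), of mass 2. The bound is
    uniform in both h and l, so that h -> 0 bounds (A+l)^-1 A y independently of l. *)
Lemma resolvent_ran l h y : 0 < l -> 0 < h ->
  rnorm (op T (fun z => (z + l)^-1) ((h^-1)%:C *: (y - T h y))) <= 2 * M * rnorm y.
Proof.
move=> l0 h0; have hl := hpc_resolvent hT l0.
have [hI _] := pcalc_hpc hT (pcalc_integrated hT h0).
have [htr _] := pcalc_hpc hT (pcalc_translation hT (ltW h0)).
have h1 := hpcB hT (hpc1 hT).1 htr.
have -> : op T (fun z => (z + l)^-1) ((h^-1)%:C *: (y - T h y)) =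
    op T (fun z => h^-1 * ((1 - expR (- (h * z))) / z * (z / (z + l)))) y.
  have hc := hpcM hT hI (hpc_resolvent_compl l0).
  rewrite (opZ hT _ _ hc) (op_scalev hT _ _ hl); congr (_ *: _).
  rewrite -(op_translation y (ltW h0)) -{1}[y](hpc1 hT).2 -(opB hT y (hpc1 hT).1 htr).
  rewrite -(opM hT y hl h1); apply: op_ext => z z0.
  by field; rewrite !gt_eqF// addr_gt0.
have hc := hpcZ hT h^-1 (hpcM hT hI (hpc_resolvent_compl l0)).
apply: (le_trans (op_norm hT y hc)); rewrite gtr0_norm ?invr_gt0// mulKf ?gt_eqF//.
by rewrite [M * _]mulrC.
Qed.

(* If (A/(A+1)) w = 0 then w = l (A+l)^-1 w for all l > 0, which tends to 0 with l
   since it does on the dense range of A. *)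
Lemma op_regularizer_injective (A : set (X * X)) : op_opp A = generator T ->
  closure (op_ran A) = [set: X] -> injective (op T (fun t => t / (t + 1))).
Proof.
move=> hA hran; have M0 := M0 hT; have he := hpc_resolvent_compl ltr01.
suff key w : op T (fun t => t / (t + 1)) w = 0 -> w = 0.
  move=> u v uv; apply/eqP; rewrite -subr_eq0; apply/eqP; apply: key.
  by rewrite (op_subv hT _ _ he) uv subrr.
move=> w0.
have wl l : 0 < l -> w = op T (fun z => l * (z + l)^-1) w.
  move=> l0; have hl := hpc_resolvent hT l0.
  have h1 := hpcD hT (hpc1 hT).1 (hpcZ hT (1 - l) hl).
  have e : op T (fun z => 1 - l * (z + l)^-1) w = 0.
    rewrite (op_ext _ (g := fun z => (1 + (1 - l) * (z + l)^-1) * (z / (z + 1)))).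
      by rewrite (opM hT w h1 he) w0 -[X in op _ _ X](subrr (0 : X)) (op_subv hT _ _ h1) subrr.
    by move=> z z0; field; rewrite !gt_eqF ?addr_gt0.
  have := opB hT w (hpc1 hT).1 (hpcZ hT l hl); rewrite e (hpc1 hT).2 => /esym/eqP.
  by rewrite subr_eq0 => /eqP.
have near_ran e : 0 < e -> exists y z0, rnorm (w - z0) < e /\ A (y, z0).
  move=> e0; have : closure (op_ran A) w by rewrite hran.
  have e0' : 0 < e%:C by rewrite ltcR.
  move=> /(_ _ (nbhsx_ballx w _ e0'))[z0 [[y Ay]]].
  by rewrite -ball_normE /= rnormE ltcR => h; exists y, z0.
(* Here z0 = A y is the limit of (y - T h y)/h, and [resolvent_ran] passes to the limit. *)
have rbound y z0 l : A (y, z0) -> 0 < l -> rnorm (op T (fun z => (z + l)^-1) z0) <= 2 * M * rnorm y.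
  move=> Ay l0; have hl := hpc_resolvent hT l0.
  have gy : generator T (y, - z0) by rewrite -hA /op_opp /= opprK.
  have gc : (fun h => - ((h^-1)%:C *: (T h y - y))) @ 0^'+ --> z0.
    by rewrite -[X in _ --> X]opprK; apply: cvgN.
  have FF : Filter (0 : R)^'+ by exact: at_right_proper_filter.
  have nl := @cvg_rnorm _ _ _ _ FF _ _ (op_cvg hT (FF := FF) hl gc); rewrite -(cvg_lim (@Rhausdorff R) nl).
  apply: limr_le; first by apply/cvg_ex; eexists; exact: nl.
  near=> h.
  have h0 : 0 < h by [].
  by rewrite -scalerN opprB; exact: resolvent_ran.
suff h : rnorm w <= 0 by apply: rnorm_eq0; apply/eqP; rewrite eq_le h rnorm_ge0.
apply/ler_addgt0Pr => e e0; rewrite add0r.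
pose e' := e / (2 * (M + 1)).
have e'0 : 0 < e' by rewrite divr_gt0// mulr_gt0// ltr_wpDl.
have [y [z0 [wz Ay]]] := near_ran _ e'0.
pose l := e / (2 * (2 * M * rnorm y + 1)).
have n0 : 0 <= 2 * M * rnorm y by rewrite !mulr_ge0// rnorm_ge0.
have l0 : 0 < l by rewrite divr_gt0// mulr_gt0// ltr_wpDl.
have hl := hpc_resolvent hT l0; have hll := hpcZ hT l hl.
rewrite (wl l l0).
have -> : w = (w - z0) + z0 by rewrite subrK.
rewrite (op_addv hT _ _ hll); apply: (le_trans (rnormD _ _)).
have b1 : rnorm (op T (fun z => l * (z + l)^-1) (w - z0)) <= M * e'.
  apply: (le_trans (op_norm hT _ hll)).
  rewrite gtr0_norm// divff ?gt_eqF// mulr1 ler_wpM2l// ltW//.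
have b2 : rnorm (op T (fun z => l * (z + l)^-1) z0) <= l * (2 * M * rnorm y).
  rewrite (opZ hT _ _ hl) rnormZ gtr0_norm//.
  by apply: ler_wpM2l; [exact: ltW|exact: rbound Ay l0].
have c1 : M * e' <= e / 2.
  rewrite /e' mulrA ler_pdivrMr ?mulr_gt0 ?ltr_wpDl//; nra.
have c2 : l * (2 * M * rnorm y) <= e / 2.
  rewrite /l mulrAC ler_pdivrMr ?mulr_gt0 ?ltr_wpDl//; nra.
lra.
Unshelve. all: by end_near.
Qed.

End Injectivity.

(** * Kaluza's theorem *)

Section Kaluza.
Context (R : realType).
Implicit Types (u p : nat -> R).

(** Each new term depends on all earlier ones, so the recursion carries the list of terms already
    computed. *)
Fixpoint renewal_seq u n : seq R :=
  if n is n'.+1 then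
    let s := renewal_seq u n' in
    rcons s (u n'.+1 - \sum_(j < n') nth 0 s j * u (n' - j)%N)
  else [::].

(** With U the generating series of u and U = 1 + P U, this is the coefficient of x^(n+1) in P = 1 -
    1/U; the constant term of P is zero and is not indexed. *)
Definition renewal u n : R := nth 0 (renewal_seq u n.+1) n.

Lemma size_renewal_seq u n : size (renewal_seq u n) = n.
Proof. by elim: n => //= n IH; rewrite size_rcons IH. Qed.

Lemma nth_renewal_seq u n j : (j < n)%N -> nth 0 (renewal_seq u n) j = renewal u j.
Proof.
elim: n => // n IH; rewrite ltnS leq_eqVlt => /orP[/eqP -> //|jn].
by rewrite /= nth_rcons size_renewal_seq jn IH.
Qed.

Lemma renewalE u n : u 0%N = 1 ->
  u n.+1 = \sum_(j < n.+1) renewal u j * u (n - j)%N.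
Proof.
move=> u0; rewrite big_ord_recr /= subnn u0 mulr1 {2}/renewal /= nth_rcons.
rewrite size_renewal_seq ltnn eqxx.
under [X in _ = _ + (_ - X)]eq_bigr do rewrite nth_renewal_seq//.
by rewrite addrC subrK.
Qed.

Section Positivity.
Variable u : nat -> R.
Hypotheses (u0 : u 0%N = 1) (upos : forall n, 0 < u n)
  (ulc : forall n, u n.+1 ^+ 2 <= u n * u n.+2) (uni : forall n, u n.+1 <= u n).

Lemma ratio_nondecreasing k n : (k <= n)%N -> u k.+1 * u n <= u n.+1 * u k.
Proof.
elim: n => [|n IH]; first by rewrite leqn0 => /eqP ->.
rewrite leq_eqVlt => /orP[/eqP -> //|]; rewrite ltnS => /IH h.
rewrite -(ler_pM2l (upos n)).
apply: (@le_trans _ _ (u n.+1 * (u n.+1 * u k))).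
  have -> : u n * (u k.+1 * u n.+1) = u n.+1 * (u k.+1 * u n) by ring.
  by rewrite ler_pM2l.
rewrite !mulrA -expr2 ler_pM2r//; exact: ulc.
Qed.

(** Kaluza's induction. Multiply the new coefficient by u_(n+1) and expand u_(n+1) by the renewal
    equation: the term with index j compares u_(n+1-j) / u_(n-j) with u_(n+2) / u_(n+1), and
    log-convexity makes the ratios nondecreasing. *)
Lemma renewal_ge0 n : 0 <= renewal u n.
Proof.
elim/ltn_ind: n => n IH.
have := renewalE n u0; rewrite big_ord_recr /= subnn u0 mulr1 => e.
case: n IH e => [|n] IH e; first by move: e; rewrite big_ord0 add0r => <-; exact: ltW.
have -> : renewal u n.+1 = u n.+2 - \sum_(j < n.+1) renewal u j * u (n.+1 - j)%N by rewrite e; ring.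
rewrite subr_ge0 -(ler_pM2r (upos n.+1)) {2}(renewalE n u0) mulr_suml mulr_sumr.
apply: ler_sum => j _; have jn : (j <= n)%N by rewrite -ltnS.
rewrite mulrCA -mulrA ler_wpM2l ?IH// subSn//.
by apply: ratio_nondecreasing; rewrite (leq_trans (leq_subr _ _)).
Qed.

Lemma u_nonincreasing m n : (m <= n)%N -> u n <= u m.
Proof.
elim: n => [|n IH]; first by rewrite leqn0 => /eqP ->.
by rewrite leq_eqVlt => /orP[/eqP -> //|]; rewrite ltnS => /IH; exact: le_trans (uni n).
Qed.

(** In the renewal equation for u_(n+1), every factor u_(n-j) is at least u_(n+1); divide by
    u_(n+1). *)
Lemma sum_renewal_le1 n : \sum_(j < n) renewal u j <= 1.
Proof.
case: n => [|n]; first by rewrite big_ord0.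
rewrite -(ler_pM2r (upos n.+1)) mul1r {2}(renewalE n u0) mulr_suml.
apply: ler_sum => j _; rewrite ler_wpM2l ?renewal_ge0//.
by apply: u_nonincreasing; rewrite (leq_trans (leq_subr _ _)).
Qed.

(** All terms being nonnegative, the truncated identity [conv] between partial sums bounds U by 1 +
    P U and 1 + P U by U. *)
Lemma renewal_inv (x U : R) : 0 <= x < 1 ->
  (fun N => \sum_(n < N) u n * x ^+ n) @ \oo --> U ->
  (fun N => \sum_(n < N) renewal u n * x ^+ n.+1) @ \oo --> 1 - U^-1.
Proof.
move=> /andP[x0 x1] cU.
pose a n := renewal u n * x ^+ n.+1; pose b n := u n * x ^+ n.
have a0 n : 0 <= a n by rewrite mulr_ge0 ?renewal_ge0// exprn_ge0.
have b0 n : 0 <= b n by rewrite mulr_ge0 ?exprn_ge0// ltW.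
have [P cP uP] : exists2 l, (fun N => \sum_(n < N) a n) @ \oo --> l & forall N, \sum_(n < N) a n <= l.
  apply: (bounded_sum_cvg (C := 1) a0) => N; apply: le_trans (sum_renewal_le1 N).
  by apply: ler_sum => n _; rewrite ler_piMr ?renewal_ge0// exprn_ile1// ltW.
have bU N : \sum_(n < N) b n <= U.
  rewrite -(cvg_lim (@Rhausdorff R) cU); apply: nondecreasing_cvgn_le.
    by apply/nondecreasing_seqP => n; rewrite big_ord_recr /= lerDl b0.
  by apply/cvg_ex; exists U.
have conv N : \sum_(n < N.+1) b n = 1 + \sum_(j < N) a j * \sum_(i < N - j) b i.
  elim: N => [|N IH].
    by rewrite big_ord_recr !big_ord0 /= /b u0 expr0 mulr1 add0r addr0.
  rewrite big_ord_recr IH /= -addrA; congr (1 + _).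
  rewrite [in RHS]big_ord_recr /=.
  have -> : \sum_(i < N.+1 - N) b i = 1.
    by rewrite subSnn big_ord_recr big_ord0 /= /b u0 expr0 mulr1 add0r.
  have -> : \sum_(j < N) a j * \sum_(i < N.+1 - j) b i =
      \sum_(j < N) a j * \sum_(i < N - j) b i + \sum_(j < N) a j * b (N - j)%N.
    rewrite -big_split; apply: eq_bigr => j _ /=.
    by rewrite subSn 1?ltnW// big_ord_recr mulrDr.
  rewrite -addrA; congr (_ + _).
  rewrite /b (renewalE N u0) big_ord_recr /= subnn u0 mulr1 mulrDl mulr_suml; congr (_ + _).
    apply: eq_bigr => j _; rewrite /a mulrACA -exprD; congr (_ * x ^+ _).
    by rewrite addSn subnKC// ltnW.
  by rewrite mulr1.
have U1 : 1 <= U.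
  by have := bU 1%N; rewrite big_ord_recr big_ord0 /= /b u0 expr0 mulr1 add0r.
have U0 : 0 < U by apply: lt_le_trans U1.
have up : U <= 1 + P * U.
  have cU' : (fun N => \sum_(n < N.+1) b n) @ \oo --> U.
    by rewrite (cvg_shiftS (fun N => \sum_(n < N) b n)).
  apply: (real_cvg_le cU') => N; rewrite conv lerD2l.
  apply: (@le_trans _ _ (\sum_(j < N) a j * U)).
    by apply: ler_sum => j _; rewrite ler_wpM2l.
  by rewrite -mulr_suml ler_wpM2r// ltW.
(* The product of K terms of P and L terms of U is contained in the truncated convolution of length
   K + L. *)
have lo : 1 + P * U <= U.
  have h K : \sum_(n < K) a n * U <= U - 1.
    have cK : (fun N => (\sum_(n < K) a n) * (\sum_(n < N) b n)) @ \oo --> (\sum_(n < K) a n) * U.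
      exact: cvgMl_tmp cU.
    rewrite -mulr_suml; apply: (real_cvg_le cK) => L; rewrite lerBrDl mulr_suml.
    apply: le_trans (bU (K + L).+1); rewrite conv lerD2l big_split_ord /=.
    rewrite -[leLHS]addr0; apply: lerD.
      apply: ler_sum => j _; rewrite ler_wpM2l//.
      have le : (L <= K + L - j)%N by rewrite addnC -addnBA ?leq_addr// ltnW.
      rewrite -(subnKC le) big_split_ord /= lerDl sumr_ge0//.
    by apply: sumr_ge0 => j _; rewrite mulr_ge0// sumr_ge0.
  have cPU : (fun N => (\sum_(n < N) a n) * U) @ \oo --> P * U by exact: cvgMr_tmp cP.
  rewrite -lerBrDl; apply: (real_cvg_le cPU) => K; rewrite mulr_suml; exact: h.
have PE : P = 1 - U^-1.
  have e : U = 1 + P * U by apply/eqP; rewrite eq_le up lo.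
  have Un0 : U != 0 by rewrite gt_eqF.
  apply: (mulIf Un0); rewrite mulrBl mul1r mulVf//; lra.
by rewrite -PE.
Qed.

End Positivity.
End Kaluza.

(** * Symbols built from a Stieltjes function *)

Lemma Rintegral_bigcup_cvg d (S : measurableType d) (R : realType) (m : {measure set S -> \bar R})
    (E_ : nat -> set S) (f : S -> R) : trivIset setT E_ -> (forall k, measurable (E_ k)) ->
  (forall s, (\bigcup_k E_ k) s -> 0 <= f s) ->
  m.-integrable (\bigcup_k E_ k) (EFin \o f) ->
  (fun N => \sum_(k < N) \int[m]_(s in E_ k) f s) @ \oo --> \int[m]_(s in \bigcup_k E_ k) f s /\
  forall N, \sum_(k < N) \int[m]_(s in E_ k) f s <= \int[m]_(s in \bigcup_k E_ k) f s.
Proof.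
move=> tE mE f0 fi.
have sE k : E_ k `<=` \bigcup_k E_ k by exact: bigcup_sup.
have fik k : m.-integrable (E_ k) (EFin \o f).
  by apply: (integrableS _ _ (sE k) fi) => //; exact: bigcupT_measurable.
have e0 k : 0 <= \int[m]_(s in E_ k) f s by apply: Rintegral_ge0 => s Es; apply/f0/(sE k).
have mU : measurable (\bigcup_k E_ k) by exact: bigcupT_measurable.
have h : (fun N => \sum_(k < N) \int[m]_(s in E_ k) f s) @ \oo --> \int[m]_(s in \bigcup_k E_ k) f s.
  apply: (nneseries_cvg_fine e0); first exact: integrable_fin_num.
  rewrite (integral_bigcup tE mE fi); apply: eq_eseriesr => k _.
  by rewrite fineK//; exact: integrable_fin_num.
split=> // N; rewrite -(cvg_lim (@Rhausdorff R) h).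
apply: (nondecreasing_cvgn_le (u_ := fun N => \sum_(k < N) \int[m]_(s in E_ k) f s)).
  by apply/nondecreasing_seqP => n; rewrite big_ord_recr /= lerDl.
by apply/cvg_ex; eexists; exact: h.
Qed.

Lemma measurable_fun_inv_pos d (S : measurableType d) (R : realType) (B : set S) (f : S -> R) :
  measurable B -> (forall s, B s -> 0 < f s) -> measurable_fun B f ->
  measurable_fun B (fun s => (f s)^-1).
Proof.
move=> mB f0 mf.
suff h : measurable_fun (`]0%R, +oo[%classic : set (measurableTypeR R)) (GRing.inv : R -> R).
  apply: (measurable_comp _ _ h mf) => //.
  by move=> _ [s Bs <-] /=; rewrite in_itv /= andbT f0.
apply: open_continuous_measurable_fun; first exact: interval_open.
by move=> x /set_mem /=; rewrite in_itv /= andbT => x0; apply: inv_continuous; rewrite gt_eqF.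
Qed.

Lemma pos_nat_block (R : realType) (p : R) : 0 < p -> exists n : nat, n%:R < p <= n.+1%:R.
Proof.
move=> p0; have ex : exists n : nat, p <= n%:R.
  by exists (Num.bound p); rewrite ltW// archi_boundP// ltW.
case: (ex_minnP ex) => -[|n] np nmin; first by move: np; rewrite leNgt p0.
exists n; rewrite np andbT ltNge; apply/negP => /nmin; by rewrite ltnn.
Qed.

Section Kernel.
Context (R : realType) (X : completeNormedModType R[i]) (T : R -> X -> X) (M : R)
  (hT : bounded_C0 T M) (m : {measure set (measurableTypeR R) -> \bar R}).
Implicit Types (a b c p r s t z : R) (B : set (measurableTypeR R)) (phi : R -> R).

Lemma hpc_ratio c : 0 < c -> hpc T (fun z => c / (z + c)) 1.
Proof.
move=> c0; have := hpcZ hT c (hpc_resolvent hT c0).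
by rewrite gtr0_norm// divff ?gt_eqF.
Qed.

(** With zeta = P/(z+P) and theta = (P-p)/P one has 1 - theta zeta = (z+p)/(z+P): up to the factor
    zeta, the kernel is a geometric series in one symbol of mass 1, for all p <= P at once. At zeta
    = 1 it gives the mass phi/p. *)
Lemma hpc_kernel_bounded B (P : R) phi : measurable B -> 0 < P -> (forall p, B p -> 0 < p <= P) ->
  measurable_fun B (phi : measurableTypeR R -> R) -> (forall p, B p -> 0 <= phi p) ->
  m.-integrable B (EFin \o (fun p => phi p / p)) ->
  hpc T (fun z => \int[m]_(p in B) (phi p / (z + p))) (\int[m]_(p in B) (phi p / p)).
Proof.
move=> mB P0 BP mphi phi0 ip.
have mth : measurable_fun B ((fun p => (P - p) / P) : measurableTypeR R -> R).
  by apply: measurable_funM => //; apply: measurable_funB => //; exact: measurable_id.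
have mphi' : measurable_fun B ((fun p => phi p / P) : measurableTypeR R -> R).
  exact: measurable_funM.
have e p : B p -> (phi p / P) / (1 - (P - p) / P * 1) = phi p / p.
  by move=> /BP/andP[p0 _]; field; rewrite !gt_eqF//; lra.
have h : hpc T (fun z => \int[m]_(p in B) ((phi p / P) / (1 - (P - p) / P * (P / (z + P)))))
    (\int[m]_(p in B) (phi p / p)).
  apply: (hpc_geometric_integral hT mB mphi' mth _ _ (hpc_ratio P0)).
  - by move=> p Bp; rewrite divr_ge0 ?phi0// ltW.
  - move=> p /BP/andP[p0 pP]; rewrite divr_ge0 ?subr_ge0 ?(ltW P0)//=.
    by rewrite ler_pdivrMr// mul1r gerBl ltW.
  - by move=> p /BP/andP[p0 pP]; rewrite mulr1 ltr_pdivrMr// mul1r gtrBl.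
  - by apply: eq_integrable ip => // p /set_mem Bp /=; rewrite e.
  - rewrite le_eqVlt; apply/orP; left; apply/eqP; apply: eq_Rintegral => p /set_mem Bp; exact: e.
have := hpcM hT (hpc_ratio P0) h; rewrite mul1r; apply: hpc_ext => z z0.
have zP : 0 < z + P by rewrite addr_gt0.
have bz p : B p -> (phi p / P) / (1 - (P - p) / P * (P / (z + P))) = (z + P) / P * (phi p / (z + p)).
  move=> /BP/andP[p0 _]; have zp : 0 < z + p by rewrite addr_gt0.
  have -> : 1 - (P - p) / P * (P / (z + P)) = (z + p) / (z + P) by field; rewrite !gt_eqF.
  by field; rewrite !gt_eqF.
have iz : m.-integrable B (EFin \o (fun p => phi p / (z + p))).
  apply: (le_integrable mB _ _ ip).
    apply/measurable_EFinP; apply: measurable_funM => //.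
    apply: measurable_fun_inv_pos => //; last by apply: measurable_funD => //; exact: measurable_id.
    by move=> p /BP/andP[p0 _]; rewrite addr_gt0.
  move=> p Bp /=; have /andP[p0 _] := BP p Bp; have f0 := phi0 p Bp.
  have zp : 0 < z + p by rewrite addr_gt0.
  rewrite lee_fin !ger0_norm; [|exact: divr_ge0 (ltW p0)|exact: divr_ge0 (ltW zp)].
  by rewrite ler_wpM2l// lef_pV2 ?posrE// lerDr (ltW z0).
rewrite (_ : \int[m]_(p in B) _ = \int[m]_(p in B) ((z + P) / P * (phi p / (z + p)))); last first.
  by apply: eq_Rintegral => p /set_mem; exact: bz.
by rewrite RintegralZl// mulrA [X in X * _](_ : _ = 1) ?mul1r//; field; rewrite !gt_eqF.
Qed.

(** The expansion of [hpc_kernel_bounded] requires an upper bound on p, so B is cut along the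
    intervals ]n, n+1]; the masses of the pieces add up to the integral over B. *)
Lemma hpc_kernel B phi : measurable B -> (forall p, B p -> 0 < p) ->
  measurable_fun B (phi : measurableTypeR R -> R) -> (forall p, B p -> 0 <= phi p) ->
  m.-integrable B (EFin \o (fun p => phi p / p)) ->
  hpc T (fun z => \int[m]_(p in B) (phi p / (z + p))) (\int[m]_(p in B) (phi p / p)).
Proof.
move=> mB BP mphi phi0 ip.
pose E_ (n : nat) : set (measurableTypeR R) := B `&` `]n%:R, n.+1%:R]%classic.
have mE n : measurable (E_ n) by apply: measurableI.
have tE : trivIset setT E_.
  apply/trivIsetP => i j _ _ ij; apply/seteqP; split => // p [[_ +] [_ +]].
  rewrite /= !in_itv /= => /andP[i1 i2] /andP[j1 j2].
  have h1 : (i < j.+1)%N by rewrite -(ltr_nat R) (lt_le_trans i1).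
  have h2 : (j < i.+1)%N by rewrite -(ltr_nat R) (lt_le_trans j1).
  by move: ij; rewrite eqn_leq -ltnS h1 -ltnS h2.
have UE : \bigcup_n E_ n = B.
  apply/seteqP; split => [p [n _ []]//|p Bp].
  have [n np] := pos_nat_block (BP p Bp); by exists n => //; split.
have sE n : E_ n `<=` B by move=> p [].
have i' z : 0 <= z -> m.-integrable B (EFin \o (fun p => phi p / (z + p))).
  move=> z0; apply: (le_integrable mB _ _ ip).
    apply/measurable_EFinP; apply: measurable_funM => //.
    apply: measurable_fun_inv_pos => //; last by apply: measurable_funD => //; exact: measurable_id.
    by move=> p /BP p0; rewrite ltr_wpDl.
  move=> p Bp /=; have p0 := BP p Bp; have f0 := phi0 p Bp.
  have zp : 0 < z + p by rewrite ltr_wpDl.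
  rewrite lee_fin !ger0_norm; [|exact: divr_ge0 (ltW p0)|exact: divr_ge0 (ltW zp)].
  by rewrite ler_wpM2l// lef_pV2 ?posrE// lerDr.
have bl n : hpc T (fun z => \int[m]_(p in E_ n) (phi p / (z + p))) (\int[m]_(p in E_ n) (phi p / p)).
  apply: (@hpc_kernel_bounded _ n.+1%:R) => //.
  - by move=> p [Bp]; rewrite /= in_itv /= => /andP[_ ->]; rewrite BP.
  - exact: measurable_funS mphi.
  - by move=> p /sE; exact: phi0.
  - exact: integrableS ip.
have key z : 0 <= z ->
   (fun N => \sum_(k < N) \int[m]_(p in E_ k) (phi p / (z + p))) @ \oo --> \int[m]_(p in B) (phi p / (z + p)) /\
   forall N, \sum_(k < N) \int[m]_(p in E_ k) (phi p / (z + p)) <= \int[m]_(p in B) (phi p / (z + p)).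
  move=> z0; rewrite -UE; apply: Rintegral_bigcup_cvg => //; rewrite UE; last exact: i'.
  by move=> p Bp; rewrite divr_ge0 ?phi0// addr_ge0// ltW// BP.
apply: (hpc_series hT bl _ _).1.
- have [_ h] := key 0 (lexx 0) => N; have := h N.
  under eq_Rintegral do rewrite add0r.
  by under eq_bigr do under eq_Rintegral do rewrite add0r.
- by move=> z z0; exact: (key z (ltW z0)).1.
Qed.

Lemma integrable_kernel B (z : R) : measurable B -> (m B < +oo)%E -> (forall p, B p -> 0 < p) -> 0 < z ->
  m.-integrable B (EFin \o (fun p => (z + p)^-1)).
Proof.
move=> mB fB BP z0; have zp p : B p -> 0 < z + p by move=> /BP p0; rewrite addr_gt0.
apply: (bounded_integrable mB fB (C := z^-1)).
  apply: measurable_fun_inv_pos => //; by apply: measurable_funD => //; exact: measurable_id.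
move=> p Bp; rewrite ger0_norm ?invr_ge0 ?(ltW (zp p Bp))//.
by rewrite lef_pV2 ?posrE ?zp// lerDl ltW// BP.
Qed.

(** Write z/(z+p) = 1 - p/(z+p): the constant and the kernel each have mass m(B). *)
Lemma hpc_kernel_low B : measurable B -> (m B < +oo)%E -> (forall p, B p -> 0 < p) ->
  hpc T (fun z => z * \int[m]_(p in B) (z + p)^-1) (2 * fine (m B)).
Proof.
move=> mB fB BP; have fn : m B \is a fin_num by rewrite ge0_fin_numE.
have fpp p : B p -> p / p = 1 by move=> /BP p0; rewrite divff ?gt_eqF.
have i1 : m.-integrable B (EFin \o (fun=> 1 : R)).
  by apply: (bounded_integrable mB fB (C := 1)) => // p _; rewrite normr1.
have h : hpc T (fun z => \int[m]_(p in B) (p / (z + p))) (fine (m B)).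
  have -> : fine (m B) = \int[m]_(p in B) (p / p).
    transitivity (\int[m]_(p in B) (1 : R)); first by rewrite Rintegral_cst// mul1r.
    by apply: eq_Rintegral => p /set_mem Bp; rewrite fpp.
  apply: hpc_kernel => //.
  - by move=> p /BP/ltW.
  - by apply: eq_integrable i1 => // p /set_mem Bp /=; rewrite fpp.
have := hpcB hT (hpc_cst hT (fine (m B))) h.
rewrite ger0_norm ?fine_ge0// -[fine _ + _]mulr2n -[_ *+ 2]mulr_natl.
apply: hpc_ext => z z0; have iz := integrable_kernel mB fB BP z0.
rewrite -RintegralZl//; apply/esym/eqP; rewrite eq_sym subr_eq; apply/eqP.
have mp : measurable_fun B ((fun p => p / (z + p)) : measurableTypeR R -> R).
  apply: measurable_funM; first exact: measurable_id.
  apply: measurable_fun_inv_pos => //; last by apply: measurable_funD => //; exact: measurable_id.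
  by move=> p /BP p0; rewrite addr_gt0.
rewrite -RintegralD//; last 2 first.
- by have := integrableZl mB z iz; apply: eq_integrable.
- apply: (bounded_integrable mB fB (C := 1)) => // p /BP p0.
  have zp : 0 < z + p by rewrite addr_gt0.
  by rewrite ger0_norm ?divr_ge0 ?(ltW zp) ?(ltW p0)// ler_pdivrMr// mul1r lerDr ltW.
transitivity (\int[m]_(p in B) (1 : R)); first by rewrite Rintegral_cst// mul1r.
apply: eq_Rintegral => p /set_mem/BP p0.
by rewrite -mulrDl divff// gt_eqF// addr_gt0.
Qed.

End Kernel.

Section StieltjesFunction.
Context (R : realType) (mu : {measure set (measurableTypeR R) -> \bar R})
  (hmu : levy_integrable mu).
Implicit Types (a b c p r s t z w : R) (B : set (measurableTypeR R)).
Local Notation Rpos := (`]0%R, +oo[%classic : set (measurableTypeR R)).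

(** The contribution of the part of mu on B to the Stieltjes function [st] with representation (0,
    0, mu). *)
Definition kern B z : R := \int[mu]_(p in B) (z + p)^-1.
Definition st z : R := kern Rpos z.

Lemma mRpos : measurable Rpos. Proof. by []. Qed.

Lemma RposP p : Rpos p <-> 0 < p.
Proof. by rewrite /= in_itv /= andbT. Qed.

Lemma measurable_kern B z : measurable B -> B `<=` Rpos -> 0 <= z ->
  measurable_fun B ((fun p => (z + p)^-1) : measurableTypeR R -> R).
Proof.
move=> mB BP z0; apply: measurable_fun_inv_pos => //.
  by move=> p /BP/RposP p0; rewrite ltr_wpDl.
by apply: measurable_funD => //; exact: measurable_id.
Qed.

Lemma levy_integrable1 : mu.-integrable Rpos (EFin \o (fun p => (1 + p)^-1)).
Proof.
apply/integrableP; split; first by apply/measurable_EFinP; apply: measurable_kern; rewrite ?ler01.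
apply: le_lt_trans hmu; rewrite le_eqVlt; apply/orP; left; apply/eqP.
apply: eq_integral => p /set_mem/RposP p0 /=.
by rewrite ger0_norm// invr_ge0 addr_ge0// ltW.
Qed.

Lemma kern_integrable B z : measurable B -> B `<=` Rpos -> 0 < z ->
  mu.-integrable B (EFin \o (fun p => (z + p)^-1)).
Proof.
move=> mB BP z0; apply: (integrableS mRpos mB BP).
have k0 : 0 < Num.max 1 z^-1 by rewrite lt_max ltr01.
have ik := integrableZl mRpos (Num.max 1 z^-1) levy_integrable1.
apply: (le_integrable mRpos _ _ ik).
  by apply/measurable_EFinP; apply: measurable_kern => //; exact: ltW.
move=> p /RposP p0 /=; have zp : 0 < z + p by rewrite addr_gt0.
have p1 : 0 < 1 + p by rewrite addr_gt0.
rewrite lee_fin gtr0_norm ?invr_gt0// gtr0_norm ?divr_gt0//.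
rewrite ler_pdivlMr// mulrC -ler_pdivlMr ?invr_gt0// invrK.
set k := Num.max _ _; have k1 : 1 <= k by rewrite le_max lexx.
have kz : 1 <= k * z.
  have : z^-1 <= k by rewrite le_max lexx orbT.
  by move=> /(ler_wpM2r (ltW z0)); rewrite mulVf ?gt_eqF.
nra.
Qed.

Lemma mu_bounded B c : measurable B -> (forall p, B p -> 0 < p <= c) -> (mu B < +oo)%E.
Proof.
move=> mB Bc; have BP : B `<=` Rpos by move=> p /Bc/andP[p0 _]; apply/RposP.
have [B0|/set0P[p Bp]] := eqVneq B set0; first by rewrite B0 measure0.
have /andP[p0 pc] := Bc p Bp; have c0 : 0 < c by apply: lt_le_trans pc.
have iB := integrableZl mB (1 + c) (integrableS mRpos mB BP levy_integrable1).
have i1 : mu.-integrable B (EFin \o (fun=> 1 : R)).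
  apply: (le_integrable mB _ _ iB); first exact/measurable_EFinP.
  move=> q Bq /=; have /andP[q0 qc] := Bc q Bq; have q1 : 0 < 1 + q by rewrite addr_gt0.
  rewrite normr1 lee_fin ger0_norm; last by rewrite divr_ge0 ?(ltW q1)// addr_ge0// ltW.
  by rewrite ler_pdivlMr// mul1r lerD2l.
have := integrable_fin_num mB i1; rewrite (_ : (\int[mu]_(x in B) _)%E = mu B).
  by rewrite ge0_fin_numE.
by rewrite -[RHS]mul1e -integral_cst.
Qed.

Lemma kern_ge0 B z : B `<=` Rpos -> 0 <= z -> 0 <= kern B z.
Proof.
move=> BP z0; apply: Rintegral_ge0 => p /BP/RposP p0.
by rewrite invr_ge0 addr_ge0// ltW.
Qed.

Lemma kern_setU B B' z : measurable B -> measurable B' -> B `<=` Rpos -> B' `<=` Rpos ->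
  [disjoint B & B'] -> 0 < z -> kern (B `|` B') z = kern B z + kern B' z.
Proof.
move=> mB mB' BP BP' d z0; rewrite /kern Rintegral_setU//.
apply: kern_integrable => //; first exact: measurableU.
by move=> p [/BP|/BP'].
Qed.

Lemma kern_anti B z w : measurable B -> B `<=` Rpos -> 0 < z -> z <= w -> kern B w <= kern B z.
Proof.
move=> mB BP z0 zw; have w0 : 0 < w by apply: lt_le_trans zw.
apply: le_Rintegral => //; [exact: kern_integrable|exact: kern_integrable|].
by move=> p /BP/RposP p0; rewrite lef_pV2 ?posrE ?addr_gt0// lerD2r.
Qed.

Lemma kern_mul_mono B z w : measurable B -> B `<=` Rpos -> 0 < z -> z <= w ->
  z * kern B z <= w * kern B w.
Proof.
move=> mB BP z0 zw; have w0 : 0 < w by apply: lt_le_trans zw.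
have iz v (v0 : 0 < v) := kern_integrable mB BP v0.
rewrite /kern -!RintegralZl//; [|exact: iz|exact: iz].
apply: le_Rintegral => //.
- by have := integrableZl mB z (iz z z0); apply: eq_integrable.
- by have := integrableZl mB w (iz w w0); apply: eq_integrable.
move=> p /BP/RposP p0; rewrite ler_pdivlMr ?addr_gt0// mulrAC ler_pdivrMr ?addr_gt0//.
nra.
Qed.

Lemma st_ge0 z : 0 <= z -> 0 <= st z.
Proof. exact: kern_ge0. Qed.

Lemma st_anti z w : 0 < z -> z <= w -> st w <= st z.
Proof. exact: kern_anti. Qed.

Lemma st_mul_mono z w : 0 < z -> z <= w -> z * st z <= w * st w.
Proof. exact: kern_mul_mono. Qed.

Lemma st_small e : 0 < e -> exists2 c, 0 < c & st c <= e.
Proof.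
move=> e0.
have h : (fun n : nat => \int[mu]_(p in Rpos) (n.+1%:R + p)^-1) @ \oo --> \int[mu]_(p in Rpos) (0 : R).
  apply: (dominated_cvg_Rintegral mRpos _ levy_integrable1).
  - by move=> n; exact: measurable_kern.
  - move=> n p /RposP p0; rewrite ger0_norm ?invr_ge0 ?addr_ge0// ?(ltW p0)//.
    by rewrite lef_pV2 ?posrE ?addr_gt0// lerD2r ler1n.
  - move=> p /RposP p0; apply/cvgrPdist_le => d d0.
    near=> n; rewrite sub0r normrN ger0_norm ?invr_ge0 ?addr_ge0// ?(ltW p0)//.
    apply: (@le_trans _ _ n.+1%:R^-1); first by rewrite lef_pV2 ?posrE ?addr_gt0// lerDl ltW.
    by apply: ltW; near: n; exact: (near_infty_natSinv_lt (PosNum d0)).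
rewrite Rintegral_cst// mul0r in h.
move: h => /cvgrPdist_le h; have h' := h e e0.
have [n _ hn] := h'; exists n.+1%:R => //.
by have := hn n (leqnn n); rewrite /= sub0r normrN; apply: le_trans; exact: ler_norm.
Unshelve. all: by end_near.
Qed.

Hypothesis st_oo : st s @[s --> 0^'+] --> +oo.

Lemma st_gt0 z : 0 < z -> 0 < st z.
Proof.
move=> z0.
have [w w0 sw] : exists2 w, 0 < w & 1 <= st w.
  have /cvgryPge h := st_oo; have h1 := h 1.
  near (0:R)^'+ => w; exists w => //; near: w; exact: h1.
have [zw|wz] := leP z w.
  by apply: lt_le_trans (st_anti z0 zw); apply: lt_le_trans sw.
have := st_mul_mono w0 (ltW wz); rewrite -(pmulr_rgt0 _ z0).
by apply: lt_le_trans; rewrite mulr_gt0//; apply: lt_le_trans sw.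
Unshelve. all: by end_near.
Qed.

End StieltjesFunction.

(** * Bounds for s/(g+s) uniform in s *)

Section Psi.
Context (R : realType) (X : completeNormedModType R[i]) (T : R -> X -> X) (M : R)
  (hT : bounded_C0 T M) (mu : {measure set (measurableTypeR R) -> \bar R})
  (hmu : levy_integrable mu).
Implicit Types (a b c p r s t z w : R) (B : set (measurableTypeR R)).
Local Notation Rpos := (`]0%R, +oo[%classic : set (measurableTypeR R)).

Section Low.
(** The constant 12 serves twice: it makes the first moment below c/2 at most 1/8, and it makes the
    part of mu above c/2 a perturbation of mass 1/2 in [hpc_psi]. *)
Variables (c s : R) (c0 : 0 < c) (s0 : 0 < s) (cs : st mu c <= s / 12).
Let B : set (measurableTypeR R) := `]0%R, c / 2[%classic.

Let mB : measurable B. Proof. exact: measurable_itv. Qed.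

Let BP p : B p -> 0 < p < c / 2. Proof. by rewrite /B /= in_itv. Qed.

Let BR : B `<=` Rpos. Proof. by move=> p /BP/andP[p0 _]; apply/RposP. Qed.

Let fB : (mu B < +oo)%E.
Proof. by apply: (mu_bounded hmu (c := c / 2) mB) => p /BP/andP[-> /ltW]. Qed.

(** Moments of the image of mu under 1 - p/c, which lies in [1/2, 1] on B: they are nonincreasing
    and log-convex, and their first ratio is at least 1/2. *)
Let mom n : R := \int[mu]_(p in B) (1 - p / c) ^+ n.

Let x01 p : B p -> 1 / 2 <= 1 - p / c <= 1.
Proof.
move=> /BP/andP[p0 pc]; have h1 : 0 <= p / c by rewrite divr_ge0 ?ltW.
have h2 : p / c <= 1 / 2 by rewrite ler_pdivrMr//; lra.
by apply/andP; split; lra.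
Qed.

Let mx n : measurable_fun B ((fun p => (1 - p / c) ^+ n) : measurableTypeR R -> R).
Proof.
apply: measurable_funX; apply: measurable_funB => //; apply: measurable_funM => //.
Qed.

Let ix n : mu.-integrable B (EFin \o (fun p => (1 - p / c) ^+ n)).
Proof.
apply: (bounded_integrable mB fB (C := 1) (mx n)) => p /x01/andP[h1 h2].
rewrite ger0_norm ?exprn_ge0//; last lra.
by apply: exprn_ile1 => //; lra.
Qed.

Let mom_ge n : (1 / 2) ^+ n * fine (mu B) <= mom n.
Proof.
rewrite -(Rintegral_cst mu mB); apply: le_Rintegral => //.
  by apply: (bounded_integrable mB fB (C := (1/2) ^+ n)) => // p _; rewrite ger0_norm ?exprn_ge0.
by move=> p /x01/andP[h1 h2]; apply: lerXn2r; rewrite ?nnegrE//; lra.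
Qed.

Let mom0E : mom 0 = fine (mu B).
Proof.
rewrite -[RHS]mul1r -(Rintegral_cst mu mB) /mom.
by apply: eq_Rintegral => p _; rewrite expr0.
Qed.

(** On B one has c + p <= 3c/2, so mu(B) <= (3c/2) g(c) <= (3c/2)(s/12) = c s / 8. *)
Let mom0_le : mom 0 / (c * s) <= 1 / 8.
Proof.
have h : (3 / 2 * c)^-1 * fine (mu B) <= st mu c.
  have d : [disjoint B & (`[c / 2, +oo[%classic : set (measurableTypeR R))].
    apply/disj_setPS => p [/BP/andP[_ p1]] /=; rewrite in_itv /= andbT => p2; lra.
  have R' : (`[c / 2, +oo[%classic : set (measurableTypeR R)) `<=` Rpos.
    move=> p /=; rewrite !in_itv /= !andbT => h; apply: lt_le_trans h; exact: divr_gt0.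
  rewrite /st (_ : Rpos = B `|` `[c / 2, +oo[%classic); last first.
    apply/seteqP; split => [p /RposP p0|p [/BR//|/R'//]].
    have [pc|pc] := ltP p (c / 2); [left|right]; rewrite /B /= in_itv /= ?p0 ?pc//.
  rewrite kern_setU//; apply: (@le_trans _ _ (kern mu B c)); last by rewrite lerDl kern_ge0// ltW.
  rewrite -(Rintegral_cst mu mB); apply: le_Rintegral => //.
  - by apply: (bounded_integrable mB fB (C := (3/2 * c)^-1)) => // p _; rewrite ger0_norm// invr_ge0 mulr_ge0 ?(ltW c0).
  - exact: kern_integrable.
  - by move=> p /BP/andP[p0 p1]; rewrite lef_pV2 ?posrE ?mulr_gt0 ?addr_gt0//; lra.
rewrite ler_pdivrMr ?mulr_gt0// mom0E.
have h2 := le_trans h cs.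
have : fine (mu B) <= (3 / 2 * c) * (s / 12).
  by rewrite -ler_pdivrMl ?mulr_gt0.
lra.
Qed.

Let mom_ge0 n : 0 <= mom n.
Proof. by apply: le_trans (mom_ge n); rewrite mulr_ge0 ?exprn_ge0 ?fine_ge0. Qed.

Let mom_ni n : mom n.+1 <= mom n.
Proof.
apply: le_Rintegral => // p /x01/andP[h1 h2]; rewrite exprS ler_piMl// exprn_ge0//; lra.
Qed.

(** Cauchy-Schwarz by the discriminant: with y = 1 - p/c, the quadratic in t is the integral of y^n
    (y - t)^2. It is evaluated at its minimum, the case of a vanishing moment being separate. *)
Let mom_lc n : mom n.+1 ^+ 2 <= mom n * mom n.+2.
Proof.
have q t : 0 <= mom n.+2 - 2 * t * mom n.+1 + t ^+ 2 * mom n.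
  have iZ k l : mu.-integrable B (EFin \o (fun p => k * (1 - p / c) ^+ l)).
    by have := integrableZl mB k (ix l); apply: eq_integrable.
  rewrite /mom -!RintegralZl// -RintegralB// -RintegralD//; last first.
    by have := integrableB mB (ix n.+2) (iZ (2 * t) n.+1); apply: eq_integrable.
  apply: Rintegral_ge0 => p /x01/andP[h1 h2].
  have -> : (1 - p / c) ^+ n.+2 - 2 * t * (1 - p / c) ^+ n.+1 + t ^+ 2 * (1 - p / c) ^+ n =
    (1 - p / c) ^+ n * (1 - p / c - t) ^+ 2 by rewrite !exprS; ring.
  by rewrite mulr_ge0 ?sqr_ge0// exprn_ge0//; lra.
have [m0|mn0] := eqVneq (mom n) 0.
  have : mom n.+1 = 0 by apply/eqP; rewrite eq_le mom_ge0 andbT -m0.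
  by move=> ->; rewrite m0 mul0r expr0n.
have m0 : 0 < mom n by rewrite lt0r mn0 mom_ge0.
have := q (mom n.+1 / mom n); rewrite -(pmulr_rge0 _ m0).
have -> : mom n * (mom n.+2 - 2 * (mom n.+1 / mom n) * mom n.+1 + (mom n.+1 / mom n) ^+ 2 * mom n) =
  mom n * mom n.+2 - mom n.+1 ^+ 2 by field.
by rewrite subr_ge0.
Qed.

Let mom_half : mom 0 / 2 <= mom 1.
Proof. by have := mom_ge 1; rewrite expr1 mom0E mulrC div1r. Qed.

Let zeta z := c / (z + c).

(** From z + p = (z + c)(1 - zeta (1 - p/c)), a geometric series in zeta whose partial sums are
    dominated by (z+p)^-1. *)
Let mom_series z : 0 < z ->
  (fun N => \sum_(n < N) mom n / c * zeta z ^+ n.+1) @ \oo --> kern mu B z.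
Proof.
move=> z0.
have ze0 : 0 < zeta z by rewrite divr_gt0// addr_gt0.
have ze1 : zeta z < 1 by rewrite ltr_pdivrMr ?addr_gt0// mul1r ltrDr.
have -> : (fun N => \sum_(n < N) mom n / c * zeta z ^+ n.+1) =
    (fun N => \int[mu]_(p in B) \sum_(n < N) (zeta z / c * zeta z ^+ n) * (1 - p / c) ^+ n).
  apply/funext => N; rewrite (Rintegral_sum mB (u := fun n p => (zeta z / c * zeta z ^+ n) * (1 - p / c) ^+ n)).
    by apply: eq_bigr => n _; rewrite RintegralZl// -/(mom n) exprS; field; rewrite gt_eqF.
  by move=> n; have := integrableZl mB (zeta z / c * zeta z ^+ n) (ix n); apply: eq_integrable.
have eE p : B p -> forall N, \sum_(n < N) (zeta z / c * zeta z ^+ n) * (1 - p / c) ^+ n =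
    zeta z / c * \sum_(n < N) (zeta z * (1 - p / c)) ^+ n.
  move=> _ N; rewrite mulr_sumr; apply: eq_bigr => n _; move: (zeta z) (1 - p / c) => y w.
  by rewrite exprMn mulrA.
have q1 p : B p -> 0 <= zeta z * (1 - p / c) < 1.
  move=> /x01/andP[h1 h2]; rewrite mulr_ge0 ?(ltW ze0)//=; last lra.
  by apply: le_lt_trans ze1; rewrite ler_piMr// ltW.
have lE p : B p -> zeta z / c * (1 - zeta z * (1 - p / c))^-1 = (z + p)^-1.
  move=> /BP/andP[p0 _]; rewrite /zeta.
  have -> : 1 - c / (z + c) * (1 - p / c) = (z + p) / (z + c) by field; rewrite !gt_eqF ?addr_gt0.
  by field; rewrite !gt_eqF ?addr_gt0.
apply: (dominated_cvg_Rintegral mB _ (kern_integrable hmu mB BR z0)).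
- by move=> N; apply: measurable_sum => n; apply: measurable_funM => //; exact: mx.
- move=> N p Bp; rewrite eE// -lE//.
  have hz : 0 <= zeta z / c := divr_ge0 (ltW ze0) (ltW c0).
  have := q1 p Bp; move: (zeta z / c) (zeta z * (1 - p / c)) hz => w y hz /andP[y0 y1].
  rewrite ger0_norm; last by apply: mulr_ge0 => //; apply: sumr_ge0 => n _; exact: exprn_ge0.
  rewrite ler_wpM2l// sum_geometric ?lt_eqF//.
  by rewrite ler_pdivrMr ?subr_gt0// mulVf ?subr_eq0 ?gt_eqF// gerBl exprn_ge0.
- move=> p Bp; rewrite -lE//.
  have -> : (fun N => \sum_(n < N) (zeta z / c * zeta z ^+ n) * (1 - p / c) ^+ n) =
      (fun N => zeta z / c * \sum_(n < N) (zeta z * (1 - p / c)) ^+ n).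
    by apply/funext => N; exact: eE.
  have /andP[q0 q1'] := q1 p Bp.
  have h : `|zeta z * (1 - p / c)| < 1 by rewrite ger0_norm.
  exact: cvgMl_tmp (cvg_geometric_sum h).
Qed.

(** Kaluza's theorem for 1 followed by the moments divided by c s: the inverse is 1 - P(zeta) with P
    of mass at most 1, whence the 2. *)
Lemma hpc_psi_low : hpc T (fun z => (1 + kern mu B z / s)^-1) 2.
Proof.
have cs0 : 0 < c * s by rewrite mulr_gt0.
(* Kaluza's theorem divides by the terms of the sequence, so the case of no mass below c/2 is
   treated apart. *)
have [m0|mn0] := eqVneq (fine (mu B)) 0.
  have k0 z : 0 < z -> kern mu B z = 0.
    move=> z0; apply/eqP; rewrite eq_le kern_ge0 ?(ltW z0)// andbT.
    have -> : 0 = z^-1 * fine (mu B) by rewrite m0 mulr0.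
    rewrite -(Rintegral_cst mu mB); apply: le_Rintegral => //.
    - exact: kern_integrable.
    - by apply: (bounded_integrable mB fB (C := z^-1)) => // p _; rewrite ger0_norm// invr_ge0 ltW.
    - by move=> p /BP/andP[p0 p1]; rewrite lef_pV2 ?posrE ?addr_gt0// lerDl ltW.
  have h : hpc T (fun=> 1) 2 by apply: hpcW (hpc1 hT).1; rewrite ler1n.
  by apply: hpc_ext h => z z0; rewrite k0// mul0r addr0 invr1.
have mB0 : 0 < fine (mu B) by rewrite lt0r mn0 fine_ge0.
pose u n := if n is n'.+1 then mom n' / (c * s) else 1.
have momp n : 0 < mom n by apply: lt_le_trans (mom_ge n); rewrite mulr_gt0// exprn_gt0.
have upos n : 0 < u n by case: n => [|n] //=; rewrite divr_gt0.
(* Only the first inequality involves the prepended 1: it asks that the zeroth moment squared be at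
   most c s times the first one, and follows from the bounds 1/8 and 1/2. The others are
   log-convexity of the moments. *)
have ulc n : u n.+1 ^+ 2 <= u n * u n.+2.
  case: n => [|n] /=.
    rewrite mul1r expr2; apply: (@le_trans _ _ (mom 0 / (c * s) * (1 / 8))).
      by rewrite ler_pM2l ?mom0_le// divr_gt0.
    rewrite mulrAC ler_pM2r ?invr_gt0//; have := mom_half; have := momp 0%N; lra.
  rewrite mulrACA exprMn -!expr2 ler_pM2r ?exprn_gt0 ?invr_gt0//; exact: mom_lc.
have uni n : u n.+1 <= u n.
  case: n => [|n] /=; first by have := mom0_le; lra.
  by rewrite ler_pM2r ?invr_gt0// mom_ni.
have U z : 0 < z -> (fun N => \sum_(n < N) u n * zeta z ^+ n) @ \oo --> 1 + kern mu B z / s.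
  move=> z0; rewrite -(cvg_shiftS (fun N => \sum_(n < N) u n * zeta z ^+ n)) /=.
  have -> : (fun N => \sum_(n < N.+1) u n * zeta z ^+ n) =
      (fun N => 1 + (\sum_(n < N) mom n / c * zeta z ^+ n.+1) * s^-1).
    apply/funext => N; rewrite big_ord_recl /= expr0 mulr1 mulr_suml; congr (_ + _).
    apply: eq_bigr => n _; rewrite /bump /= add1n; field; rewrite !gt_eqF//.
  have h1 : (fun N => (\sum_(n < N) mom n / c * zeta z ^+ n.+1) * s^-1) @ \oo --> kern mu B z * s^-1.
    exact: cvgMr_tmp (mom_series z0).
  have h2 : (fun _ : nat => 1 : R) @ \oo --> (1 : R) by exact: cvg_cst.
  exact: cvgD h2 h1.
have ri z : 0 < z -> (fun N => \sum_(n < N) renewal u n * zeta z ^+ n.+1) @ \oo --> 1 - (1 + kern mu B z / s)^-1.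
  move=> z0; apply: (renewal_inv _ upos ulc uni _ (U z z0)) => //.
  by rewrite divr_ge0 ?ltr_pdivrMr ?mul1r ?ltrDr ?(ltW c0) ?addr_ge0 ?addr_gt0 ?(ltW z0) ?(ltW c0).
have hr n : hpc T (fun z => renewal u n * zeta z ^+ n.+1) (renewal u n).
  have r0 := renewal_ge0 (erefl _ : u 0%N = 1) upos ulc n.
  have := hpcZ hT (renewal u n) (hpcX hT n.+1 (hpc_ratio hT c0)).
  by rewrite expr1n mulr1 ger0_norm.
have sr N : \sum_(n < N) renewal u n <= 1 by exact: sum_renewal_le1.
have [h _] := hpc_series hT hr sr ri.
have := hpcB hT (hpc1 hT).1 h; rewrite -[1 + 1]/(2 : R).
by apply: hpc_ext => z z0; rewrite opprB addrCA subrr addr0.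
Qed.

End Low.

(** For p >= c/2 one has c + p <= 3p, so the mass, the integral of 1/p, is at most three times the
    kernel at c. *)
Lemma hpc_kern_ge B c : measurable B -> 0 < c -> (forall p, B p -> c / 2 <= p) ->
  hpc T (kern mu B) (3 * kern mu B c).
Proof.
move=> mB c0 Bc; have c2 : 0 < c / 2 by exact: divr_gt0.
have BR : B `<=` Rpos by move=> p /Bc cp; apply/RposP; exact: lt_le_trans cp.
have m1 : measurable_fun B ((fun=> 1) : measurableTypeR R -> R) by [].
have mi : measurable_fun B ((fun p => 1 / p) : measurableTypeR R -> R).
  apply: measurable_funM => //; apply: measurable_fun_inv_pos; [exact: mB|by move=> p /BR/RposP|exact: measurable_id].
have ik := kern_integrable hmu mB BR c0.
have ik3 : mu.-integrable B (EFin \o (fun p => 3 * (c + p)^-1)).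
  by have := integrableZl mB 3 ik; apply: eq_integrable.
have le3 p : B p -> 1 / p <= 3 * (c + p)^-1.
  move=> /Bc cp; have p0 : 0 < p by exact: lt_le_trans cp.
  have cp0 : 0 < c + p by rewrite addr_gt0.
  rewrite ler_pdivrMr// mulrAC ler_pdivlMr//; lra.
have ip : mu.-integrable B (EFin \o (fun p => 1 / p)).
  apply: (le_integrable mB _ _ ik3); first exact/measurable_EFinP.
  move=> p Bp /=; have p0 : 0 < p by apply/RposP/BR.
  have cp0 : 0 < c + p by rewrite addr_gt0.
  by rewrite lee_fin gtr0_norm ?divr_gt0// gtr0_norm ?mulr_gt0 ?invr_gt0// le3.
have := hpc_kernel hT mB (fun p Bp => iffLR (RposP p) (BR p Bp)) m1 (fun _ _ => ler01) ip.
move=> h; apply: (hpcW _ (hpc_ext _ h)).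
  by rewrite /kern -RintegralZl//; apply: le_Rintegral.
by move=> z z0; apply: eq_Rintegral => p _; rewrite mul1r.
Qed.

Lemma Rpos_split c : 0 < c -> [/\ (`]0%R, c[%classic : set (measurableTypeR R)) `|` `[c, +oo[%classic = Rpos,
  (`]0%R, c[%classic : set (measurableTypeR R)) `<=` Rpos, (`[c, +oo[%classic : set (measurableTypeR R)) `<=` Rpos &
  [disjoint (`]0%R, c[%classic : set (measurableTypeR R)) & `[c, +oo[%classic]].
Proof.
move=> c0.
have l1 : (`]0%R, c[%classic : set (measurableTypeR R)) `<=` Rpos.
  by move=> p /=; rewrite !in_itv /= andbT => /andP[].
have l2 : (`[c, +oo[%classic : set (measurableTypeR R)) `<=` Rpos.
  by move=> p /=; rewrite !in_itv /= !andbT; exact: lt_le_trans.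
split=> //.
- apply/seteqP; split => [p [/l1//|/l2//]|p /RposP p0].
  by have [pc|pc] := ltP p c; [left|right]; rewrite /= in_itv /= ?p0 ?pc.
- apply/disj_setPS => p [] /=; rewrite !in_itv /= andbT => /andP[_ p1].
  by rewrite leNgt p1.
Qed.

Lemma st_split c z : 0 < c -> 0 < z ->
  st mu z = kern mu `]0%R, c[ z + kern mu `[c, +oo[ z.
Proof.
by move=> c0 z0; have [e h1 h2 d] := Rpos_split c0; rewrite -kern_setU// e.
Qed.

(** With a and b the kernels of mu below and above c/2, 1 + (a+b)/s = (1 + a/s)(1 + (b/s)/(1 +
    a/s)). The first factor has an inverse of mass 2 by [hpc_psi_low]; b has mass at most 3 g(c) <=
    s/4, so the perturbation has mass 1/2, and its Neumann series contributes another factor 2. *)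
Lemma hpc_psi s : 0 < s -> hpc T (fun z => s / (st mu z + s)) 4.
Proof.
move=> s0; have s12 : 0 < s / 12 by exact: divr_gt0.
have [c c0 cs] := st_small hmu s12; have c2 : 0 < c / 2 by exact: divr_gt0.
have hl := hpc_psi_low c0 s0 cs.
have mH : measurable (`[c / 2, +oo[%classic : set (measurableTypeR R)) by [].
have hh : hpc T (kern mu `[c / 2, +oo[) (s / 4).
  apply: hpcW (hpc_kern_ge mH c0 _); last by move=> p /=; rewrite in_itv /= andbT.
  have := st_split c2 c0; have [_ h1 _ _] := Rpos_split c2.
  have := kern_ge0 mu h1 (ltW c0); move: cs; lra.
have hm : hpc T (fun z => - (s^-1 * ((1 + kern mu `]0%R, c / 2[ z / s)^-1 * kern mu `[c / 2, +oo[ z))) (1 / 2).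
  apply: hpcN; have := hpcZ hT s^-1 (hpcM hT hl hh).
  by rewrite gtr0_norm ?invr_gt0// [X in hpc _ _ X](_ : _ = 1 / 2)//; field; rewrite gt_eqF.
have hn : 1 / 2 < 1 :> R by lra.
have := hpcM hT hl (hpc_neumann hT hn hm).
rewrite [X in hpc _ _ X](_ : _ = 4); last by field.
apply: hpc_ext => z z0; rewrite (st_split c2 z0).
have [_ h1 h2 _] := Rpos_split c2.
have k1 := kern_ge0 mu h1 (ltW z0); have k2 := kern_ge0 mu h2 (ltW z0).
move: (kern mu `]0%R, c / 2[ z) (kern mu `[c / 2, +oo[ z) k1 k2 => a b a0 b0.
have sa : 0 < s + a by rewrite ltr_wpDr.
have sab : 0 < s + a + b by rewrite ltr_wpDr.
by field; rewrite !gt_eqF//; lra.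
Qed.

End Psi.

(** * Decay along the orbit *)

Section OrbitBounds.
Context (R : realType) (X : completeNormedModType R[i]) (T : R -> X -> X) (M : R)
  (hT : bounded_C0 T M) (mu : {measure set (measurableTypeR R) -> \bar R})
  (hmu : levy_integrable mu) (st_oo : st mu s @[s --> 0^'+] --> +oo).
Implicit Types (a b c p r s t z w : R) (B : set (measurableTypeR R)) (x : X).
Local Notation Rpos := (`]0%R, +oo[%classic : set (measurableTypeR R)).

(** The function t/g(1/t) lies below an affine function with slope 1/g(p) and constant 1/(p g(p)):
    for t p <= 1 because z g(z) is nondecreasing, for t p > 1 because g is nonincreasing. This is
    the form of bound taken by [resolvent_bound], and both resulting terms equal 1/(p g(p)). *)
Lemma resolvent_decay x :
  (exists K : R, \forall t \near +oo, rnorm (cesaro_mean T t x) <= K * (st mu (t^-1))^-1) ->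
  exists2 C, 0 <= C & forall p, 0 < p <= 1 -> rnorm (op T (fun z => (z + p)^-1) x) <= C / (p * st mu p).
Proof.
move=> [K [t0 [_ ht0]]]; have gp p := st_gt0 hmu st_oo (z := p).
pose t1 := Num.max 1 (t0 + 1); have t1_1 : 1 <= t1 by rewrite le_max lexx.
have t10 : 0 < t1 by apply: lt_le_trans t1_1.
have M0 := M0 hT; have nx := rnorm_ge0 x.
have hI t : t1 <= t -> rnorm (integrated T t x) <= `|K| * (t / st mu (t^-1)).
  move=> tt; have t_gt0 : 0 < t by apply: lt_le_trans tt.
  have tt0 : t0 < t by apply: lt_le_trans tt; rewrite lt_max ltrDl ltr01 orbT.
  have := ht0 t tt0; rewrite /cesaro_mean -/(integrated T t x) rnormZ gtr0_norm ?invr_gt0//.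
  rewrite ler_pdivrMl// => /le_trans; apply; rewrite mulrCA.
  by apply: ler_wpM2r; [rewrite divr_ge0 ?ltW ?gp ?invr_gt0|exact: ler_norm].
have hM t : 0 < t -> rnorm (integrated T t x) <= M * t * rnorm x.
  by move=> t_gt0; have [h <-] := pcalc_hpc hT (pcalc_integrated hT t_gt0); exact: op_norm.
(* The second term covers t < t1, where only the trivial bound M t |x| is available; it is absorbed
   through p g(p) <= g(1) for p <= 1. *)
pose C := `|K| + M * t1 * rnorm x * st mu 1.
have C1 : 0 <= M * t1 * rnorm x * st mu 1 by rewrite !mulr_ge0// ?(ltW t10) ?(ltW (gp _ _)).
have C0 : 0 <= C by rewrite addr_ge0.
exists (2 * C); first by rewrite mulr_ge0.
move=> p /andP[p0 p1]; have g0 := gp p p0.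
have -> : 2 * C / (p * st mu p) = C / st mu p / p + C / (p * st mu p) by field; rewrite !gt_eqF.
apply: (resolvent_bound hT p0); first by rewrite divr_ge0// ltW.
move=> t t_gt0.
have pg0 : 0 < p * st mu p by rewrite mulr_gt0.
have it0 : 0 < t^-1 by rewrite invr_gt0.
have gt0 := gp _ it0.
have [tt|tt] := leP t1 t.
  apply: (le_trans (hI t tt)).
  apply: (@le_trans _ _ (C * (t / st mu t^-1))).
    by rewrite ler_wpM2r ?divr_ge0 ?(ltW t_gt0) ?(ltW gt0)// lerDl.
  have [pt|tp] := leP p t^-1.
    apply: (@le_trans _ _ (C / (p * st mu p))); last first.
      by rewrite lerDr mulr_ge0 ?(ltW t_gt0)// divr_ge0// ltW.
    rewrite ler_wpM2l// ler_pdivrMr// mulrC ler_pdivlMr// -ler_pdivlMl//.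
    exact: st_mul_mono.
  apply: (@le_trans _ _ (C / st mu p * t)); last by rewrite lerDl divr_ge0// ltW.
  rewrite -mulrA ler_wpM2l// mulrC ler_wpM2r ?(ltW t_gt0)//.
  by rewrite lef_pV2 ?posrE// st_anti// ltW.
apply: (@le_trans _ _ (C / (p * st mu p))); last first.
  by rewrite lerDr mulr_ge0 ?(ltW t_gt0)// divr_ge0// ltW.
apply: (le_trans (hM t t_gt0)); rewrite ler_pdivlMr//.
apply: (@le_trans _ _ (M * t1 * rnorm x * st mu 1)); last by rewrite lerDr.
apply: ler_pM; [by rewrite !mulr_ge0// ltW|exact: ltW| |].
  by rewrite ler_wpM2r// ler_wpM2l// ltW.
by rewrite -[leRHS]mul1r st_mul_mono.
Qed.

Section Decay.
Variables (x : X) (C : R) (C0 : 0 <= C)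
  (hC : forall p, 0 < p <= 1 -> rnorm (op T (fun z => (z + p)^-1) x) <= C / (p * st mu p)).

(* The block lies below P, so its kernel is the resolvent at P times a bounded symbol. *)
Lemma kern_block_bound (P r : R) B : 0 < r -> 0 < P <= 1 -> measurable B ->
  (forall p, B p -> P / 2 <= p <= P) ->
  hpc T (fun z => z / (z + r) * kern mu B z) (4 * fine (mu B) / P) /\
  rnorm (op T (fun z => z / (z + r) * kern mu B z) x) <= M * (4 * fine (mu B)) * (C / (P * st mu P)).
Proof.
move=> r0 /andP[P0 P1] mB BP; have p0 p : B p -> 0 < p.
  by move=> /BP/andP[+ _]; apply: lt_le_trans; exact: divr_gt0.
have fB : (mu B < +oo)%E.
  by apply: (mu_bounded hmu (c := P) mB) => p Bp; rewrite p0//; case/andP: (BP p Bp).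
have BR : B `<=` Rpos by move=> p /p0 pp; apply/RposP.
have mphi : measurable_fun B ((fun p => P - p) : measurableTypeR R -> R).
  by apply: measurable_funB => //; exact: measurable_id.
have phi0 p : B p -> 0 <= P - p by move=> /BP/andP[_ pP]; rewrite subr_ge0.
have phi1 p : B p -> (P - p) / p <= 1.
  by move=> Bp; have /andP[h1 h2] := BP p Bp; rewrite ler_pdivrMr ?p0//; lra.
have ip : mu.-integrable B (EFin \o (fun p => (P - p) / p)).
  apply: (bounded_integrable mB fB (C := 1)).
    by apply: measurable_funM => //; apply: measurable_fun_inv_pos => //; exact: measurable_id.
  by move=> p Bp; rewrite ger0_norm ?phi1// divr_ge0 ?phi0// ltW// p0.
have h1 : hpc T (fun z => \int[mu]_(p in B) ((P - p) / (z + p))) (fine (mu B)).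
  apply: hpcW (hpc_kernel hT mB p0 mphi phi0 ip).
  rewrite -[leRHS]mul1r -(Rintegral_cst mu mB); apply: le_Rintegral => //.
  by apply: (bounded_integrable mB fB (C := 1)) => // p _; rewrite normr1.
have h2 : hpc T (fun z => fine (mu B) + \int[mu]_(p in B) ((P - p) / (z + p))) (2 * fine (mu B)).
  have := hpcD hT (hpc_cst hT (fine (mu B))) h1.
  by rewrite ger0_norm ?fine_ge0// -[fine _ + _]mulr2n -[_ *+ 2]mulr_natl.
have h3 := hpcM hT (hpc_resolvent_compl hT r0) h2.
have h4 := hpc_resolvent hT P0.
(* This is (z+P)/(z+p) = 1 + (P-p)/(z+p) integrated over B; the second term has mass at most 1 per
   unit of mu because p >= P/2. *)
have e z : 0 < z -> z / (z + r) * (fine (mu B) + \int[mu]_(p in B) ((P - p) / (z + p))) * (z + P)^-1 =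
    z / (z + r) * kern mu B z.
  move=> z0; rewrite -mulrA; congr (_ * _).
  have iz := kern_integrable hmu mB BR z0.
  have zP : 0 < z + P by rewrite addr_gt0.
  apply: (mulIf (lt0r_neq0 zP)); rewrite divfK ?gt_eqF// mulrC -RintegralZl//.
  rewrite -[X in X + _]mul1r -(Rintegral_cst mu mB) -RintegralD//; last 2 first.
  - by apply: (bounded_integrable mB fB (C := 1)) => // p _; rewrite normr1.
  - apply: (bounded_integrable mB fB (C := 1)).
      by apply: measurable_funM => //; apply: measurable_kern => //; exact: ltW.
    move=> p Bp; have pp := p0 p Bp; have zp : 0 < z + p by rewrite addr_gt0.
    rewrite ger0_norm ?divr_ge0 ?phi0 ?(ltW zp)//; apply: le_trans (phi1 p Bp).
    by rewrite ler_wpM2l ?phi0// lef_pV2 ?posrE// lerDr ltW.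
  apply: eq_Rintegral => p /set_mem Bp; have pp := p0 p Bp.
  by field; rewrite gt_eqF// addr_gt0.
split.
  have := hpcM hT h3 h4; rewrite [X in hpc _ _ X](_ : _ = 4 * fine (mu B) / P); last by ring.
  exact: hpc_ext.
rewrite -(op_ext _ _ e) (opM hT x h3 h4); apply: (le_trans (op_norm hT _ h3)).
have -> : 2 * (2 * fine (mu B)) = 4 * fine (mu B) by ring.
rewrite ler_wpM2l ?mulr_ge0 ?(M0 hT) ?fine_ge0//.
by apply: hC; rewrite P0.
Qed.

(** 1 - a/b <= ln (b/a), and b <= 2a exchanges the denominator b for a at the cost of a factor 2. *)
Lemma ln_sub_ge a b : 0 < a -> a <= b -> b <= 2 * a -> (b - a) / a <= 2 * (ln b - ln a).
Proof.
move=> a0 ab b2; have b0 : 0 < b by apply: lt_le_trans ab.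
have h := expR_ge1Dx (ln a - ln b); rewrite expRD expRN !lnK ?posrE// in h.
have h1 : (b - a) / b <= ln b - ln a.
  by rewrite mulrBl divff ?gt_eqF//; lra.
apply: (@le_trans _ _ (2 * ((b - a) / b))); last by rewrite ler_wpM2l.
rewrite ler_pdivrMr// mulrA mulrAC ler_pdivlMr//; nra.
Qed.

(** For p in the block, 1/(P/2+p) - 1/(P+p) is at least (P/2) / ((3P/2)(2P)) = 1/(6P), and the rest
    of mu contributes a nonnegative amount to the increment of g. Bounding a mass by an increment of
    g is what lets the blocks telescope. *)
Lemma mu_block_le (P : R) : 0 < P ->
  fine (mu `[P / 2, P[%classic) <= 6 * P * (st mu (P / 2) - st mu P).
Proof.
move=> P0; have P2 : 0 < P / 2 by exact: divr_gt0.
pose B : set (measurableTypeR R) := `[P / 2, P[%classic.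
have mB : measurable B by exact: measurable_itv.
have BP p : B p -> P / 2 <= p < P by rewrite /B /= in_itv.
have BR : B `<=` Rpos by move=> p /BP/andP[p1 _]; apply/RposP; exact: lt_le_trans p1.
have fB : (mu B < +oo)%E.
  apply: (mu_bounded hmu (c := P) mB) => p /BP/andP[p1 p2].
  by rewrite (lt_le_trans P2 p1) ltW.
have mC : measurable (Rpos `\` B) by apply: measurableD.
have CR : Rpos `\` B `<=` Rpos by move=> p [].
have d : [disjoint B & Rpos `\` B] by apply/disj_setPS => p [? [_]].
have sE z : 0 < z -> st mu z = kern mu B z + kern mu (Rpos `\` B) z.
  by move=> z0; rewrite -kern_setU// setDUK.
have PP : P / 2 <= P by rewrite ler_pdivrMr//; lra.
have h1 := kern_anti hmu mC CR P2 PP.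
rewrite !sE//.
suff : fine (mu B) <= 6 * P * (kern mu B (P / 2) - kern mu B P).
  move=> h; apply: (le_trans h); rewrite ler_wpM2l ?mulr_ge0 ?(ltW P0)//; lra.
have i1 := kern_integrable hmu mB BR P2; have i2 := kern_integrable hmu mB BR P0.
rewrite /kern -RintegralB// -ler_pdivrMl ?mulr_gt0//.
rewrite -(Rintegral_cst mu mB); apply: le_Rintegral => //.
- by apply: (bounded_integrable mB fB (C := (6 * P)^-1)) => // p _; rewrite ger0_norm// invr_ge0 mulr_ge0// ltW.
- by have := integrableB mB i1 i2; apply: eq_integrable.
move=> p /BP/andP[p1 p2]; have p0 : 0 < p by apply: lt_le_trans p1.
have -> : (P / 2 + p)^-1 - (P + p)^-1 = (P / 2) / ((P / 2 + p) * (P + p)).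
  have e0 : P / 2 = (P + p) - (P / 2 + p) by lra.
  rewrite [X in _ = X / _]e0; have : 0 < P / 2 + p by rewrite addr_gt0.
  have : 0 < P + p by rewrite addr_gt0.
  move: (P / 2 + p) (P + p) => a b b0 a0; by field; rewrite !gt_eqF.
rewrite ler_pdivlMr ?mulr_gt0 ?addr_gt0// ler_pdivrMl ?mulr_gt0//.
have : (P / 2 + p) * (P + p) <= (P / 2 + P) * (P + P).
  by apply: ler_pM; rewrite ?addr_ge0 ?(ltW P2) ?(ltW P0) ?(ltW p0)// lerD2l ltW.
lra.
Qed.

Let q (j : nat) : R := (2^-1) ^+ j.

Let q0 j : 0 < q j. Proof. by rewrite exprn_gt0. Qed.

Let q1 j : q j <= 1. Proof. by rewrite exprn_ile1// invf_le1// ler1n. Qed.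

Let qS j : q j.+1 = q j / 2. Proof. by rewrite /q exprSr. Qed.

(** Bound for the part of mu on [1, +oo[: 2 is the mass of z/(z+r), and 3 comes from
    [hpc_kern_ge]. *)
Let Ctail : R := 6 * M * kern mu `[1, +oo[ 1 * rnorm x.

(* The contributions of the blocks telescope, each being at most a multiple of
   ln g(P/2) - ln g(P). *)
Lemma kern_tail_bound (r : R) j : 0 < r ->
  (exists c, hpc T (fun z => z / (z + r) * kern mu `[q j, +oo[ z) c) /\
  rnorm (op T (fun z => z / (z + r) * kern mu `[q j, +oo[ z) x) <=
    Ctail + 48 * M * C * (ln (st mu (q j)) - ln (st mu 1)).
Proof.
move=> r0; have M0 := M0 hT; have gp p := st_gt0 hmu st_oo (z := p).
elim: j => [|j [[c hc] IH]].
  have mB : measurable (`[1%R, +oo[%classic : set (measurableTypeR R)) by [].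
  have h : hpc T (kern mu `[1, +oo[) (3 * kern mu `[1, +oo[ 1).
    apply: (hpc_kern_ge hT hmu mB ltr01) => p /=; rewrite in_itv /= andbT; apply: le_trans; lra.
  have h' := hpcM hT (hpc_resolvent_compl hT r0) h.
  rewrite /q expr0; split; first by eexists; exact: h'.
  rewrite subrr mulr0 addr0; apply: (le_trans (op_norm hT x h')).
  by rewrite /Ctail le_eqVlt; apply/orP; left; apply/eqP; ring.
have P0 := q0 j; set P := q j in P0 *.
have P2 : 0 < P / 2 by exact: divr_gt0.
have PP : P / 2 <= P by rewrite ler_pdivrMr//; lra.
have mB : measurable (`[P / 2, P[%classic : set (measurableTypeR R)) by [].
have mH : measurable (`[P, +oo[%classic : set (measurableTypeR R)) by [].
have BP p : (`[P / 2, P[%classic : set (measurableTypeR R)) p -> P / 2 <= p <= P.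
  by rewrite /= in_itv /= => /andP[-> /ltW].
have P01 : 0 < P <= 1 by rewrite P0 q1.
have [hb nb] := kern_block_bound r0 P01 mB BP.
have eU z : 0 < z -> z / (z + r) * kern mu `[q j.+1, +oo[ z =
    z / (z + r) * kern mu `[P / 2, P[ z + z / (z + r) * kern mu `[P, +oo[ z.
  move=> z0; rewrite -mulrDr -kern_setU//; last 3 first.
  - by move=> p /BP/andP[p1 _]; apply/RposP; exact: lt_le_trans p1.
  - by move=> p /=; rewrite !in_itv /= !andbT; exact: lt_le_trans.
  - by apply/disj_setPS => p [] /=; rewrite !in_itv /= andbT => /andP[_ p1]; rewrite leNgt p1.
  congr (_ * kern mu _ _); rewrite qS -/P; apply/seteqP; split => [p|p] /=; rewrite !in_itv /= !andbT.
    by have [pP|pP] := ltP p P; [left; rewrite ?pP ?andbT|right].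
  by case=> [/andP[]//|]; exact: le_trans.
split.
  by eexists; apply: hpc_ext (hpcD hT hb hc) => z z0; rewrite eU.
rewrite (op_ext _ _ eU) (opD hT x hb hc); apply: (le_trans (rnormD _ _)).
apply: (le_trans (lerD nb IH)).
have gP := gp P P0; have gP2 := gp _ P2.
have l1 : st mu P <= st mu (P / 2) by exact: st_anti.
have l2 : st mu (P / 2) <= 2 * st mu P.
  have h := st_mul_mono hmu P2 PP; rewrite -(ler_pM2l P2).
  by have -> : P / 2 * (2 * st mu P) = P * st mu P by field.
(* The constant is 48 = 4 * 6 * 2, from the block bound, the mass of the block and the comparison
   with logarithms. *)
have h : M * (4 * fine (mu `[P / 2, P[%classic)) * (C / (P * st mu P)) <=
    48 * M * C * (ln (st mu (P / 2)) - ln (st mu P)).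
  have h1 := mu_block_le P0; have h2 := ln_sub_ge gP l1 l2.
  apply: (@le_trans _ _ (M * (4 * (6 * P * (st mu (P / 2) - st mu P))) * (C / (P * st mu P)))).
    rewrite ler_wpM2r ?divr_ge0 ?mulr_ge0 ?(ltW P0) ?(ltW gP)//.
    by rewrite ler_wpM2l// ler_wpM2l.
  have -> : M * (4 * (6 * P * (st mu (P / 2) - st mu P))) * (C / (P * st mu P)) =
     24 * M * C * ((st mu (P / 2) - st mu P) / st mu P).
    by field; rewrite !gt_eqF.
  have -> : 48 * M * C * (ln (st mu (P / 2)) - ln (st mu P)) =
     24 * M * C * (2 * (ln (st mu (P / 2)) - ln (st mu P))) by ring.
  by rewrite ler_wpM2l// !mulr_ge0.
rewrite qS -/P; apply: le_trans (lerD h (lexx _)) _.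
by rewrite addrCA -mulrDr addrA subrK.
Qed.

(** On ]0, r[ the factor z is spent on the kernel, giving mass 2 mu(]0, r[) <= 4 r g(r), and the
    remaining resolvent at r decays like C/(r g(r)): the product is bounded. Above r the tail bound
    applies. *)
Lemma regularized_st_bound m : (exists c, hpc T (fun z => z / (z + q m) * st mu z) c) /\
  rnorm (op T (fun z => z / (z + q m) * st mu z) x) <=
    4 * M * C + Ctail + 48 * M * C * (ln (st mu (q m)) - ln (st mu 1)).
Proof.
have M0 := M0 hT; have gp p := st_gt0 hmu st_oo (z := p).
have r0 := q0 m; have r1 := q1 m; have [[c hc] nc] := kern_tail_bound m r0.
set r := q m in r0 r1 hc nc *.
pose B : set (measurableTypeR R) := `]0%R, r[%classic.
have mB : measurable B by exact: measurable_itv.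
have BP p : B p -> 0 < p < r by rewrite /B /= in_itv.
have Bp p : B p -> 0 < p by move=> /BP/andP[].
have BR : B `<=` Rpos by move=> p /Bp p0; apply/RposP.
have fB : (mu B < +oo)%E.
  by apply: (mu_bounded hmu (c := r) mB) => p /BP/andP[-> /ltW].
have h1 := hpc_kernel_low hT mB fB Bp.
have h2 := hpc_resolvent hT r0.
have h12 := hpcM hT h1 h2.
have e z : 0 < z -> z * kern mu B z * (z + r)^-1 + z / (z + r) * kern mu `[r, +oo[ z = z / (z + r) * st mu z.
  by move=> z0; rewrite (st_split hmu r0 z0) -/B; ring.
split; first by eexists; apply: hpc_ext e (hpcD hT h12 hc).
rewrite -(op_ext _ _ e) (opD hT x h12 hc); apply: (le_trans (rnormD _ _)).
rewrite -addrA; apply: lerD => //.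
rewrite (opM hT x h1 h2); apply: (le_trans (op_norm hT _ h1)).
have hr : rnorm (op T (fun z => (z + r)^-1) x) <= C / (r * st mu r) by apply: hC; rewrite r0.
have muB : fine (mu B) <= 2 * r * st mu r.
  have : (2 * r)^-1 * fine (mu B) <= st mu r.
    apply: (@le_trans _ _ (kern mu B r)); last first.
      rewrite (st_split hmu r0 r0) lerDl kern_ge0 ?(ltW r0)//.
      by have [] := Rpos_split r0.
    rewrite -(Rintegral_cst mu mB); apply: le_Rintegral => //.
    - by apply: (bounded_integrable mB fB (C := (2 * r)^-1)) => // p _; rewrite ger0_norm// invr_ge0 mulr_ge0// ltW.
    - exact: kern_integrable.
    - by move=> p /BP/andP[p0 p1]; rewrite lef_pV2 ?posrE ?mulr_gt0 ?addr_gt0//; lra.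
  by rewrite ler_pdivrMl ?mulr_gt0.
have gr := gp r r0.
apply: (@le_trans _ _ (M * (2 * (2 * r * st mu r)) * (C / (r * st mu r)))).
  apply: ler_pM => //; rewrite ?mulr_ge0 ?fine_ge0 ?rnorm_ge0//.
  by rewrite ler_wpM2l// ler_wpM2l.
by rewrite le_eqVlt; apply/orP; left; apply/eqP; field; rewrite !gt_eqF.
Qed.

Lemma hpc_f s : 0 < s -> hpc T (fun z => st mu z / (st mu z + s)) 5.
Proof.
move=> s0; have := hpcB hT (hpc1 hT).1 (hpc_psi hT hmu s0).
rewrite [X in hpc _ _ X](_ : _ = 5); last by ring.
apply: hpc_ext => z z0; have g0 := st_gt0 hmu st_oo z0.
by field; rewrite gt_eqF// addr_gt0.
Qed.

(** Split f_s by 1 = r/(z+r) + z/(z+r). The first piece is controlled by r (A+r)^-1 x, of size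
    C/g(r). In the second, f_s = psi_s g / s leaves (z/(z+r)) g, of size 1 + ln g(r). Choosing g(r)
    between s and 2s balances both. *)
Lemma op_f_decay : exists2 C', 0 <= C' &
  forall s, 1 <= s -> rnorm (op T (fun z => st mu z / (st mu z + s)) x) <= C' * ((1 + ln s) / s).
Proof.
have M0 := M0 hT; have gp p := st_gt0 hmu st_oo (z := p); have nx := rnorm_ge0 x.
have g1 := gp 1 ltr01.
have Ct0 : 0 <= Ctail.
  rewrite /Ctail !mulr_ge0// kern_ge0//.
  by move=> p /=; rewrite !in_itv /= !andbT; exact: lt_le_trans.
have ln2 : 0 <= ln (2 : R) by rewrite ln_ge0// ler1n.
(* [D1] covers the range s <= g(1), while [D2] and [D3] are the constant term and the coefficient of
   ln s for s > g(1). *)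
have [D1 D1E] : exists D, D = 5 * M * rnorm x * st mu 1 by eexists.
have [D2 D2E] : exists D, D = 5 * M * C + 4 * M * (4 * M * C + Ctail + 48 * M * C * (ln 2 + `|ln (st mu 1)|)) by eexists.
have [D3 D3E] : exists D, D = 4 * M * (48 * M * C) by eexists.
have D10 : 0 <= D1 by rewrite D1E !mulr_ge0// ltW.
have D20 : 0 <= D2.
  rewrite D2E.
  apply: addr_ge0; first by rewrite !mulr_ge0.
  apply: mulr_ge0; first by rewrite mulr_ge0.
  apply: addr_ge0; first by rewrite addr_ge0// !mulr_ge0.
  by apply: mulr_ge0; [rewrite !mulr_ge0|rewrite addr_ge0].
have D30 : 0 <= D3 by rewrite D3E !mulr_ge0.
exists (D1 + D2 + D3); first by rewrite !addr_ge0.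
move=> s s1; have s0 : 0 < s by apply: lt_le_trans s1.
have lns : 0 <= ln s by rewrite ln_ge0.
have hf := hpc_f s0.
have ex : exists m, s <= st mu (q m).
  have [w w0 sw] : exists2 w, 0 < w & s <= st mu w.
    have /cvgryPge h := st_oo; have h1 := h s.
    by near (0:R)^'+ => w; exists w => //; near: w; exact: h1.
  exists (Num.bound w^-1); apply: (le_trans sw); apply: st_anti => //.
  have := archi_boundP (ltW (_ : 0 < w^-1)); rewrite invr_gt0 => /(_ w0) h.
  rewrite /q exprVn -[leRHS]invrK lef_pV2 ?posrE ?exprn_gt0 ?invr_gt0//.
  apply: (le_trans (ltW h)); rewrite -natrX ler_nat; exact/ltnW/ltn_expl.
case: (ex_minnP ex) => m sm mmin.
case: m sm mmin => [|m] sm mmin.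
  (* Here s <= g(1), and the uniform bound on f_s(A) is enough. *)
  rewrite /q expr0 in sm; apply: (le_trans (op_norm hT x hf)).
  rewrite mulrA ler_pdivlMr//.
  apply: (@le_trans _ _ (M * 5 * rnorm x * st mu 1)); first by rewrite ler_wpM2l// !mulr_ge0.
  have -> : M * 5 * rnorm x * st mu 1 = D1 by rewrite D1E; ring.
  apply: (@le_trans _ _ ((D1 + D2 + D3) * 1)); first by rewrite mulr1 -addrA lerDl addr_ge0.
  by rewrite ler_wpM2l ?addr_ge0// lerDl.
have r0 := q0 m.+1; have r1 := q1 m.+1; set r := q m.+1 in sm r0 r1 *.
have rq : r + r = q m by rewrite /r qS; lra.
(* Minimality gives g(2r) < s, and g(r) <= 2 g(2r) because z g(z) is nondecreasing. *)
have gs : st mu r <= 2 * s.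
  have sq : st mu (q m) < s by rewrite ltNge; apply/negP => /mmin; rewrite ltnn.
  have rr : r <= q m by rewrite -rq lerDl ltW.
  have := st_mul_mono hmu r0 rr; rewrite -rq in sq *; nra.
have gr := gp r r0.
have [[c hc] nc] := regularized_st_bound m.+1; rewrite -/r in hc nc.
have h2 := hpcZ hT r (hpc_resolvent hT r0).
have h3 := hpc_psi hT hmu s0.
have h12 := hpcM hT hf h2; have h34 := hpcZ hT s^-1 (hpcM hT h3 hc).
have e z : 0 < z -> st mu z / (st mu z + s) * (r * (z + r)^-1) + s^-1 * (s / (st mu z + s) * (z / (z + r) * st mu z)) =
    st mu z / (st mu z + s).
  move=> z0; have gz := gp z z0.
  by field; rewrite !gt_eqF ?addr_gt0.
rewrite -(op_ext _ _ e) (opD hT x h12 h34); apply: (le_trans (rnormD _ _)).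
have n1 : rnorm (op T (fun z => st mu z / (st mu z + s) * (r * (z + r)^-1)) x) <= 5 * M * C / s.
  rewrite (opM hT x hf h2) (opZ hT _ _ (hpc_resolvent hT r0)); apply: (le_trans (op_norm hT _ hf)).
  rewrite rnormZ gtr0_norm//.
  have hr : rnorm (op T (fun z => (z + r)^-1) x) <= C / (r * st mu r) by apply: hC; rewrite r0.
  apply: (@le_trans _ _ (M * 5 * (r * (C / (r * st mu r))))).
    by rewrite ler_wpM2l ?mulr_ge0// ler_wpM2l// ltW.
  have -> : M * 5 * (r * (C / (r * st mu r))) = 5 * M * C * (st mu r)^-1 by field; rewrite !gt_eqF.
  by rewrite ler_wpM2l ?mulr_ge0// lef_pV2 ?posrE.
have n2 : rnorm (op T (fun z => s^-1 * (s / (st mu z + s) * (z / (z + r) * st mu z))) x) <=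
    s^-1 * (4 * M * (4 * M * C + Ctail + 48 * M * C * (ln s + (ln 2 + `|ln (st mu 1)|)))).
  rewrite (opZ hT _ _ (hpcM hT h3 hc)) (opM hT x h3 hc) rnormZ gtr0_norm ?invr_gt0//.
  rewrite ler_wpM2l ?invr_ge0 ?(ltW s0)//; apply: (le_trans (op_norm hT _ h3)).
  rewrite [M * 4]mulrC ler_wpM2l ?mulr_ge0//; apply: (le_trans nc).
  rewrite lerD2l ler_wpM2l ?mulr_ge0//.
  have : ln (st mu r) <= ln (2 * s) by rewrite ler_ln ?posrE// mulr_gt0.
  rewrite lnM ?posrE//; have := ler_norm (- ln (st mu 1)); rewrite normrN; lra.
apply: (le_trans (lerD n1 n2)).
rewrite [X in X + _]mulrC -mulrDr [leRHS]mulrA [leRHS]mulrC ler_pM2l ?invr_gt0//.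
have -> : 5 * M * C + 4 * M * (4 * M * C + Ctail + 48 * M * C * (ln s + (ln 2 + `|ln (st mu 1)|))) = D2 + D3 * ln s.
  by rewrite D2E D3E; ring.
nra.
Unshelve. all: by end_near.
Qed.

End Decay.

End OrbitBounds.

(** * Composition with a complete Bernstein function *)

Section BlockSum.
Context (R : realType) (X : completeNormedModType R[i]) (T : R -> X -> X) (M : R)
  (hT : bounded_C0 T M) (mu nu : {measure set (measurableTypeR R) -> \bar R})
  (hmu : levy_integrable mu) (st_oo : st mu s @[s --> 0^'+] --> +oo)
  (hnu : levy_integrable nu).
Implicit Types (s t z : R) (x y : X).
Local Notation Rpos := (`]0%R, +oo[%classic : set (measurableTypeR R)).

(** With theta = (S-s)/S, (g+S)/(g+s) = 1 / (1 - theta psi_S). As psi_S has mass 4, the series is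
    controlled by theta <= 1/8, which leaves a factor 1/(1 - 1/2) = 2. This fixes the width of the
    blocks. *)
Lemma hpc_block (E : set (measurableTypeR R)) (S : R) : measurable E -> 0 < S ->
  (forall s, E s -> 7 / 8 * S <= s <= S) ->
  hpc T (fun z => \int[nu]_(s in E) ((st mu z + S) / (st mu z + s))) (2 * fine (nu E)).
Proof.
move=> mE S0 ES; have S78 : 0 < 7 / 8 * S by rewrite mulr_gt0.
have fE : (nu E < +oo)%E.
  by apply: (mu_bounded hnu (c := S) mE) => s /ES/andP[s1 ->]; rewrite (lt_le_trans S78 s1).
have mth : measurable_fun E ((fun s => (S - s) / S) : measurableTypeR R -> R).
  by apply: measurable_funM => //; apply: measurable_funB => //; exact: measurable_id.
have m1 : measurable_fun E ((fun=> 1) : measurableTypeR R -> R) by [].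
have th s : E s -> 0 <= (S - s) / S <= 1 / 8.
  move=> /ES/andP[s1 s2]; rewrite divr_ge0 ?subr_ge0 ?(ltW S0)//=.
  by rewrite ler_pdivrMr//; lra.
have le2 s : E s -> 0 <= 1 / (1 - (S - s) / S * 4) <= 2.
  move=> /th/andP[h1 h2]; have h3 : 1 / 2 <= 1 - (S - s) / S * 4 by lra.
  have h4 : 0 < 1 - (S - s) / S * 4 by lra.
  rewrite divr_ge0 ?(ltW h4)//= ler_pdivrMr//; lra.
have mq : measurable_fun E ((fun s => 1 / (1 - (S - s) / S * 4)) : measurableTypeR R -> R).
  apply: measurable_funM => //; apply: measurable_fun_inv_pos => //.
    by move=> s /th/andP[h1 h2]; lra.
  by apply: measurable_funB => //; exact: measurable_funM.
have iq : nu.-integrable E (EFin \o (fun s => 1 / (1 - (S - s) / S * 4))).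
  by apply: (bounded_integrable mE fE (C := 2) mq) => s /le2/andP[h1 h2]; rewrite ger0_norm.
have h : hpc T (fun z => \int[nu]_(s in E) (1 / (1 - (S - s) / S * (S / (st mu z + S))))) (2 * fine (nu E)).
  apply: (hpc_geometric_integral hT mE m1 mth _ _ (hpc_psi hT hmu S0) _ iq).
  - by [].
  - by move=> s /th/andP[h1 h2]; apply/andP; split; lra.
  - by move=> s /th/andP[h1 h2]; lra.
  - rewrite -(Rintegral_cst nu mE); apply: le_Rintegral => //.
      by apply: (bounded_integrable mE fE (C := 2)) => // s _; rewrite ger0_norm.
    by move=> s /le2/andP[].
apply: hpc_ext h => z z0; have g0 := st_gt0 hmu st_oo z0.
apply: eq_Rintegral => s /set_mem/ES/andP[s1 s2].
have s0 : 0 < s by apply: lt_le_trans s1.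
have gS : 0 < st mu z + S by rewrite addr_gt0.
have gs : 0 < st mu z + s by rewrite addr_gt0.
have -> : 1 - (S - s) / S * (S / (st mu z + S)) = (st mu z + s) / (st mu z + S) by field; rewrite !gt_eqF.
by field; rewrite !gt_eqF.
Qed.

(** On a block the integral of f_s is f_S times the symbol of [hpc_block]. Two summabilities are
    used: [gam], along x, makes the vectors converge to y; [eta], for operators regularized by
    z/(z+1), makes the regularized integral a symbol of finite mass. The integral itself may be
    unbounded near z = 0. *)
Lemma block_sum (E_ : nat -> set (measurableTypeR R)) (S_ gam eta : nat -> R) G H x :
  trivIset setT E_ -> (forall n, measurable (E_ n)) -> (forall n, 0 < S_ n) ->
  (forall n s, E_ n s -> 7 / 8 * S_ n <= s <= S_ n) ->
  (forall n, rnorm (op T (fun z => st mu z / (st mu z + S_ n)) x) <= gam n) ->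
  (forall n, hpc T (fun z => z / (z + 1) * (st mu z / (st mu z + S_ n))) (eta n)) ->
  (forall N, \sum_(n < N) fine (nu (E_ n)) * gam n <= G) ->
  (forall N, \sum_(n < N) fine (nu (E_ n)) * eta n <= H) ->
  exists y c, hpc T (fun z => z / (z + 1) * \int[nu]_(s in \bigcup_n E_ n) (st mu z / (st mu z + s))) c /\
   op T (fun z => z / (z + 1) * \int[nu]_(s in \bigcup_n E_ n) (st mu z / (st mu z + s))) x =
   op T (fun z => z / (z + 1)) y.
Proof.
move=> tE mE S0 ES hgam heta sG sH; have M0 := M0 hT.
pose v n z := \int[nu]_(s in E_ n) ((st mu z + S_ n) / (st mu z + s)).
have hv n : hpc T (v n) (2 * fine (nu (E_ n))) := hpc_block (mE n) (S0 n) (@ES n).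
have hf n := hpc_f hT hmu st_oo (S0 n).
have he := hpc_resolvent_compl hT ltr01.
have hvf n := hpcM hT (hv n) (hf n).
have n1 n : rnorm (op T (fun z => v n z * (st mu z / (st mu z + S_ n))) x) <=
   2 * M * (fine (nu (E_ n)) * gam n).
  rewrite (opM hT x (hv n) (hf n)); apply: (le_trans (op_norm hT _ (hv n))).
  have -> : 2 * M * (fine (nu (E_ n)) * gam n) = M * (2 * fine (nu (E_ n))) * gam n by ring.
  by rewrite ler_wpM2l// !mulr_ge0// fine_ge0.
have n2 N : \sum_(n < N) 2 * M * (fine (nu (E_ n)) * gam n) <= 2 * M * G.
  by rewrite -mulr_sumr ler_wpM2l// mulr_ge0.
have [y cy] := rnorm_series_cvg n1 n2.
have E0 n s : E_ n s -> 0 < s.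
  by move=> /ES/andP[s1 _]; apply: lt_le_trans s1; rewrite mulr_gt0.
have UR : \bigcup_n E_ n `<=` Rpos by move=> s [n _ /E0 s0]; apply/RposP.
have mU : measurable (\bigcup_n E_ n) by exact: bigcupT_measurable.
have h3 n := hpcM hT (heta n) (hv n).
have s3 N : \sum_(n < N) eta n * (2 * fine (nu (E_ n))) <= 2 * H.
  apply: (@le_trans _ _ (2 * \sum_(n < N) fine (nu (E_ n)) * eta n)); last by rewrite ler_wpM2l.
  by rewrite mulr_sumr le_eqVlt; apply/orP; left; apply/eqP; apply: eq_bigr => n _; ring.
have c3 z : 0 < z -> (fun N => \sum_(n < N) z / (z + 1) * (st mu z / (st mu z + S_ n)) * v n z) @ \oo -->
    z / (z + 1) * \int[nu]_(s in \bigcup_n E_ n) (st mu z / (st mu z + s)).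
  move=> z0; have g0 := st_gt0 hmu st_oo z0.
  have i1 B : measurable B -> B `<=` Rpos -> nu.-integrable B (EFin \o (fun s => st mu z / (st mu z + s))).
    move=> mB BR; have := integrableZl mB (st mu z) (kern_integrable hnu mB BR g0).
    by apply: eq_integrable.
  have [h _] : (fun N => \sum_(n < N) \int[nu]_(s in E_ n) (st mu z / (st mu z + s))) @ \oo -->
     \int[nu]_(s in \bigcup_n E_ n) (st mu z / (st mu z + s)) /\ forall N,
     \sum_(n < N) \int[nu]_(s in E_ n) (st mu z / (st mu z + s)) <= \int[nu]_(s in \bigcup_n E_ n) (st mu z / (st mu z + s)).
    apply: Rintegral_bigcup_cvg => //; last exact: i1.
    by move=> s /UR/RposP s0; rewrite divr_ge0 ?addr_ge0 ?(ltW g0) ?(ltW s0).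
  have -> : (fun N => \sum_(n < N) z / (z + 1) * (st mu z / (st mu z + S_ n)) * v n z) =
     (fun N => z / (z + 1) * \sum_(n < N) \int[nu]_(s in E_ n) (st mu z / (st mu z + s))).
    apply/funext => N; rewrite mulr_sumr; apply: eq_bigr => n _; rewrite -mulrA; congr (_ * _).
    have ER : E_ n `<=` Rpos by move=> s /E0 s0; apply/RposP.
    have gS : 0 < st mu z + S_ n by rewrite addr_gt0.
    rewrite /v -RintegralZl//; last first.
      by have := integrableZl (mE n) (st mu z + S_ n) (kern_integrable hnu (mE n) ER g0); apply: eq_integrable.
    apply: eq_Rintegral => s /set_mem/E0 s0; field; rewrite !gt_eqF//.
    by rewrite addr_gt0.
  exact: cvgMl_tmp h.
have [h4 o4] := hpc_series hT h3 s3 c3.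
exists y, (2 * H); split=> //.
apply: (cvg_vec_unique (o4 x)).
suff -> : (fun N => \sum_(n < N) op T (fun z => z / (z + 1) * (st mu z / (st mu z + S_ n)) * v n z) x) =
  (fun N => op T (fun z => z / (z + 1)) (\sum_(n < N) op T (fun z => v n z * (st mu z / (st mu z + S_ n))) x)).
  exact: (op_cvg hT he cy).
apply/funext => N; elim: N => [|N IH].
  by rewrite !big_ord0 -[X in op _ _ X](subrr (0 : X)) (op_subv hT _ _ he) subrr.
rewrite !big_ord_recr /= IH (op_addv hT _ _ he); congr (_ + _).
rewrite -(opM hT x he (hvf N)); apply: op_ext => z z0; ring.
Qed.

End BlockSum.

(** * Geometric partition of the half-line *)

Section GeometricBlocks.
Context (R : realType).
Implicit Types (s z : R) (n : nat).
Local Notation set_R := (set (measurableTypeR R)).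

(** The largest ratio allowed by the condition 7/8 S <= s <= S on the blocks. *)
Definition beta : R := 8 / 7.
Definition high_block n : set_R := `[beta ^+ n, beta ^+ n.+1[%classic.
Definition low_block n : set_R := `[beta^-1 ^+ n.+1, beta^-1 ^+ n[%classic.

Lemma beta_gt0 : 0 < beta. Proof. exact: divr_gt0. Qed.

Lemma beta_ge1 : 1 <= beta. Proof. by rewrite /beta; lra. Qed.

Lemma betaX_gt0 n : 0 < beta ^+ n. Proof. by rewrite exprn_gt0// beta_gt0. Qed.

Lemma betaVX_gt0 n : 0 < beta^-1 ^+ n. Proof. by rewrite exprn_gt0// invr_gt0 beta_gt0. Qed.

Lemma betaX_mono m n : (m <= n)%N -> beta ^+ m <= beta ^+ n.
Proof. by move=> mn; apply: ler_weXn2l => //; exact: beta_ge1. Qed.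

Lemma betaVX_mono m n : (m <= n)%N -> beta^-1 ^+ n <= beta^-1 ^+ m.
Proof. by move=> mn; rewrite !exprVn lef_pV2 ?posrE ?betaX_gt0// betaX_mono. Qed.

Lemma betaX_unbounded s : exists n, s < beta ^+ n.
Proof.
have bern n : 1 + n%:R / 7 <= beta ^+ n.
  elim: n => [|n IH]; first by rewrite mul0r addr0 expr0.
  have h : 1 + n%:R / 7 + 1 / 7 <= beta ^+ n * beta.
    have n0 : 0 <= n%:R :> R by [].
    apply: (@le_trans _ _ ((1 + n%:R / 7) * beta)); first by rewrite /beta; lra.
    by rewrite ler_pM2r// beta_gt0.
  by rewrite exprSr -natr1; lra.
exists (Num.bound (7 * `|s|)); apply: lt_le_trans (bern _).
have := archi_boundP (_ : 0 <= 7 * `|s|); rewrite mulr_ge0// => /(_ isT).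
have := ler_norm s; lra.
Qed.

Lemma high_blockP n s : high_block n s <-> beta ^+ n <= s < beta ^+ n.+1.
Proof. by rewrite /high_block /= in_itv. Qed.

Lemma low_blockP n s : low_block n s <-> beta^-1 ^+ n.+1 <= s < beta^-1 ^+ n.
Proof. by rewrite /low_block /= in_itv. Qed.

Lemma measurable_high_block n : measurable (high_block n). Proof. exact: measurable_itv. Qed.

Lemma measurable_low_block n : measurable (low_block n). Proof. exact: measurable_itv. Qed.

Lemma trivIset_high_block : trivIset setT high_block.
Proof.
apply/trivIsetP => i j _ _ ij; apply/seteqP; split => // s [/high_blockP/andP[i1 i2] /high_blockP/andP[j1 j2]].
have [lt|le|e] := ltngtP i j; last by rewrite e eqxx in ij.
- by have := lt_le_trans i2 (le_trans (betaX_mono lt) j1); rewrite ltxx.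
- by have := lt_le_trans j2 (le_trans (betaX_mono le) i1); rewrite ltxx.
Qed.

Lemma trivIset_low_block : trivIset setT low_block.
Proof.
apply/trivIsetP => i j _ _ ij; apply/seteqP; split => // s [/low_blockP/andP[i1 i2] /low_blockP/andP[j1 j2]].
have [lt|le|e] := ltngtP i j; last by rewrite e eqxx in ij.
- by have := lt_le_trans j2 (le_trans (betaVX_mono lt) i1); rewrite ltxx.
- by have := lt_le_trans i2 (le_trans (betaVX_mono le) j1); rewrite ltxx.
Qed.

Lemma bigcup_high_block : \bigcup_n high_block n = `[1%R, +oo[%classic.
Proof.
apply/seteqP; split => [s [n _ /high_blockP/andP[s1 _]]|s] /=; rewrite in_itv /= andbT.
  by apply: le_trans s1; rewrite -(expr0 beta) betaX_mono.
move=> s1; case: (ex_minnP (betaX_unbounded s)) => -[|n] sn nmin.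
  by move: sn; rewrite expr0 ltNge s1.
exists n => //; apply/high_blockP; rewrite sn andbT leNgt; apply/negP => /nmin.
by rewrite ltnn.
Qed.

Lemma bigcup_low_block : \bigcup_n low_block n = `]0%R, 1[%classic.
Proof.
apply/seteqP; split => [s [n _ /low_blockP/andP[s1 s2]]|s] /=; rewrite in_itv /=.
  rewrite (lt_le_trans (betaVX_gt0 _) s1) (lt_le_trans s2)//.
  by rewrite -(expr0 beta^-1) betaVX_mono.
move=> /andP[s0 s1].
have ex : exists n, beta^-1 ^+ n <= s.
  have [n hn] := betaX_unbounded s^-1; exists n.
  by rewrite exprVn -[leRHS]invrK lef_pV2 ?posrE ?betaX_gt0 ?invr_gt0// ltW.
case: (ex_minnP ex) => -[|n] sn nmin; first by move: sn; rewrite expr0 leNgt s1.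
exists n => //; apply/low_blockP; rewrite sn /= ltNge; apply/negP => /nmin.
by rewrite ltnn.
Qed.

End GeometricBlocks.
Arguments beta {R}.

(** * What integrability of q(t)/t^2 says about the representing measure of q *)

Section BernsteinTail.
Context (R : realType) (nu : {measure set (measurableTypeR R) -> \bar R})
  (hnu : levy_integrable nu) (q : R -> R) (a b : R) (a0 : 0 <= a) (b0 : 0 <= b)
  (qE : forall z, 0 < z -> q z = a + b * z + z * st nu z)
  (qint : (\int[@lebesgue_measure R]_(tau in `[1%R, +oo[) (q tau / tau ^+ 2)%:E < +oo)%E).

Lemma bernstein_nondecreasing z w : 0 < z -> z <= w -> q z <= q w.
Proof.
move=> z0 zw; have w0 : 0 < w by apply: lt_le_trans zw.
rewrite !qE// -!addrA lerD2l; apply: lerD; first by rewrite ler_wpM2l.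
exact: st_mul_mono.
Qed.

Lemma bernstein_ge0 z : 0 < z -> 0 <= q z.
Proof. by move=> z0; rewrite qE// !addr_ge0 ?mulr_ge0 ?st_ge0 ?(ltW z0). Qed.

Lemma bernstein_integrable :
  (@lebesgue_measure R).-integrable `[1%R, +oo[ (EFin \o (fun t => q t / t ^+ 2)).
Proof.
have t0 (t : R) : `[1%R, +oo[%classic t -> 0 < t.
  by rewrite /= in_itv /= andbT; exact: lt_le_trans.
apply/integrableP; split.
  apply/measurable_EFinP; apply: measurable_funM.
    suff h : measurable_fun (`[1%R, +oo[%classic : set R) (fun t : R => q (Num.max 1 t)).
      by apply: eq_measurable_fun h => t /set_mem /=; rewrite in_itv /= andbT => t1; rewrite max_r.
    apply: nondecreasing_measurable => // z w zw.
    apply: bernstein_nondecreasing; first by rewrite lt_max ltr01.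
    by rewrite ge_max !le_max lexx zw orbT.
  by apply: measurable_fun_inv_pos => // t /t0 h; rewrite exprn_gt0.
apply: le_lt_trans qint; rewrite le_eqVlt; apply/orP; left; apply/eqP.
apply: eq_integral => t /set_mem/t0 h /=.
by rewrite ger0_norm// divr_ge0 ?exprn_ge0 ?bernstein_ge0// ltW.
Qed.

Definition bernstein_energy : R := \int[@lebesgue_measure R]_(t in `[1%R, +oo[) (q t / t ^+ 2).

(** As q is nondecreasing, its integrand on the block k is at least q(beta^k) / beta^(2k+2), and the
    block has length beta^k (beta - 1); the constant is beta^2 / (beta - 1) = 64/7. *)
Lemma bernstein_discrete N :
  \sum_(k < N) q (beta ^+ k) / beta ^+ k <= 64 / 7 * bernstein_energy.
Proof.
have U := @bigcup_high_block R.
have t0 (t : R) : (\bigcup_n @high_block R n) t -> 0 < t.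
  by rewrite U /= in_itv /= andbT; exact: lt_le_trans.
have f0 (t : R) : (\bigcup_n @high_block R n) t -> 0 <= q t / t ^+ 2.
  by move=> /t0 h; rewrite divr_ge0 ?exprn_ge0 ?bernstein_ge0// ltW.
have iq : (@lebesgue_measure R).-integrable (\bigcup_n @high_block R n) (EFin \o (fun t => q t / t ^+ 2)).
  by rewrite U; exact: bernstein_integrable.
have [_ h] := Rintegral_bigcup_cvg (@trivIset_high_block R) (@measurable_high_block R) f0 iq.
apply: (@le_trans _ _ (64 / 7 * \sum_(k < N) \int[@lebesgue_measure R]_(t in @high_block R k) (q t / t ^+ 2))); last first.
  by rewrite ler_wpM2l//; have := h N; rewrite U.
rewrite mulr_sumr; apply: ler_sum => k _.
have bk := betaX_gt0 R k; have bk1 := betaX_gt0 R k.+1.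
have lm : (@lebesgue_measure R (@high_block R k) = (beta ^+ k.+1 - beta ^+ k)%:E)%E.
  rewrite /high_block lebesgue_measure_itv /= lte_fin.
  have lt : beta ^+ k < beta ^+ k.+1 :> R.
    by rewrite exprS ltr_pMl// /beta; lra.
  by rewrite lt EFinB.
have fm : (@lebesgue_measure R (@high_block R k) < +oo)%E by rewrite lm ltry.
have mk := @measurable_high_block R k.
have sub : @high_block R k `<=` \bigcup_n @high_block R n by exact: bigcup_sup.
have : \int[@lebesgue_measure R]_(t in @high_block R k) (q (beta ^+ k) / (beta ^+ k.+1) ^+ 2) <=
    \int[@lebesgue_measure R]_(t in @high_block R k) (q t / t ^+ 2).
  apply: le_Rintegral => //.
  - by apply: (bounded_integrable mk fm (C := `|q (beta ^+ k) / (beta ^+ k.+1) ^+ 2|)).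
  - by apply: (integrableS _ mk sub iq); rewrite U.
  move=> t /high_blockP/andP[t1 t2]; have tt : 0 < t by apply: lt_le_trans t1.
  apply: ler_pM; [exact: bernstein_ge0|by rewrite invr_ge0 exprn_ge0 ?(ltW bk1)|exact: bernstein_nondecreasing|].
  have key (y u : R) : 0 < u -> u < y -> (y ^+ 2)^-1 <= (u ^+ 2)^-1.
    move=> u0 uy; have y0 : 0 < y by apply: lt_trans uy.
    by rewrite lef_pV2 ?posrE ?exprn_gt0//; apply: lerXn2r; rewrite ?nnegrE ltW.
  exact: key tt t2.
rewrite Rintegral_cst//; set w := fine _.
have -> : w = beta ^+ k.+1 - beta ^+ k by exact: (congr1 fine lm).
move=> h1.
have -> : q (beta ^+ k) / beta ^+ k = 64 / 7 * (q (beta ^+ k) / (beta ^+ k.+1) ^+ 2 * (beta ^+ k.+1 - beta ^+ k)).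
  rewrite (exprS beta k); move: (beta ^+ k) bk (q _) => y y0 c; rewrite /beta; field; rewrite gt_eqF//.
by rewrite ler_wpM2l.
Qed.

Lemma kern_lower (B : set (measurableTypeR R)) z c : measurable B -> (nu B < +oo)%E ->
  (forall s, B s -> 0 < s <= c) -> 0 < z <= c -> fine (nu B) / (2 * c) <= kern nu B z.
Proof.
move=> mB fB Bc /andP[z0 zc]; have c0 : 0 < c by apply: lt_le_trans zc.
have BR : B `<=` `]0%R, +oo[%classic by move=> s /Bc/andP[s0 _]; apply/RposP.
rewrite mulrC -(Rintegral_cst nu mB); apply: le_Rintegral => //.
- by apply: (bounded_integrable mB fB (C := `|(2 * c)^-1|)).
- exact: kern_integrable.
- by move=> s /Bc/andP[s0 sc]; rewrite lef_pV2 ?posrE ?mulr_gt0 ?addr_gt0//; lra.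
Qed.

Lemma nu_high_block_lty n : (nu (@high_block R n) < +oo)%E.
Proof.
apply: (mu_bounded hnu (c := beta ^+ n.+1) (@measurable_high_block R n)) => s /high_blockP/andP[s1 s2].
by rewrite (lt_le_trans (betaX_gt0 R n) s1) ltW.
Qed.

(** For s in the block j and k <= j, beta^k + s <= 2 beta^(j+1). *)
Lemma st_high_lower k N :
  \sum_(j < N | (k <= j)%N) fine (nu (@high_block R j)) / (2 * beta ^+ j.+1) <= st nu (beta ^+ k).
Proof.
have bk := betaX_gt0 R k; have U := @bigcup_high_block R.
have R1 : (`[1%R, +oo[%classic : set (measurableTypeR R)) `<=` `]0%R, +oo[%classic.
  by move=> s /=; rewrite !in_itv /= !andbT; exact: lt_le_trans.
have f0 s : (\bigcup_n @high_block R n) s -> 0 <= (beta ^+ k + s)^-1.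
  by rewrite U => /R1/RposP s0; rewrite invr_ge0 addr_ge0 ?ltW.
have ik : nu.-integrable (\bigcup_n @high_block R n) (EFin \o (fun s => (beta ^+ k + s)^-1)).
  by rewrite U; apply: kern_integrable.
have [_ h] := Rintegral_bigcup_cvg (@trivIset_high_block R) (@measurable_high_block R) f0 ik.
apply: (@le_trans _ _ (kern nu `[1%R, +oo[ (beta ^+ k))); last first.
  rewrite (st_split hnu ltr01 bk) lerDr kern_ge0 ?(ltW bk)//.
  by have [] := Rpos_split (@ltr01 R).
apply: le_trans (_ : \sum_(j < N) kern nu (@high_block R j) (beta ^+ k) <= _); last by rewrite /kern -U; exact: h.
rewrite big_mkcond; apply: ler_sum => j _; case: ifPn => [kj|_]; last first.
  by apply: kern_ge0 (ltW bk); move=> s hs; apply/R1; rewrite -U; exists j.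
apply: kern_lower (@measurable_high_block R j) (nu_high_block_lty j) _ _.
  by move=> s /high_blockP/andP[s1 s2]; rewrite (lt_le_trans (betaX_gt0 R j) s1) ltW.
by rewrite bk betaX_mono// (leq_trans kj).
Qed.

(* Exchanging the sums, the block j is counted by every k <= j. *)
Lemma bernstein_tail_sum N :
  N%:R * b + \sum_(j < N) j.+1%:R * (fine (nu (@high_block R j)) / (2 * beta ^+ j.+1)) <=
  64 / 7 * bernstein_energy.
Proof.
apply: le_trans (bernstein_discrete N).
(* At z = beta^k, q(z)/z = a/z + b + [st nu z]; the nonnegative a/z is dropped and the last term
   bounded below by the blocks above k. *)
apply: (@le_trans _ _ (\sum_(k < N) (b + \sum_(j < N | (k <= j)%N) fine (nu (@high_block R j)) / (2 * beta ^+ j.+1)))); last first.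
  apply: ler_sum => k _; have bk := betaX_gt0 R k.
  rewrite ler_pdivlMr// qE//.
  have := st_high_lower k N; rewrite -(ler_pM2r bk).
  by move=> h; move: a0; lra.
rewrite big_split /= sumr_const card_ord [N%:R * b]mulr_natl lerD2l.
rewrite (exchange_big_dep predT)//= le_eqVlt; apply/orP; left; apply/eqP.
apply: eq_bigr => j _.
rewrite (eq_bigl (fun k : 'I_N => (k < j.+1)%N))//.
by rewrite (big_ord_narrow (ltn_ord j)) sumr_const card_ord mulr_natl.
Qed.

(** The preceding estimate contains N b on its left, under a bound that does not depend on N. *)
Lemma bernstein_slope0 : b = 0.
Proof.
apply/eqP; rewrite eq_le b0 andbT leNgt; apply/negP => bpos.
have w0 j : 0 <= j.+1%:R * (fine (nu (@high_block R j)) / (2 * beta ^+ j.+1)).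
  by rewrite mulr_ge0// divr_ge0 ?fine_ge0// mulr_ge0// ltW// betaX_gt0.
set Q := 64 / 7 * bernstein_energy.
have h := bernstein_tail_sum (Num.bound (`|Q| / b)).
have := archi_boundP (_ : 0 <= `|Q| / b); rewrite divr_ge0// => /(_ isT).
rewrite ltr_pdivrMr//; have := ler_norm Q.
have : 0 <= \sum_(j < Num.bound (`|Q| / b)) j.+1%:R * (fine (nu (@high_block R j)) / (2 * beta ^+ j.+1)).
  by apply: sumr_ge0 => j _.
rewrite -/Q in h; lra.
Qed.

End BernsteinTail.

(** * The domain of q o g *)

Section Composition.
Context (R : realType) (X : completeNormedModType R[i]) (T : R -> X -> X) (M : R)
  (hT : bounded_C0 T M) (mu : {measure set (measurableTypeR R) -> \bar R})
  (hmu : levy_integrable mu) (st_oo : st mu s @[s --> 0^'+] --> +oo).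
Implicit Types (s t z : R) (x y : X).

Lemma complete_bernsteinE (q : R -> R) : complete_bernstein q ->
  exists (a b : R) (nu : {measure set (measurableTypeR R) -> \bar R}),
  [/\ 0 <= a, 0 <= b, levy_integrable nu & forall z, 0 < z -> q z = a + b * z + z * st nu z].
Proof.
move=> [a [b [nu [a0 b0 hnu qE]]]]; exists a, b, nu; split=> // z z0.
rewrite qE//; congr (_ + _); rewrite /st /kern -RintegralZl//.
exact: kern_integrable.
Qed.

(** The other two terms of q are nonnegative, so q >= a, and the limit at 0 forces a = 0. *)
Lemma bernstein_const0 (q : R -> R) (a b : R) (nu : {measure set (measurableTypeR R) -> \bar R}) :
  0 <= a -> 0 <= b -> (forall z, 0 < z -> q z = a + b * z + z * st nu z) ->
  q s @[s --> 0^'+] --> 0 -> a = 0.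
Proof.
move=> a0 b0 qE q0; apply/eqP; rewrite eq_le a0 andbT leNgt; apply/negP => ap.
move/cvgrPdist_lt: q0 => /(_ a ap) h.
have [w w0 hw] : exists2 w, 0 < w & `|0 - q w| < a.
  by near (0:R)^'+ => w; exists w => //; near: w; exact: h.
move: hw; rewrite sub0r normrN qE// => /(le_lt_trans (ler_norm _)).
apply/negP; rewrite -leNgt -addrA lerDl addr_ge0// mulr_ge0 ?st_ge0 ?(ltW w0)//.
Unshelve. all: by end_near.
Qed.

(** Since f_s = psi_s g / s, the regularized symbol gains a factor 1/s that f_s alone, of mass 5,
    does not have. *)
Lemma hpc_regularized_f (ce : R) s : hpc T (fun z => z / (z + 1) * st mu z) ce -> 0 < s ->
  hpc T (fun z => z / (z + 1) * (st mu z / (st mu z + s))) (ce * 4 / s).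
Proof.
move=> he s0; have := hpcZ hT s^-1 (hpcM hT he (hpc_psi hT hmu s0)).
rewrite gtr0_norm ?invr_gt0// mulrC; apply: hpc_ext => z z0.
have g0 := st_gt0 hmu st_oo z0.
by field; rewrite !gt_eqF ?addr_gt0.
Qed.

Lemma composition_dom (g q : R -> R) x :
  injective (op T (fun t => t / (t + 1))) ->
  (forall z, 0 < z -> g z = st mu z) ->
  complete_bernstein q ->
  (\int[@lebesgue_measure R]_(tau in `[1%R, +oo[) (q tau / tau ^+ 2)%:E < +oo)%E ->
  q s @[s --> 0^'+] --> 0 ->
  (exists K : R, \forall t \near +oo, rnorm (cesaro_mean T t x) <= K * (st mu (t^-1))^-1) ->
  op_dom (ext_hp_real T (q \o g)) x.
Proof.
move=> inj gE /complete_bernsteinE[a [b [nu [a0 b0 hnu qE]]]] qint q0 hx.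
have az := bernstein_const0 a0 b0 qE q0.
have bz := bernstein_slope0 hnu a0 b0 qE qint.
have [C C0 hC] := resolvent_decay hT hmu st_oo hx.
have [C' C'0 hf] := op_f_decay hT hmu st_oo C0 hC.
(* Taken at r = 1: z/(z+1) g is a symbol of finite mass. *)
have [[ce hce0] _] := regularized_st_bound hT hmu st_oo C0 hC 0.
have hce : hpc T (fun z => z / (z + 1) * st mu z) ce.
  by apply: hpc_ext hce0 => z z0; rewrite expr0.
have ce0 := hpc_ge0 hce; have M0 := M0 hT; have nx := rnorm_ge0 x.
have he := hpc_resolvent_compl hT ltr01.
have nu0 (B : set (measurableTypeR R)) : 0 <= fine (nu B) by exact: fine_ge0.
have bk k : 0 < beta ^+ k :> R := betaX_gt0 R k.
have tail N : \sum_(j < N) j.+1%:R * (fine (nu (@high_block R j)) / (2 * beta ^+ j.+1)) <=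
    64 / 7 * bernstein_energy q.
  by have := bernstein_tail_sum hnu a0 b0 qE qint N; rewrite bz mulr0 add0r.
(* On [1, +oo[ both summabilities follow from [tail]: along x the weight is (n+1)/beta^(n+1), with
   n+1 in the role of ln s, and for the regularized operators only 1/beta^(n+1). *)
have [y1 [c1 [h1 o1]]] : exists y c,
   hpc T (fun z => z / (z + 1) * \int[nu]_(s in \bigcup_n @high_block R n) (st mu z / (st mu z + s))) c /\
   op T (fun z => z / (z + 1) * \int[nu]_(s in \bigcup_n @high_block R n) (st mu z / (st mu z + s))) x =
   op T (fun z => z / (z + 1)) y.
  apply: (block_sum hT hmu st_oo hnu (S_ := fun n => beta ^+ n.+1)
    (gam := fun n => C' * (2 * n.+1%:R / beta ^+ n.+1)) (eta := fun n => ce * 4 / beta ^+ n.+1)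
    (G := 4 * C' * (64 / 7 * bernstein_energy q)) (H := 8 * ce * (64 / 7 * bernstein_energy q))).
  - exact: trivIset_high_block.
  - exact: measurable_high_block.
  - by [].
  - move=> n s /high_blockP/andP[s1 s2]; rewrite (ltW s2) andbT; apply: le_trans s1.
    by rewrite exprS mulrA /beta le_eqVlt; apply/orP; left; apply/eqP; field.
  - move=> n; have S1 : 1 <= beta ^+ n.+1 :> R by rewrite exprn_ege1// beta_ge1.
    apply: (le_trans (hf _ S1)); rewrite ler_wpM2l// ler_pM2r ?invr_gt0//.
    (* This gives 1 + ln (beta^(n+1)) <= 2 (n+1). *)
    have lb : ln beta <= 1 :> R.
      have h := @expR_ge1Dx R (ln beta); rewrite lnK ?posrE ?beta_gt0// in h.
      by move: h; rewrite /beta; lra.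
    have : ln (beta ^+ n.+1) <= n.+1%:R :> R.
      by rewrite lnXn ?beta_gt0// -[X in X <= _]mulr_natr ler_piMl.
    have : 1 <= n.+1%:R :> R by rewrite ler1n.
    lra.
  - by move=> n; exact: hpc_regularized_f.
  - move=> N; apply: (@le_trans _ _ (4 * C' * \sum_(j < N) j.+1%:R * (fine (nu (@high_block R j)) / (2 * beta ^+ j.+1)))).
      rewrite mulr_sumr; apply: ler_sum => j _; rewrite le_eqVlt; apply/orP; left; apply/eqP.
      by field; rewrite gt_eqF.
    by rewrite ler_wpM2l// mulr_ge0.
  - move=> N; apply: (@le_trans _ _ (8 * ce * \sum_(j < N) j.+1%:R * (fine (nu (@high_block R j)) / (2 * beta ^+ j.+1)))).
      rewrite mulr_sumr; apply: ler_sum => j _.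
      have -> : fine (nu (high_block j)) * (ce * 4 / beta ^+ j.+1) =
        8 * ce * (fine (nu (@high_block R j)) / (2 * beta ^+ j.+1)).
        by field; rewrite gt_eqF.
      rewrite ler_wpM2l ?mulr_ge0// ler_peMl ?divr_ge0 ?mulr_ge0 ?(ltW (bk _))//.
      by rewrite ler1n.
    by rewrite ler_wpM2l// mulr_ge0.
have UL := @bigcup_low_block R.
have fL : (nu (\bigcup_n @low_block R n) < +oo)%E.
  rewrite UL; apply: (mu_bounded hnu (c := 1)) => // s.
  by rewrite /= in_itv /= => /andP[-> /ltW].
have mL : measurable (\bigcup_n @low_block R n) by rewrite UL.
have lowsum N : \sum_(n < N) fine (nu (@low_block R n)) <= fine (nu (\bigcup_n @low_block R n)).
  have i1 : nu.-integrable (\bigcup_n @low_block R n) (EFin \o (fun=> 1 : R)).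
    by apply: (bounded_integrable mL fL (C := 1)) => // s _; rewrite normr1.
  have [_ h] := Rintegral_bigcup_cvg (@trivIset_low_block R) (@measurable_low_block R) (fun _ _ => ler01) i1.
  have := h N; rewrite Rintegral_cst// mul1r; apply: le_trans.
  apply: ler_sum => n _; rewrite Rintegral_cst ?mul1r//; exact: measurable_low_block.
(* On ]0, 1[ the measure nu is finite, so bounds independent of the block suffice. *)
have [y2 [c2 [h2 o2]]] : exists y c,
   hpc T (fun z => z / (z + 1) * \int[nu]_(s in \bigcup_n @low_block R n) (st mu z / (st mu z + s))) c /\
   op T (fun z => z / (z + 1) * \int[nu]_(s in \bigcup_n @low_block R n) (st mu z / (st mu z + s))) x =
   op T (fun z => z / (z + 1)) y.
  have SV n : 0 < beta^-1 ^+ n :> R := betaVX_gt0 R n.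
  apply: (block_sum hT hmu st_oo hnu (S_ := fun n => beta^-1 ^+ n)
    (gam := fun n => M * 5 * rnorm x) (eta := fun n => 2 * 5)
    (G := fine (nu (\bigcup_n @low_block R n)) * (M * 5 * rnorm x)) (H := fine (nu (\bigcup_n @low_block R n)) * (2 * 5))).
  - exact: trivIset_low_block.
  - exact: measurable_low_block.
  - by [].
  - move=> n s /low_blockP/andP[s1 s2]; rewrite (ltW s2) andbT; apply: le_trans s1.
    by rewrite exprS /beta invf_div.
  - by move=> n; apply: op_norm (hpc_f hT hmu st_oo (SV n)).
  - by move=> n; have h := hpcM hT he (hpc_f hT hmu st_oo (SV n)); exact: h.
  - by move=> N; rewrite -mulr_suml ler_wpM2r// !mulr_ge0.
  - by move=> N; rewrite -mulr_suml ler_wpM2r// mulr_ge0.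
(* Since a = b = 0, q o g is the integral of f_s over the low and the high blocks together. *)
apply: (ext_hp_real_dom hT (y := y1 + y2) inj (hpcD hT h1 h2)); last first.
  by rewrite (op_addv hT _ _ he) (opD hT x h1 h2) o1 o2.
move=> z z0; rewrite -mulrDr; congr (_ * _) => /=; have g0 := st_gt0 hmu st_oo z0.
rewrite gE// qE// az bz mul0r !add0r UL bigcup_high_block.
have [_ B1 B2 _] := Rpos_split (@ltr01 R).
rewrite (st_split hnu ltr01 g0) mulrDr addrC /kern -!RintegralZl//.
- exact: kern_integrable.
- exact: kern_integrable.
Qed.

End Composition.

(** * Fractional powers *)

Section FractionalPower.
Context (R : realType) (al : R) (al0 : 0 < al) (al1 : al < 1).
Implicit Types (u v w s z : R).
Local Notation leb := (@lebesgue_measure R).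

(** The integrand of s^(al-1) / (1+s) ds after s = e^u. Its integral pi / sin (pi al) normalizes the
    measure below, and only its finiteness and positivity are established. *)
Definition power_kernel u : R := expR (al * u) / (1 + expR u).

Lemma expR1D_gt0 u : 0 < 1 + expR u :> R.
Proof. by rewrite ltr_wpDr ?expR_ge0. Qed.

Lemma power_kernel_gt0 u : 0 < power_kernel u.
Proof. by rewrite divr_gt0 ?expR_gt0 ?expR1D_gt0. Qed.

Lemma continuous_expM (k : R) : continuous (fun u : R => expR (k * u)).
Proof.
move=> u; apply: continuous_comp; last exact: continuous_expR.
by apply: cvgM; [exact: cvg_cst|exact: cvg_id].
Qed.

Lemma continuous_power_kernel : continuous power_kernel.
Proof.
move=> u; apply: cvgM; first exact: continuous_expM.
apply: cvgV; first by rewrite gt_eqF// expR1D_gt0.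
by apply: cvgD; [exact: cvg_cst|exact: continuous_expR].
Qed.

Lemma measurable_power_kernel : measurable_fun setT (power_kernel : measurableTypeR R -> R).
Proof. exact: continuous_measurable_fun continuous_power_kernel. Qed.

Lemma integral_exp_lty (k : R) : 0 < k ->
  (\int[leb]_(u in `[0%R, +oo[) (expR (- (k * u)))%:E < +oo)%E.
Proof.
move=> k0; have mD : measurable (`[0%R, +oo[%classic : set (measurableTypeR R)) by [].
have mp : measurable_fun setT (exponential_pdf k : measurableTypeR R -> R) by exact: measurable_exponential_pdf.
have p0 u : 0 <= exponential_pdf k u by apply: exponential_pdf_ge0; exact: ltW.
apply: (@le_lt_trans _ _ (\int[leb]_(u in `[0%R, +oo[) ((k^-1)%:E * (exponential_pdf k u)%:E))%E).
  rewrite le_eqVlt; apply/orP; left; apply/eqP; apply: eq_integral => u /set_mem /=.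
  rewrite in_itv /= andbT => u0; rewrite exponential_pdfE// -EFinM; congr _%:E.
  by rewrite mulrA mulVf ?gt_eqF// mul1r mulNr.
rewrite ge0_integralZl_EFin//; last 2 first.
- by apply/measurable_EFinP; exact: measurable_funTS.
- by rewrite invr_ge0 ltW.
apply: (@le_lt_trans _ _ ((k^-1)%:E * 1)%E); last by rewrite mule1 ltry.
apply: lee_pmul => //; [by rewrite lee_fin invr_ge0 ltW|by apply: integral_ge0 => u _; rewrite lee_fin|].
rewrite -(integral_exponential_pdf k0); apply: ge0_subset_integral => //; first exact/measurable_EFinP.
all: by move=> u _; rewrite lee_fin.
Qed.

(** The kernel is at most e^(al u) for u < 0 and e^(-(1-al) u) for u >= 0; the two ends use al > 0
    and al < 1. *)
Lemma power_kernel_lty : (\int[leb]_u (power_kernel u)%:E < +oo)%E.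
Proof.
have mE (k : R) (D : set (measurableTypeR R)) : measurable D -> measurable_fun D (fun u : measurableTypeR R => (expR (k * u))%:E).
  move=> mD; apply/measurable_EFinP/measurable_funTS.
  exact: continuous_measurable_fun (continuous_expM (k := k)).
have mk (D : set (measurableTypeR R)) : measurable_fun D (fun u : measurableTypeR R => (power_kernel u)%:E).
  by apply/measurable_EFinP/measurable_funTS; exact: measurable_power_kernel.
have TU : [set: measurableTypeR R] = `]-oo, 0%R[%classic `|` `[0%R, +oo[%classic.
  apply/seteqP; split => // u _ /=.
  by rewrite !in_itv /= andbT; have [h|h] := ltP u 0; [left|right].
have m1 : measurable (`]-oo, 0%R[%classic : set (measurableTypeR R)) by [].
have m1' : measurable (`]-oo, (- 0)%R]%classic : set (measurableTypeR R)) by [].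
have m2 : measurable (`[0%R, +oo[%classic : set (measurableTypeR R)) by [].
have k0 u : (0 <= (power_kernel u)%:E)%E by rewrite lee_fin ltW// power_kernel_gt0.
rewrite TU ge0_integral_setU//; last first.
  by apply/disj_setPS => u [] /=; rewrite !in_itv /= andbT ltNge => /negP.
apply: lte_add_pinfty.
  apply: (@le_lt_trans _ _ (\int[leb]_(u in `]-oo, (- 0)%R]) (expR (al * u))%:E)%E).
    apply: (@le_trans _ _ (\int[leb]_(u in `]-oo, 0%R[) (expR (al * u))%:E)%E).
      apply: ge0_le_integral => //; first exact: mE.
      move=> u _; rewrite lee_fin ler_pdivrMr ?expR1D_gt0// ler_peMr ?expR_ge0//.
      by rewrite lerDl expR_ge0.
    apply: ge0_subset_integral => //; first exact: mE.
    by move=> u /=; rewrite !in_itv /= oppr0 => /ltW.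
  rewrite (ge0_integration_by_substitutionNy (G := fun u => expR (al * u))).
  - apply: le_lt_trans (integral_exp_lty al0); rewrite le_eqVlt; apply/orP; left; apply/eqP.
    by apply: eq_integral => u _ /=; rewrite mulrN.
  - by apply: continuous_subspaceT; exact: continuous_expM.
  - by move=> u _; exact: expR_ge0.
have al2 : 0 < 1 - al by rewrite subr_gt0.
apply: le_lt_trans (integral_exp_lty al2).
apply: ge0_le_integral => // [|u _].
  by apply: eq_measurable_fun (mE (- (1 - al)) _ m2) => u _; rewrite mulNr.
rewrite lee_fin ler_pdivrMr ?expR1D_gt0//.
have -> : expR (al * u) = expR (- ((1 - al) * u)) * expR u by rewrite -expRD; congr expR; ring.
by rewrite ler_wpM2l ?expR_ge0// lerDr.
Qed.

Definition power_const : R := fine (\int[leb]_u (power_kernel u)%:E)%E.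

Lemma power_constE : (\int[leb]_u (power_kernel u)%:E = power_const%:E)%E.
Proof.
rewrite fineK// ge0_fin_numE ?power_kernel_lty//.
by apply: integral_ge0 => u _; rewrite lee_fin ltW// power_kernel_gt0.
Qed.

Lemma power_const_gt0 : 0 < power_const.
Proof.
have m01 : measurable (`[0%R, 1%R]%classic : set (measurableTypeR R)) by [].
have mk : measurable_fun setT (fun u : measurableTypeR R => (power_kernel u)%:E).
  by apply/measurable_EFinP; exact: measurable_power_kernel.
have k0 u : (0 <= (power_kernel u)%:E)%E by rewrite lee_fin ltW// power_kernel_gt0.
have h : (\int[leb]_(u in `[0%R, 1%R]) ((1 + expR 1)^-1)%:E <= power_const%:E)%E.
  rewrite -power_constE.
  apply: (@le_trans _ _ (\int[leb]_(u in `[0%R, 1%R]) (power_kernel u)%:E)%E).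
    apply: ge0_le_integral => //.
    - by apply/measurable_EFinP/measurable_funTS; exact: measurable_power_kernel.
    - move=> u /=; rewrite in_itv /= => /andP[u0 u1]; rewrite lee_fin.
      rewrite -[leLHS]mul1r; apply: ler_pM; rewrite ?invr_ge0 ?(ltW (expR1D_gt0 _))//.
        by rewrite -expR0 ler_expR mulr_ge0// ltW.
      by rewrite lef_pV2 ?posrE ?expR1D_gt0// lerD2l ler_expR.
  by apply: ge0_subset_integral.
rewrite -lte_fin; apply: lt_le_trans h.
rewrite integral_cst//; have := lebesgue_itv0 (@ler01 R) => /= ->.
by rewrite mule1 lte_fin invr_gt0 expR1D_gt0.
Qed.

Lemma integral_translation (G : R -> R) w : continuous G -> (forall u, 0 <= G u) ->
  (\int[leb]_u (G (u + w))%:E = \int[leb]_u (G u)%:E)%E.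
Proof.
move=> cG G0; pose F u := u + w.
have dF : F^`()%classic = cst 1.
  apply/funext => u; rewrite /F derive1E deriveD// derive_id derive_cst addr0//.
rewrite [RHS](increasing_ge0_integration_by_substitutionT (F := F))//.
- apply: eq_integral => u _; congr _%:E; rewrite dF.
  by rewrite -[RHS]/(G (u + w) * 1) mulr1.
- by move=> u v; rewrite /F ltrD2r.
- by rewrite dF => u; exact: cst_continuous.
- by rewrite dF; exact: is_cvg_cst.
- by rewrite dF; exact: is_cvg_cst.
- by apply/cvgrNyPle => a; near=> u; rewrite /F -lerBrDr; near: u; by apply: nbhs_ninfty_le; exact: num_real.
- by apply/cvgryPge => a; near=> u; rewrite /F -lerBlDr; near: u; by apply: nbhs_pinfty_ge; exact: num_real.
Unshelve. all: by end_near.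
Qed.

Let phi u : R := power_kernel u * (1 + expR u) / power_const.

Let phi0 u : 0 <= phi u.
Proof.
by rewrite divr_ge0 ?(ltW power_const_gt0)// mulr_ge0 ?(ltW (power_kernel_gt0 _)) ?(ltW (expR1D_gt0 _)).
Qed.

Let mexpR : measurable_fun setT (expR : measurableTypeR R -> measurableTypeR R).
Proof. exact: continuous_measurable_fun (@continuous_expR R). Qed.

Let mphi : measurable_fun setT (phi : measurableTypeR R -> R).
Proof.
apply: measurable_funM => //; apply: measurable_funM; first exact: measurable_power_kernel.
by apply: measurable_funD => //; exact: mexpR.
Qed.

(* The image under [expR] of [expR (al * u) du / power_const], that is
   [s `^ (al - 1) ds / power_const], so that scaling becomes translation. *)
Definition power_measure : {measure set (measurableTypeR R) -> \bar R} :=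
  measure_function_pushforward__canonical__measure_function_Measure (dens leb phi0 mphi) mexpR.

Lemma integral_power_measure (f : R -> R) : (forall s, 0 < s -> 0 <= f s) ->
  measurable_fun (`]0%R, +oo[%classic : set (measurableTypeR R)) (f : measurableTypeR R -> R) ->
  (\int[power_measure]_(s in `]0%R, +oo[) (f s)%:E =
   \int[leb]_u (f (expR u) * phi u)%:E)%E.
Proof.
move=> f0 mf; have mE := iffRL (measurable_EFinP _ _) mf.
rewrite (ge0_integral_pushforward mexpR)//; last first.
  by move=> s /set_mem /=; rewrite in_itv /= andbT lee_fin; exact: f0.
have -> : (expR : R -> R) @^-1` `]0%R, +oo[%classic = setT.
  by apply/seteqP; split => // u _ /=; rewrite in_itv /= andbT expR_gt0.
rewrite ge0_integral_dens//.
- apply: (measurable_comp _ _ mE mexpR) => //.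
  by move=> _ [u _ <-] /=; rewrite in_itv /= andbT expR_gt0.
- by move=> u _; rewrite lee_fin f0// expR_gt0.
Qed.

(** In the variable u = ln s, the integrand is z^(al-1) times the normalized kernel translated by ln
    z, and translation preserves its integral. *)
Lemma power_stieltjes z : 0 < z ->
  (\int[power_measure]_(s in `]0%R, +oo[) ((z + s)^-1)%:E = (z `^ (al - 1))%:E)%E.
Proof.
move=> z0; rewrite integral_power_measure; last 2 first.
- by move=> s s0; rewrite invr_ge0 addr_ge0// ltW.
- apply: measurable_fun_inv_pos => //; last by apply: measurable_funD => //; exact: measurable_id.
  by move=> s /=; rewrite in_itv /= andbT => s0; rewrite addr_gt0.
have zE : z = expR (ln z) by rewrite lnK.
transitivity (\int[leb]_u ((z `^ (al - 1) / power_const)%:E * (power_kernel (u + - ln z))%:E))%E.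
  apply: eq_integral => u _; rewrite -EFinM; congr _%:E.
  rewrite /phi /powR (gt_eqF z0) /power_kernel.
  rewrite {1}zE.
  have -> : expR (al * (u + - ln z)) = expR (al * u) * expR (- (al * ln z)) by rewrite -expRD; congr expR; ring.
  have -> : expR (u + - ln z) = expR u / expR (ln z) by rewrite expRB.
  have -> : expR ((al - 1) * ln z) = (expR (- (al * ln z)))^-1 / expR (ln z).
    by rewrite -expRN opprK -expRB; congr expR; ring.
  have c0 := power_const_gt0.
  have a1 := expR_gt0 (ln z); have a2 := expR_gt0 u; have a3 := expR_gt0 (- (al * ln z)).
  move: (expR (ln z)) (expR u) (expR (- (al * ln z))) (expR (al * u)) a1 a2 a3 => a d e k a1 a2 a3.
  by field; rewrite !gt_eqF ?addr_gt0.
have mk : measurable_fun setT (fun u : measurableTypeR R => (power_kernel (u + - ln z))%:E).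
  apply/measurable_EFinP; apply: (measurableT_comp measurable_power_kernel).
  by apply: measurable_funB => //; exact: measurable_id.
rewrite ge0_integralZl_EFin//.
- rewrite (integral_translation (G := power_kernel)) ?power_constE.
  + by rewrite -EFinM divfK// gt_eqF// power_const_gt0.
  + exact: continuous_power_kernel.
  + by move=> u; rewrite ltW// power_kernel_gt0.
- by move=> u _; rewrite lee_fin ltW// power_kernel_gt0.
- by rewrite divr_ge0 ?powR_ge0// ltW// power_const_gt0.
Qed.

Lemma complete_bernstein_powR : complete_bernstein (fun s : R => s `^ al).
Proof.
exists 0, 0, power_measure.
have hl : levy_integrable power_measure by rewrite /levy_integrable power_stieltjes// ltry.
split=> // z z0; rewrite add0r mul0r add0r.
rewrite RintegralZl//; last exact: kern_integrable.
rewrite /Rintegral power_stieltjes//= -[X in X * _](powRr1 (ltW z0)) -powRD; last by rewrite (gt_eqF z0) implybT.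
by congr powR; ring.
Qed.

(** The integrand is t^(al-2), with primitive t^(al-1) / (al-1), which vanishes at infinity because
    al < 1. *)
Lemma powR_energy_lty :
  (\int[leb]_(tau in `[1%R, +oo[) (tau `^ al / tau ^+ 2)%:E < +oo)%E.
Proof.
pose F (t : R) := (al - 1)^-1 * t `^ (al - 1).
have al2 : al - 1 != 0 by rewrite subr_eq0 lt_eqF.
have pos (t : R) : 1 <= t -> 0 < t by exact: lt_le_trans.
have dF (t : R) : 0 < t -> is_derive t 1 F (t `^ (al - 2)).
  move=> t0; have t0' : t \in `]0, +oo[ by rewrite in_itv /= t0.
  have h1 := @derivable_powR R 1 (al - 1) t t0'.
  rewrite /F; apply: DeriveDef; first exact: derivableZ.
  rewrite deriveZ// -derive1E powR_derive1// -[_ *: _]/(_ * _) mulrA mulVf// mul1r.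
  by congr powR; ring.
have -> : (\int[leb]_(tau in `[1%R, +oo[) (tau `^ al / tau ^+ 2)%:E =
    \int[leb]_(tau in `[1%R, +oo[) (tau `^ (al - 2))%:E)%E.
  apply: eq_integral => t /set_mem /=; rewrite in_itv /= andbT => /pos t0; congr _%:E.
  by rewrite powRB ?(gt_eqF t0) ?implybT// [t `^ 2](@powR_mulrn _ t 2) ?ltW.
have Fl : F x @[x --> +oo] --> (0 : R).
  rewrite -[X in _ --> X](mulr0 (al - 1)^-1); apply: cvgMl_tmp.
  apply/cvgrPdist_le => e e0; near=> t.
  have t0 : 0 < t by near: t; apply: nbhs_pinfty_gt; exact: num_real.
  rewrite sub0r normrN ger0_norm ?powR_ge0//.
  have al3 : 0 < 1 - al by rewrite subr_gt0.
  have et : e^-1 `^ (1 - al)^-1 <= t by near: t; apply: nbhs_pinfty_ge; exact: num_real.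
  have h : e^-1 <= t `^ (1 - al).
    have -> : e^-1 = (e^-1 `^ (1 - al)^-1) `^ (1 - al).
      by rewrite -powRrM mulVf ?gt_eqF// powRr1// invr_ge0 ltW.
    by apply: ge0_ler_powR; rewrite ?nnegrE ?powR_ge0 ?(ltW al3) ?(ltW t0).
  have -> : al - 1 = - (1 - al) by ring.
  by rewrite powRN -[leRHS]invrK lef_pV2 ?posrE ?invr_gt0// powR_gt0.
suff -> : (\int[leb]_(tau in `[1%R, +oo[) (tau `^ (al - 2))%:E = 0%:E - (F 1)%:E)%E.
  by rewrite -EFinB ltry.
apply: ge0_continuous_FTC2y.
- by move=> t _; exact: powR_ge0.
- apply: derivable_within_continuous => t; rewrite in_itv /= andbT => /pos t0.
  by apply: derivable_powR; rewrite in_itv /= t0.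
- exact: Fl.
- by move=> t t1; have [] := dF t (lt_trans ltr01 t1).
- apply: cvg_at_right_filter; apply: differentiable_continuous.
  by apply/derivable1_diffP; have [] := dF 1 ltr01.
- move=> t; rewrite in_itv /= andbT => t1; rewrite derive1E.
  by have [_ ->] := dF t (lt_trans ltr01 t1).
Unshelve. all: by end_near.
Qed.

End FractionalPower.

Theorem theorem3p10 (R : realType) (X : completeNormedModType R[i])
    (T : R -> X -> X) (A : set (X * X))
    (hT : C0_semigroup T) (hTb : bounded_semigroup T)
    (hA : op_opp A = generator T)
    (hran : closure (op_ran A) = [set: X])
    (g : R -> R) (mu : {measure set (measurableTypeR R) -> \bar R})
    (hg : stieltjes_rep g 0 0 mu)
    (hg0 : g s @[s --> 0^'+] --> +oo) :
  (forall q : R -> R,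
     complete_bernstein q ->
     (\int[@lebesgue_measure R]_(tau in `[1%R, +oo[)
        (q tau / tau ^+ 2)%:E < +oo)%E ->
     q s @[s --> 0^'+] --> 0 ->
     forall x : X,
       (exists K : R, \forall t \near +oo,
          rnorm (cesaro_mean T t x) <= K * (g (t^-1))^-1) ->
       op_dom (ext_hp_real T (q \o g)) x) /\
  (forall x : X,
     (exists K : R, \forall t \near +oo,
          rnorm (cesaro_mean T t x) <= K * (g (t^-1))^-1) ->
     forall alpha : R, 0 < alpha < 1 ->
       op_dom (ext_hp_real T (fun s => g s `^ alpha)) x).
Proof.
(* The absolute value of a bound is again a bound, and supplies the nonnegativity that [bounded_C0]
   asks for. *)
have [M hM] : exists M, bounded_C0 T M.
  have [M hM] := hTb; exists `|M|; split=> // t x t0.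
  by apply: (le_trans (hM t x t0)); rewrite ler_wpM2r ?rnorm_ge0// ler_norm.
have [_ _ hmu gE'] := hg.
have gE z : 0 < z -> g z = st mu z.
  by move=> z0; rewrite gE'// mul0r !add0r.
have st_oo : st mu s @[s --> 0^'+] --> +oo.
  apply: cvg_trans hg0; apply: near_eq_cvg; near=> s; apply/gE.
  by near: s; exact: nbhs_right_gt.
have inj := op_regularizer_injective hM hA hran.
have decay x : (exists K : R, \forall t \near +oo, rnorm (cesaro_mean T t x) <= K * (g (t^-1))^-1) ->
    exists K : R, \forall t \near +oo, rnorm (cesaro_mean T t x) <= K * (st mu (t^-1))^-1.
  move=> [K hK]; exists K; near=> t.
  have t0 : 0 < t by near: t; apply: nbhs_pinfty_gt; exact: num_real.
  by rewrite -gE ?invr_gt0//; near: t.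
split=> [q hq qint q0 x hx|x hx al /andP[al0 al1]].
  exact: (composition_dom hM hmu st_oo inj gE hq qint q0 (decay x hx)).
apply: (composition_dom hM hmu st_oo inj gE (complete_bernstein_powR al0 al1) _ _ (decay x hx)).
- exact: powR_energy_lty.
- exact: powR_cvg0.
Unshelve. all: by end_near.
Qed.
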